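(* Let $\nu>-1$ and consider on $(\mathbb R_+,y^{2\nu+1}dy)$ the heat semigroup $P^\nu_t$ with generator $\mathscr B_\nu=\frac{\partial^2}{\partial y^2}+\frac{2\nu+1}{y}\frac{\partial}{\partial y}$. Then the Neumann heat kernel associated with this semigroup is given by $$p^N_\nu(x,y,t)=p^N_\nu(y,x,t)=(2t)^{-(\nu+1)}\left(\frac{xy}{2t}\right)^{-\nu}I_\nu\left(\frac{xy}{2t}\right)e^{-\frac{x^2+y^2}{4t}} .$$ This means that for any given function $\varphi\in\mathcal C^1_\nu(0,\infty)$ the solution of the Cauchy problem $$\begin{cases}\dfrac{\partial^2 f}{\partial y^2}+\dfrac{2\nu+1}{y}\dfrac{\partial f}{\partial y}=\dfrac{\partial f}{\partial t}, & y>0,\ t>0,\\ f(y,0)=\varphi(y),\end{cases}$$ is given by $$f(x,t)=P^\nu_t\varphi(x)=\int_0^\infty\varphi(y)\,p^N_\nu(x,y,t)\,y^{2\nu+1}\,dy .$$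
   Context: $I_\nu(z)=\sum_{k=0}^\infty\frac{(z/2)^{\nu+2k}}{\Gamma(k+1)\Gamma(k+\nu+1)}$ is the modified Bessel function of the first kind. $\mathcal C_\nu(0,\infty)$ is the set of $f\in C(0,\infty)$ such that for all $R>0$ one has $\int_0^R|f(y)|\,y^{2\nu+1}\,dy<\infty$ and $\int_R^\infty|f(y)|\,y^{\nu+\frac12}\,dy<\infty$. $\mathcal C^1_\nu(0,\infty)$ is the set of $f\in C^1(0,\infty)$ such that $f$ and $\frac1y f'$ both belong to $\mathcal C_\nu(0,\infty)$. Membership of a function $f$ in $\mathcal C^1_\nu(0,\infty)$ imposes, in particular, the weak Neumann condition $\liminf_{y\to0^+}y^{2\nu+1}|f'(y)|=0$. *)

(* Defs.v *)
From HB Require Import structures.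
From mathcomp Require Import all_boot all_order all_algebra.
From mathcomp Require Import all_classical all_reals all_analysis.

Set Implicit Arguments.
Unset Strict Implicit.
Unset Printing Implicit Defensive.

Import Order.TTheory GRing.Theory Num.Theory.
Import numFieldNormedType.Exports.

Local Open Scope classical_set_scope.
Local Open Scope ring_scope.

(* Functions on (0, oo) are total functions R -> R whose values outside
   (0, oo) are irrelevant.  A function of space and time is written f y t. *)

(* Euler's integral; it converges only for 0 < s, which is the only range in
   which it is used below. *)
Definition Gamma (R : realType) (s : R) : R :=
  \int[lebesgue_measure]_(x in `]0%R, +oo[) (x `^ (s - 1) * expR (- x)).

(* Used only for 0 < z and -1 < nu: powR is the real power of a positive
   base, and the arguments of Gamma are then positive. *)
Definition besselI (R : realType) (nu z : R) : R :=
  limn (series (fun k : nat =>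
    (z / 2) `^ (nu + (2 * k)%:R) / (Gamma (k%:R + 1) * Gamma (k%:R + nu + 1)))).

Section function_spaces.
Context (R : realType).
Implicit Types (nu r : R) (f : R -> R).

(* The two integrals defining C_nu, split at r. *)
Definition Cnu_near nu r f : \bar R :=
  (\int[lebesgue_measure]_(y in `]0%R, r[)
     (`|f y| * y `^ (2 * nu + 1))%:E)%E.

Definition Cnu_far nu r f : \bar R :=
  (\int[lebesgue_measure]_(y in `]r, +oo[)
     (`|f y| * y `^ (nu + 2^-1))%:E)%E.

Definition in_Cnu nu f : Prop :=
  (forall y, 0 < y -> {for y, continuous f}) /\
  (forall r, 0 < r -> (Cnu_near nu r f < +oo)%E /\ (Cnu_far nu r f < +oo)%E).

Definition in_C1nu nu f : Prop :=
  [/\ forall y, 0 < y -> derivable f y 1,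
      forall y, 0 < y -> {for y, continuous (derive1 f)},
      in_Cnu nu f &
      in_Cnu nu (fun y => y^-1 * derive1 f y)].

End function_spaces.

Section cauchy_problem.
Context (R : realType).
Implicit Types (nu y t : R) (phi : R -> R) (f : R -> R -> R).

Definition dy f : R -> R -> R := fun y t => derive1 (f ^~ t) y.
Definition dt f : R -> R -> R := fun y t => derive1 (f y) t.

Definition jointly_continuous f : Prop :=
  forall y t, 0 < y -> 0 < t ->
    {for (y, t), continuous (fun z : R * R => f z.1 z.2)}.

(* Two continuous derivatives in y and one in t, on (0, oo) x (0, oo). *)
Definition C21 f : Prop :=
  (forall y t, 0 < y -> 0 < t ->
     [/\ derivable (f ^~ t) y 1, derivable (dy f ^~ t) y 1
       & derivable (f y) t 1]) /\
  [/\ jointly_continuous f, jointly_continuous (dy f),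
      jointly_continuous (dy (dy f)) & jointly_continuous (dt f)].

Definition bessel_heat_equation nu f : Prop :=
  forall y t, 0 < y -> 0 < t ->
    dy (dy f) y t + (2 * nu + 1) / y * dy f y t = dt f y t.

(* f extends continuously to (0, oo) x [0, oo) by phi at t = 0. *)
Definition initial_datum phi f : Prop :=
  forall y, 0 < y ->
    f z.1 z.2 @[z --> within [set z : R * R | 0 < z.2] (nbhs (y, 0 : R))]
      --> phi y.

(* The weighted flux y^(2 nu + 1) f_y vanishes on {0} x (0, oo), the limit
   being joint in (y, t), that is, locally uniform in t. *)
Definition neumann_condition nu f : Prop :=
  forall t, 0 < t ->
    z.1 `^ (2 * nu + 1) * dy f z.1 z.2
      @[z --> within [set z : R * R | 0 < z.1] (nbhs (0 : R, t))]
      --> (0 : R).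

(* t |-> f(., t), with value phi at t = 0, is a continuous curve from [0, oo)
   to C_nu. *)
Definition continuous_in_Cnu nu phi f : Prop :=
  forall r : R, 0 < r ->
    [/\ Cnu_near nu r (fun y => f y t - phi y) @[t --> 0^'+] --> 0%E,
        Cnu_far nu r (fun y => f y t - phi y) @[t --> 0^'+] --> 0%E &
        forall s : R, 0 < s ->
          Cnu_near nu r (fun y => f y t - f y s) @[t --> s] --> 0%E /\
          Cnu_far nu r (fun y => f y t - f y s) @[t --> s] --> 0%E].

(* The last three clauses fix the class in which one can speak of the
   solution.  Without the Neumann condition the equation has further
   solutions (for nu < 0, those behaving like y^(-2 nu) at 0); and
   t^-(nu+1) exp(-y^2/4t) is a nonzero classical solution satisfying it that
   tends to 0 locally uniformly in y > 0 as t -> 0+, but not in C_nu. *)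
Definition cauchy_neumann_solution nu phi f : Prop :=
  [/\ C21 f /\ bessel_heat_equation nu f,
      initial_datum phi f,
      neumann_condition nu f,
      forall t, 0 < t -> in_C1nu nu (f ^~ t) &
      continuous_in_Cnu nu phi f].

End cauchy_problem.

Section neumann_heat_kernel.
Context (R : realType).
Implicit Types (nu x y t : R) (phi : R -> R) (p : R -> R -> R -> R).

Definition pN nu x y t : R :=
  (2 * t) `^ (- (nu + 1)) * (x * y / (2 * t)) `^ (- nu)
  * besselI nu (x * y / (2 * t)) * expR (- ((x ^+ 2 + y ^+ 2) / (4 * t))).

Definition kernel_operator nu p phi x t : R :=
  \int[lebesgue_measure]_(y in `]0%R, +oo[)
     (phi y * p x y t * y `^ (2 * nu + 1)).

(* p is the kernel of the solution operator of the Cauchy-Neumann problem: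
   for every phi in C^1_nu the integral converges absolutely and is the
   unique solution with initial datum phi. *)
Definition is_neumann_heat_kernel nu p : Prop :=
  forall phi, in_C1nu nu phi ->
    [/\ forall x t, 0 < x -> 0 < t ->
          (@lebesgue_measure R).-integrable `]0%R, +oo[
            (fun y => (phi y * p x y t * y `^ (2 * nu + 1))%:E),
        cauchy_neumann_solution nu phi (kernel_operator nu p phi) &
        forall f, cauchy_neumann_solution nu phi f ->
          forall x t, 0 < x -> 0 < t -> f x t = kernel_operator nu p phi x t].

End neumann_heat_kernel.

(* Main.v *)
(** Factoring the branch out of the Bessel function turns the kernel into
    [K(x,y,t) = 2 (4t)^-(nu+1) E_nu((xy/4t)^2) exp(-(x^2+y^2)/4t)] with [E_nu] an
    entire power series satisfying [E_nu' = E_(nu+1)] and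
    [w E_(nu+2) + (nu+1) E_(nu+1) = E_nu].  These two relations give the heat
    equation for [K], and integrating the series against Gaussians gives its
    total mass 1.

    Existence.  Gaussian bounds on [K] allow differentiation under the integral,
    and the decay off the diagonal gives the initial datum.  The norm of [C_nu]
    is equivalent to the [L^1] norm with weight [(1+y^2)^-s y^(2nu+1)],
    [s = (nu+1/2)/2]; by symmetry of [K] the weighted norm of [P_t |phi|] is the
    integral of [|phi|] against [P_t] of the weight, which converges by
    domination, so Pratt's theorem gives continuity of [t |-> P_t phi] in [C_nu].

    Uniqueness.  For a solution [f], the pairing
    [g(s) = int f(y,s) K(x,y,T-s) y^(2nu+1) dy] is constant on [(0,T)]: truncated
    to [[1/n,n]] with a cutoff at [n], its derivative consists of a commutator of
    size [O(n^-2)] and of the flux through [1/n], which the Neumann condition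
    makes small locally uniformly in [s].  As [s] tends to [0] and to [T], [g(s)]
    tends to [P_T phi(x)] and to [f(x,T)]. *)

Require Import Defs.
From HB Require Import structures.
From mathcomp Require Import all_boot all_order all_algebra.
From mathcomp Require Import all_classical all_reals all_analysis.
From mathcomp Require Import measurable_realfun.
From mathcomp Require Import ring lra.

Set Implicit Arguments.
Unset Strict Implicit.
Unset Printing Implicit Defensive.

Import Order.TTheory GRing.Theory Num.Theory.
Import numFieldNormedType.Exports.

Local Open Scope classical_set_scope.
Local Open Scope ring_scope.

(** With the branch removed, [heatK] makes sense at x = 0, where the Neumann condition is read off,
    and its derivatives only involve the indices nu + 1 and nu + 2 with factors y^2 and y^4. These
    factors move onto the datum, so every derivative of a potential is a combination of potentials
    and the same Gaussian estimates serve for all; this is why the weight y^(2nu+1) is kept inside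
    the datum. For continuity in C_nu the natural majorant P_t |phi| moves with t; only the
    convergence of its integral is accessible, and duality provides it. In the uniqueness part f is
    controlled near 0 only through its flux and at infinity only through an integral, so the pairing
    cannot be differentiated directly. What survives the removal of the truncation is a Lipschitz
    bound with arbitrarily small constant. The two ends differ in nature: as s tends to 0 the kernel
    stays regular and convergence of f in C_nu is used; as s tends to T the kernel concentrates and
    joint continuity of f at (x, T) is used. *)

(** * Exhaustion of the half-line by compact intervals *)

Section exhaustion.
Context {R : realType}.
Notation mu := (@lebesgue_measure R).

Lemma measurable_halfline : measurable (`]0%R, +oo[ : set R).
Proof. exact: measurable_itv. Qed.

(** Monotone convergence. The integrands may be singular at 0, so integration by parts and
    substitution are carried out on compact intervals inside the open half-line and then passed to
    this limit. *)
Lemma ge0_cvg_integral_exhaustion (f : R -> R) (a b : R^nat) :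
  measurable_fun (`]0, +oo[ : set R) f -> (forall y, 0 < y -> 0 <= f y) ->
  (forall n, 0 < a n) -> nonincreasing_seq a -> nondecreasing_seq b ->
  (forall y, 0 < y -> exists n, a n <= y <= b n) ->
  (\int[mu]_(y in `[a n, b n]) (f y)%:E)%E @[n --> \oo]
    --> (\int[mu]_(y in `]0%R, +oo[) (f y)%:E)%E.
Proof.
move=> mf f0 a0 na nb ab.
have -> : (`]0%R, +oo[%classic : set R) = \bigcup_n `[a n, b n]%classic.
  apply/seteqP; split => y /=.
    rewrite in_itv/= andbT => y0; have [n /andP[h1 h2]] := ab _ y0.
    by exists n => //=; rewrite in_itv/= h1 h2.
  move=> [n _]/=; rewrite !in_itv/= andbT => /andP[+ _].
  exact: lt_le_trans.
have sub n : `[a n, b n]%classic `<=` (`]0, +oo[%classic : set R).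
  by move=> y /=; rewrite !in_itv/= andbT => /andP[+ _]; exact: lt_le_trans.
apply: ge0_nondecreasing_set_cvg_integral => //.
- move=> m n mn; apply/subsetPset => y /=; rewrite !in_itv/= => /andP[h1 h2].
  by rewrite (le_trans _ h1) ?na// (le_trans h2)// nb.
- by move=> n; apply/measurable_EFinP; apply: measurable_funS mf => //.
- by move=> n y /sub /=; rewrite in_itv/= andbT lee_fin => /f0.
Qed.

Lemma harmonic_exhaustion (y : R) : 0 < y ->
  exists n, (n.+1%:R)^-1 <= y <= n.+1%:R.
Proof.
move=> y0.
have [n hn] : exists n : nat, Num.max y y^-1 < n.+1%:R.
  exists (Num.truncn (Num.max y y^-1)); exact: truncnS_gt.
move: hn; rewrite gt_max => /andP[h1 h2].
exists n; rewrite (ltW h1) andbT -[leRHS]invrK lef_pV2 ?posrE ?invr_gt0//.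
exact: ltW.
Qed.

Lemma cvg_natS : (n.+1%:R : R) @[n --> \oo] --> +oo.
Proof.
apply/cvgryPge => A; near=> n.
apply: (@le_trans _ _ n%:R); last by rewrite ler_nat.
by near: n; apply: nbhs_infty_ger.
Unshelve. all: end_near. Qed.

Lemma cvg_harmonic_at_right : (n.+1%:R^-1 : R) @[n --> \oo] --> 0^'+.
Proof.
move=> A [e /= e0 he].
have : \forall n \near \oo, (n.+1%:R^-1 : R) < e.
  have /cvgrPdist_lt/(_ _ e0) := @cvg_harmonic R.
  by apply: filterS => n; rewrite sub0r normrN ger0_norm// invr_ge0.
apply: filterS => n hn; apply: he; rewrite /= ?invr_gt0//.
by rewrite sub0r normrN ger0_norm// invr_ge0.
Qed.

End exhaustion.

(** * Powers against exponentials *)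

Section powR_complements.
Context {R : realType}.

(** Multiplying [ln z < z] at z = c x / s by s gives the bound with constant (s / c)^s. *)
Lemma powR_le_expR (s c : R) : 0 <= s -> 0 < c ->
  exists2 C, 0 < C & forall x, 0 < x -> x `^ s <= C * expR (c * x).
Proof.
rewrite le_eqVlt => /predU1P[<-|s0] c0.
  exists 1 => // x x0; rewrite powRr0 mul1r -expR0 ler_expR.
  by rewrite mulr_ge0// ltW.
exists (expR (- s * ln (c / s))); first exact: expR_gt0.
move=> x x0; rewrite -expRD {1}/powR gt_eqF// ler_expR.
have cs0 : 0 < c / s by rewrite divr_gt0.
have : ln (c / s * x) < c / s * x by apply: ln_sublinear; rewrite mulr_gt0.
rewrite lnM ?posrE// => /ltW h.
have : s * (ln (c / s) + ln x) <= s * (c / s * x) by rewrite ler_pM2l.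
by rewrite !mulrA (mulrC s c) mulfK ?gt_eqF//; lra.
Qed.

Lemma continuous_powR (s x : R) : 0 < x -> {for x, continuous (@powR R ^~ s)}.
Proof.
move=> x0; apply/differentiable_continuous/derivable1_diffP.
by have [] := is_derive1_powR s x0.
Qed.

Lemma powRS (x s : R) : 0 < x -> x `^ (s + 1) = x `^ s * x.
Proof.
by move=> x0; rewrite powRD ?powRr1 ?(ltW x0)// (gt_eqF x0) implybT.
Qed.

Lemma measurable_powR_id (s : R) (A : set R) : measurable_fun A (@powR R ^~ s).
Proof. by apply: measurable_funTS; exact: measurable_powR. Qed.

Lemma cvg_powR_expR (s : R) : 0 < s ->
  x `^ s * expR (- x) @[x --> +oo] --> 0.
Proof.
move=> s0.
(* Half of the exponential decay absorbs the power; the other half still tends to 0. *)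
have h0 : (0 : R) < 2^-1 by lra.
have [C C0 hC] := powR_le_expR (ltW s0) h0.
apply/cvgrPdist_le => e e0; near=> x.
rewrite sub0r normrN ger0_norm ?mulr_ge0 ?powR_ge0 ?expR_ge0//.
apply: (@le_trans _ _ (C * expR (2^-1 * x) * expR (- x))).
  by rewrite ler_wpM2r ?expR_ge0// hC.
rewrite -mulrA -expRD -ler_pdivlMl// -[leRHS]lnK ?posrE ?mulr_gt0 ?invr_gt0//.
rewrite ler_expR.
have : - (2 * ln (C^-1 * e)) <= x by near: x; apply: nbhs_pinfty_ge; rewrite num_real.
by lra.
Unshelve. all: end_near. Qed.

End powR_complements.

(** * The fundamental theorem of calculus on segments *)

Section ftc_closed.
Context {R : realType}.
Notation mu := (@lebesgue_measure R).

Lemma continuous_segment_integrable (f : R -> R) (a b : R) :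
  (forall x, a <= x <= b -> {for x, continuous f}) ->
  mu.-integrable `[a, b] (EFin \o f).
Proof.
move=> cf; apply: continuous_compact_integrable; first exact: segment_compact.
apply: continuous_in_subspaceT => x; rewrite inE/= in_itv/= => h.
exact: cf.
Qed.

Lemma integrable_scale (D : set R) (f : R -> R) (c : R) : measurable D ->
  mu.-integrable D (EFin \o f) -> mu.-integrable D (EFin \o (fun x => c * f x)).
Proof.
move=> mD h; rewrite (_ : EFin \o _ = (fun x => c%:E * (EFin \o f) x)%E) //.
exact: integrableZl.
Qed.

Lemma is_derive_continuous (f : R -> R) (x df : R) :
  is_derive x 1 f df -> {for x, continuous f}.
Proof.
by move=> [h _]; apply/differentiable_continuous/derivable1_diffP.
Qed.

Lemma integral_FTC_segment (F f : R -> R) (a b : R) : a < b ->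
  (forall x, a <= x <= b -> is_derive x 1 F (f x)) ->
  (forall x, a <= x <= b -> {for x, continuous f}) ->
  (\int[mu]_(x in `[a, b]) (f x)%:E = (F b)%:E - (F a)%:E)%E.
Proof.
move=> ab dF cf.
have cF x : a <= x <= b -> {for x, continuous F}.
  by move=> h; apply: is_derive_continuous (dF _ h).
apply: continuous_FTC2 => //.
- by apply: continuous_in_subspaceT => x; rewrite inE/= in_itv/= => h; exact: cf.
- split => [x|//|//].
  + rewrite in_itv/= => /andP[h1 h2].
    by have [] := dF x; rewrite ?(ltW h1) ?(ltW h2).
  + by apply/cvg_at_right_filter/cF; rewrite lexx ltW.
  + by apply/cvg_at_left_filter/cF; rewrite lexx ltW.
- move=> x; rewrite in_itv/= => /andP[h1 h2].
  by rewrite derive1E; apply: derive_val; apply: dF; rewrite (ltW h1) ltW.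
Qed.

Lemma Rintegral_FTC_segment (F f : R -> R) (a b : R) : a < b ->
  (forall x, a <= x <= b -> is_derive x 1 F (f x)) ->
  (forall x, a <= x <= b -> {for x, continuous f}) ->
  \int[mu]_(x in `[a, b]) f x = F b - F a.
Proof.
by move=> ab dF cf; rewrite /Rintegral (integral_FTC_segment ab dF cf) -EFinB.
Qed.

Lemma is_derive_comp_expR (f : R -> R) (x df : R) : is_derive x 1 f df ->
  is_derive x 1 (fun y => expR (f y)) (expR (f x) * df).
Proof. by move=> h; exact: (is_derive1_comp (is_derive_expR (f x)) h). Qed.

End ftc_closed.

(** * Euler's Gamma function *)

Section gamma.
Context {R : realType}.
Notation mu := (@lebesgue_measure R).
Implicit Types s x : R.

Definition gamma_density s x := x `^ (s - 1) * expR (- x).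

Definition gamma_ereal s := (\int[mu]_(x in `]0%R, +oo[) (gamma_density s x)%:E)%E.

Lemma gamma_density_ge0 s x : 0 <= gamma_density s x.
Proof. by rewrite mulr_ge0 ?powR_ge0 ?expR_ge0. Qed.

Lemma continuous_gamma_density s x : 0 < x ->
  {for x, continuous (gamma_density s)}.
Proof.
move=> x0; apply: cvgM; first exact: continuous_powR.
apply: continuous_comp; first exact: cvgN.
exact: continuous_expR.
Qed.

Lemma measurable_gamma_density s (A : set R) : measurable_fun A (gamma_density s).
Proof.
apply: measurable_funM; first exact: measurable_powR_id.
by apply: measurableT_comp => //; exact: measurable_funTS.
Qed.

Lemma is_derive_gamma_primitive s x : 0 < x ->
  is_derive x 1 (fun y => y `^ s * expR (- y))
    (s * gamma_density s x - gamma_density (s + 1) x).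
Proof.
move=> x0.
have h1 := is_derive1_powR s x0.
apply: is_derive_eq.
by rewrite /gamma_density /GRing.scale/= addrK; ring.
Qed.

(** Integration of the derivative of y^s exp(-y): the functional equation of Gamma with its boundary
    term. *)
Lemma gamma_segment s (a b : R) : 0 < s -> 0 < a -> a < b ->
  (s%:E * \int[mu]_(x in `[a, b]) (gamma_density s x)%:E =
   \int[mu]_(x in `[a, b]) (gamma_density (s + 1) x)%:E
   + (b `^ s * expR (- b) - a `^ s * expR (- a))%:E)%E.
Proof.
move=> s0 a0 ab.
have pos x : a <= x <= b -> 0 < x by move=> /andP[+ _]; exact: lt_le_trans.
have I r : mu.-integrable `[a, b] (EFin \o gamma_density r).
  apply: continuous_segment_integrable => x /pos; exact: continuous_gamma_density.
have dF x : a <= x <= b -> is_derive x 1 (fun y => y `^ s * expR (- y))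
    (s * gamma_density s x - gamma_density (s + 1) x).
  by move=> /pos; exact: is_derive_gamma_primitive.
have cf x : a <= x <= b -> {for x, continuous (fun x =>
    s * gamma_density s x - gamma_density (s + 1) x)}.
  move=> /pos x0; apply: cvgB; last exact: continuous_gamma_density.
  by apply: cvgM; [exact: cvg_cst|exact: continuous_gamma_density].
have := Rintegral_FTC_segment ab dF cf.
rewrite RintegralB//=; last first.
  exact: integrable_scale.
rewrite RintegralZl// => e.
have J r : (\int[mu]_(x in `[a, b]) (gamma_density r x)%:E)%E \is a fin_num.
  by apply: integrable_fin_num (I r).
rewrite -(fineK (J s)) -(fineK (J (s + 1))).
rewrite -EFinM -EFinD; congr (_%:E).
by move: e; rewrite /Rintegral; lra.
Qed.

(** Stated in the extended reals, so that it is available before finiteness is known and can be used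
    to prove it. *)
Lemma gamma_ereal_rec s : 0 < s -> gamma_ereal (s + 1) = (s%:E * gamma_ereal s)%E.
Proof.
move=> s0.
(* Starting at 2 instead of 1 makes the first interval nondegenerate, as [gamma_segment] requires
   [a < b]. *)
have H r : (\int[mu]_(y in `[(n.+2%:R^-1)%R, n.+2%:R%R]) (gamma_density r y)%:E)%E
    @[n --> \oo] --> gamma_ereal r.
  apply: ge0_cvg_integral_exhaustion => //.
  - exact: measurable_gamma_density.
  - by move=> y _; exact: gamma_density_ge0.
  - by move=> m n mn; rewrite lef_pV2 ?posrE// ler_nat !ltnS.
  - by move=> m n mn; rewrite ler_nat !ltnS.
  - move=> y /harmonic_exhaustion [n /andP[h1 h2]]; exists n.
    rewrite (le_trans _ h1) ?(le_trans h2) ?ler_nat//.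
    by rewrite lef_pV2 ?posrE// ler_nat.
have L := cvgeZl (isT : s%:E \is a fin_num) (H s).
suff K : (s%:E * \int[mu]_(y in `[(n.+2%:R^-1)%R, n.+2%:R%R]) (gamma_density s y)%:E)%E
    @[n --> \oo] --> gamma_ereal (s + 1).
  exact: cvg_unique K L.
have e n : (s%:E * \int[mu]_(y in `[(n.+2%:R^-1)%R, n.+2%:R%R]) (gamma_density s y)%:E =
   \int[mu]_(x in `[(n.+2%:R^-1)%R, n.+2%:R%R]) (gamma_density (s + 1) x)%:E
   + (n.+2%:R `^ s * expR (- n.+2%:R) - (n.+2%:R^-1) `^ s * expR (- n.+2%:R^-1))%:E)%E.
  apply: gamma_segment => //.
  apply: (@lt_trans _ _ 1); rewrite ?ltr1n//.
  by rewrite invf_lt1 ?ltr1n.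
rewrite (eq_cvg _ _ e) -[gamma_ereal _]adde0; apply: cvgeD; [by rewrite fin_num_adde_defl|exact: H|].
have c2 : (n.+2%:R : R) @[n --> \oo] --> +oo.
  by rewrite (cvg_shiftS (fun n => n.+1%:R : R)); exact: cvg_natS.
have c1 : (n.+2%:R^-1 : R) @[n --> \oo] --> 0^'+.
  by rewrite (cvg_shiftS (fun n => n.+1%:R^-1 : R)); exact: cvg_harmonic_at_right.
apply: cvg_EFin; first exact: nearW.
rewrite (_ : 0%R = 0 - 0 * expR (- 0)); last by rewrite mul0r subr0.
apply: cvgB; first exact: (cvg_comp _ _ c2 (cvg_powR_expR s0)).
apply: cvgM; first exact: (cvg_comp _ _ c1 (powR_cvg0 s0)).
apply: (cvg_comp _ (fun y : R => expR (- y)) c1).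
by apply: cvg_at_right_filter; apply: continuous_comp;
  [exact: opp_continuous|exact: continuous_expR].
Qed.

(** The recursion reduces the claim to s + 1, whose density carries a positive power of x: it has no
    singularity at 0 and an exponential dominates it. *)
Lemma gamma_ereal_lty s : 0 < s -> (gamma_ereal s < +oo)%E.
Proof.
move=> s0.
suff h : (gamma_ereal (s + 1) < +oo)%E.
  move: h; rewrite gamma_ereal_rec// => h.
  rewrite ltNge leye_eq; apply/eqP => e; move: h; rewrite e gt0_muley ?lte_fin//.
have h0 : (0 : R) < 2^-1 by lra.
have [C C0 hC] := powR_le_expR (ltW s0) h0.
apply: (@le_lt_trans _ _ (\int[mu]_(x in `]0%R, +oo[) (C * expR (- (2^-1 * x)))%:E)%E).
  apply: ge0_le_integral => //.
  - by move=> x _; rewrite lee_fin gamma_density_ge0.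
  - by apply/measurable_EFinP; exact: measurable_gamma_density.
  - apply/measurable_EFinP; apply: measurable_funM => //.
    by apply: measurableT_comp => //; apply: measurable_funN; exact: measurable_funM.
  - move=> x /=; rewrite in_itv/= andbT => x0; rewrite lee_fin /gamma_density addrK.
    apply: le_trans (ler_wpM2r (expR_ge0 _) (hC _ x0)) _.
    by rewrite -mulrA -expRD ler_wpM2l ?(ltW C0)// ler_expR; lra.
rewrite integral_itv_obnd_cbnd; last first.
  apply/measurable_EFinP; apply: measurable_funM => //.
  by apply: measurableT_comp => //; apply: measurable_funN; exact: measurable_funM.
pose F x := - (2 * C) * expR (- (2^-1 * x)).
have dF x : is_derive x 1 F (C * expR (- (2^-1 * x))).
  have h : is_derive x 1 (fun y : R => - (2^-1 * y)) (- 2^-1).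
    by apply: is_derive_eq; rewrite /GRing.scale/= mulr1.
  rewrite /F; apply: is_derive_eq; rewrite /GRing.scale/=.
  by field.
rewrite (@ge0_continuous_FTC2y _ _ F _ 0).
- by rewrite -EFinB ltry.
- by move=> x _; rewrite mulr_ge0 ?(ltW C0) ?expR_ge0.
- apply: continuous_subspaceT => x; apply: cvgM; first exact: cvg_cst.
  apply: continuous_comp; last exact: continuous_expR.
  by apply: cvgN; apply: cvgM; [exact: cvg_cst|].
- rewrite -(mulr0 (- (2 * C))); apply: cvgM; first exact: cvg_cst.
  apply: (cvg_comp (fun x : R => 2^-1 * x) (fun x => expR (- x)) _ (@cvgr_expR R)).
  exact: gt0_cvgMry.
- by move=> x _; case: (dF x).
- by apply/cvg_at_right_filter; exact: is_derive_continuous (dF 0).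
- by move=> x _; rewrite derive1E; exact: derive_val.
Qed.

Lemma gamma_ereal_gt0 s : (0 < gamma_ereal s)%E.
Proof.
have pos x : 1 <= x <= 2 -> 0 < x by move=> /andP[+ _]; exact: lt_le_trans.
(* A lower bound for the density on [[1, 2]], from 0 <= ln x <= ln 2 and x <= 2. *)
pose c := expR (- `|s - 1| * ln 2 - 2).
have c0 : 0 < c by exact: expR_gt0.
apply: (@lt_le_trans _ _ (\int[mu]_(x in `[1%R, 2%R]) (cst c%:E) x)%E).
  rewrite integral_cst//= lebesgue_measure_itv/= lte_fin ltr1n -EFinB -EFinM lte_fin.
  by rewrite mulr_gt0//; lra.
apply: (@le_trans _ _ (\int[mu]_(x in `[1%R, 2%R]) (gamma_density s x)%:E)%E).
  apply: ge0_le_integral => //.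
  - by move=> x _; rewrite lee_fin ltW.
  - by apply/measurable_EFinP; exact: measurable_gamma_density.
  - move=> x /=; rewrite in_itv/= => /andP[h1 h2].
    have x0 : 0 < x by lra.
    rewrite lee_fin /gamma_density /powR gt_eqF// -expRD ler_expR.
    apply: lerD; last lra.
    rewrite mulNr lerNl; apply: le_trans (ler_norm _) _.
    rewrite normrN normrM ler_wpM2l// ger0_norm ?ln_ge0//.
    by rewrite ler_ln ?posrE.
apply: ge0_subset_integral => //.
- by apply/measurable_EFinP; exact: measurable_gamma_density.
- by move=> x _; rewrite lee_fin gamma_density_ge0.
- by move=> x /=; rewrite !in_itv/= andbT; exact: pos.
Qed.

Lemma gamma_erealE s : 0 < s -> gamma_ereal s = (Gamma s)%:E.
Proof.
move=> s0; rewrite /Gamma /Rintegral fineK// ge0_fin_numE ?gamma_ereal_lty//.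
by rewrite ltW// gamma_ereal_gt0.
Qed.

Lemma Gamma_gt0 s : 0 < s -> 0 < Gamma s.
Proof. by move=> s0; rewrite -lte_fin -gamma_erealE// gamma_ereal_gt0. Qed.

Lemma GammaS s : 0 < s -> Gamma (s + 1) = s * Gamma s.
Proof.
move=> s0; apply: EFin_inj.
by rewrite EFinM -!gamma_erealE ?gamma_ereal_rec// addr_gt0.
Qed.

Lemma Gamma1 : Gamma 1 = 1 :> R.
Proof.
apply: EFin_inj; rewrite -gamma_erealE// /gamma_ereal.
pose F (x : R) := - expR (- x).
have dF x : is_derive x 1 F (expR (- x)).
  by rewrite /F; apply: is_derive_eq; rewrite mulrN1 opprK.
under eq_integral do rewrite /gamma_density subrr powRr0 mul1r.
rewrite integral_itv_obnd_cbnd; last first.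
  by apply/measurable_EFinP; apply: measurableT_comp.
rewrite (@ge0_continuous_FTC2y _ _ F _ 0).
- by rewrite -EFinB /F oppr0 expR0 sub0r opprK.
- by move=> x _; rewrite expR_ge0.
- apply: continuous_subspaceT => x.
  by apply: continuous_comp; [exact: opp_continuous|exact: continuous_expR].
- by rewrite -oppr0; apply: cvgN; exact: cvgr_expR.
- by move=> x _; case: (dF x).
- by apply/cvg_at_right_filter; exact: is_derive_continuous (dF 0).
- by move=> x _; rewrite derive1E; exact: derive_val.
Qed.

Lemma GammaSn (n : nat) : Gamma (n%:R + 1) = n`!%:R :> R.
Proof.
elim: n => [|n IH]; first by rewrite add0r Gamma1.
by rewrite -natr1 GammaS ?IH ?factS ?natrM -?natr1// ltr_wpDl.
Qed.

End gamma.

(** * Gaussian moments as values of Gamma *)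

Section gaussian_moment.
Context {R : realType}.
Notation mu := (@lebesgue_measure R).

(** The substitution x = b y^2, on a segment away from 0, where the density is continuous. *)
Lemma gaussian_moment_segment (s b c d : R) : 0 < b -> 0 < c -> c < d ->
  (\int[mu]_(x in `[(b * c ^+ 2)%R, (b * d ^+ 2)%R]) (gamma_density s x)%:E =
   (2 * b `^ s)%:E *
     \int[mu]_(y in `[c, d]) (y `^ (2 * s - 1) * expR (- (b * y ^+ 2)))%:E)%E.
Proof.
move=> b0 c0 cd; pose F (y : R) := b * y ^+ 2.
have dF (y : R) : is_derive y 1 F (2 * b * y).
  by rewrite /F; apply: is_derive_eq; rewrite /GRing.scale/=; ring.
have dFE : (F^`())%classic = fun y => 2 * b * y.
  by apply/funext => y; rewrite derive1E; exact: derive_val.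
have cF' (y : R) : {for y, continuous (fun y => 2 * b * y)}.
  by apply: cvgM; [exact: cvg_cst|].
have cF (y : R) : {for y, continuous F} by apply: is_derive_continuous (dF y).
rewrite (@integration_by_substitution_increasing _ F) ?(ltW cd)//; last 6 first.
- move=> x y; rewrite !in_itv/= => /andP[cx _] _ xy; rewrite ltr_pM2l//.
  by rewrite !expr2; nra.
- by rewrite dFE => y _; exact: cF'.
- by rewrite dFE; apply/cvg_ex; exists (2 * b * c); apply/cvg_at_right_filter/cF'.
- by rewrite dFE; apply/cvg_ex; exists (2 * b * d); apply/cvg_at_left_filter/cF'.
- split; first by move=> x _; case: (dF x).
    exact/cvg_at_right_filter/cF.
  exact/cvg_at_left_filter/cF.
- apply: continuous_in_subspaceT => x; rewrite inE/= in_itv/= => /andP[h _].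
  apply: continuous_gamma_density; apply: lt_le_trans h.
  by rewrite /F mulr_gt0// exprn_gt0.
rewrite -ge0_integralZl//; last 3 first.
- apply/measurable_EFinP; apply: measurable_funM.
    exact: measurable_powR_id.
  by apply: measurableT_comp => //; apply: measurable_funN; apply: measurable_funM.
- by move=> y _; rewrite lee_fin mulr_ge0 ?powR_ge0 ?expR_ge0.
- by rewrite lee_fin mulr_ge0 ?powR_ge0.
apply: eq_integral => y; rewrite inE/= in_itv/= => /andP[cy _].
have y0 : 0 < y by exact: lt_le_trans cy.
rewrite -EFinM; congr (_%:E) => /=.
have -> : ((gamma_density s \o F) * (F^`())%classic) y = gamma_density s (b * y ^+ 2) * (2 * b * y).
  by rewrite -[LHS]/(gamma_density s (F y) * (F^`())%classic y) dFE.
rewrite /gamma_density powRM ?(ltW b0) ?sqr_ge0//.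
rewrite -(powR_mulrn 2 (ltW y0)) -powRrM.
have -> : b `^ s = b `^ (s - 1) * b by rewrite -powRS// subrK.
have -> : y `^ (2 * s - 1) = y `^ (2%:R * (s - 1)) * y.
  by rewrite -powRS//; congr (_ `^ _); ring.
by ring.
Qed.

Lemma gaussian_moment (s b : R) : 0 < s -> 0 < b ->
  (\int[mu]_(y in `]0%R, +oo[) (y `^ (2 * s - 1) * expR (- (b * y ^+ 2)))%:E =
   (Gamma s / (2 * b `^ s))%:E)%E.
Proof.
move=> s0 b0.
pose a n : R := n.+2%:R^-1; pose d n : R := n.+2%:R.
have a0 n : 0 < a n by rewrite invr_gt0.
have na : nonincreasing_seq a.
  by move=> m n mn; rewrite lef_pV2 ?posrE// ler_nat !ltnS.
have nd : nondecreasing_seq d by move=> m n mn; rewrite ler_nat !ltnS.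
have ex y : 0 < y -> exists n, a n <= y <= d n.
  move=> /harmonic_exhaustion [n /andP[h1 h2]]; exists n.
  rewrite (le_trans _ h1) ?(le_trans h2) ?ler_nat//.
  by rewrite lef_pV2 ?posrE// ler_nat.
have ad n : a n < d n.
  apply: (@lt_trans _ _ 1); rewrite ?ltr1n//.
  by rewrite invf_lt1 ?ltr1n.
have sqle (u v : R) : 0 <= u -> u <= v -> b * u ^+ 2 <= b * v ^+ 2.
  by move=> u0 uv; rewrite ler_pM2l// lerXn2r// nnegrE//; exact: le_trans uv.
have H1 : (\int[mu]_(y in `[(b * a n ^+ 2)%R, (b * d n ^+ 2)%R]) (gamma_density s y)%:E)%E
    @[n --> \oo] --> gamma_ereal s.
  apply: (@ge0_cvg_integral_exhaustion _ _ (fun n => b * a n ^+ 2) (fun n => b * d n ^+ 2)).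
  - exact: measurable_gamma_density.
  - by move=> y _; exact: gamma_density_ge0.
  - by move=> n; rewrite mulr_gt0// exprn_gt0.
  - by move=> m n mn; apply: sqle; [exact: ltW|exact: na].
  - by move=> m n mn; apply: sqle; [exact: ler0n|exact: nd].
  - move=> y y0; have [] := ex (Num.sqrt (y / b)); first by rewrite sqrtr_gt0 divr_gt0.
    move=> n /andP[h1 h2]; exists n.
    have e : b * Num.sqrt (y / b) ^+ 2 = y.
      by rewrite sqr_sqrtr ?divr_ge0 ?(ltW y0) ?(ltW b0)// mulrC divfK// gt_eqF.
    by rewrite -e !sqle ?sqrtr_ge0// ltW.
have H2 : ((2 * b `^ s)%:E *
     \int[mu]_(y in `[a n, d n]) (y `^ (2 * s - 1) * expR (- (b * y ^+ 2)))%:E)%E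
    @[n --> \oo] --> ((2 * b `^ s)%:E *
     \int[mu]_(y in `]0%R, +oo[) (y `^ (2 * s - 1) * expR (- (b * y ^+ 2)))%:E)%E.
  apply: cvgeZl => //; apply: ge0_cvg_integral_exhaustion => //.
    apply: measurable_funM; first exact: measurable_powR_id.
    by apply: measurableT_comp => //; apply: measurable_funN; apply: measurable_funM.
  by move=> y _; rewrite mulr_ge0 ?powR_ge0 ?expR_ge0.
move: H1; rewrite (eq_cvg _ _ (fun n => gaussian_moment_segment s b0 (a0 n) (ad n))) => H1.
have c0 : 0 < 2 * b `^ s by rewrite mulr_gt0// powR_gt0.
have E := cvg_unique (@ereal_hausdorff R) H1 H2; rewrite gamma_erealE// in E.
by rewrite [Gamma s / _]mulrC EFinM (E _) muleA -EFinM mulVf ?mul1e// gt_eqF.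
Qed.

End gaussian_moment.

(** * The entire series underlying the Bessel function *)

Section bessel_series.
Context {R : realType}.
Implicit Types m w z a : R.

Definition bessel_coeff m (k : nat) : R := (k`!%:R * Gamma (k%:R + m + 1))^-1.

(* The modified Bessel function with its branch factored out:
   I_m(z) = (z/2)^m besselE m (z^2/4). *)
Definition besselE m w : R := limn (pseries (bessel_coeff m) w).

Lemma geometric_bound (g : R^nat) (a : R) K : 0 < a -> (forall k, 0 < g k) ->
  (forall k, (K <= k)%N -> g k.+1 <= a * g k) ->
  exists2 C, 0 < C & forall k, g k <= C * a ^+ k.
Proof.
move=> a0 g0 step.
(* This sum dominates each of its terms, which settles the indices up to K; beyond them the ratio
   bound propagates the estimate. *)
pose C := \sum_(j < K.+1) g j * a ^- j.
have tge0 j : 0 <= g j * a ^- j by rewrite mulr_ge0 ?invr_ge0 ?exprn_ge0 ?ltW.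
have small k : (k <= K)%N -> g k <= C * a ^+ k.
  move=> kK; rewrite -ler_pdivrMr ?exprn_gt0//.
  rewrite /C (bigD1 (Ordinal (kK : (k < K.+1)%N)))//= lerDl.
  by apply: sumr_ge0 => i _; exact: tge0.
exists C.
  have := small 0 isT; rewrite expr0 mulr1; exact: lt_le_trans.
elim=> [|k IH]; first exact: small.
have [kK|] := leqP k.+1 K; first exact: small.
rewrite ltnS => Kk; apply: le_trans (step _ Kk) _.
by rewrite exprS mulrCA ler_pM2l.
Qed.

Lemma Gamma_shift_gt0 m k : -1 < m -> 0 < Gamma (k%:R + m + 1) :> R.
Proof. by move=> hm; apply: Gamma_gt0; have := ler0n R k; lra. Qed.

Lemma Gamma_shiftS m k : -1 < m ->
  Gamma (k.+1%:R + m + 1) = (k%:R + m + 1) * Gamma (k%:R + m + 1) :> R.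
Proof.
move=> hm; rewrite -GammaS; last by have := ler0n R k; lra.
by congr Gamma; rewrite -natr1; ring.
Qed.

Lemma bessel_coeff_gt0 m k : -1 < m -> 0 < bessel_coeff m k.
Proof.
by move=> hm; rewrite invr_gt0 mulr_gt0 ?ltr0n ?fact_gt0// Gamma_shift_gt0.
Qed.

Lemma bessel_coeff_ge0 m k : -1 < m -> 0 <= bessel_coeff m k.
Proof. by move=> hm; exact/ltW/bessel_coeff_gt0. Qed.

(** The quotients 1 / (k + m + 1) of successive values of 1 / Gamma(k + m + 1) tend to 0, so any
    base a > 0 is allowed, however small. This is what gives [besselE] an arbitrarily small
    exponential rate. *)
Lemma bessel_coeff_le m a : -1 < m -> 0 < a ->
  exists2 C, 0 < C & forall k, bessel_coeff m k <= C * (a ^+ k / k`!%:R).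
Proof.
move=> hm a0.
pose g k := (Gamma (k%:R + m + 1))^-1 : R.
have g0 k : 0 < g k by rewrite invr_gt0 Gamma_shift_gt0.
have [C C0 hC] : exists2 C, 0 < C & forall k, g k <= C * a ^+ k.
  apply: (@geometric_bound _ _ (Num.truncn (a^-1 - m)).+1) => // k hk.
  rewrite /g Gamma_shiftS// invfM ler_pM2r ?g0//.
  rewrite -[leRHS]invrK lef_pV2 ?posrE ?invr_gt0//.
    by have := truncnS_gt (a^-1 - m); have : ((Num.truncn (a^-1 - m)).+1%:R : R) <= k%:R
      by [rewrite ler_nat]; lra.
  by have := ler0n R k; lra.
exists C => // k; rewrite /bessel_coeff invfM mulrA [leRHS]mulrC.
by rewrite ler_pM2l ?hC// invr_gt0 ltr0n fact_gt0.
Qed.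

Lemma series_exp_coeff_le z n : 0 <= z -> series (exp_coeff z) n <= expR z :> R.
Proof.
move=> z0; apply: nondecreasing_cvgn_le; last exact: is_cvg_series_exp_coeff.
apply: nondecreasing_series => k _ _; by rewrite /exp_coeff /= divr_ge0 ?exprn_ge0.
Qed.

Lemma is_cvg_bessel_series m w : -1 < m -> cvgn (pseries (bessel_coeff m) w).
Proof.
move=> hm; have [C C0 hC] := bessel_coeff_le hm (@ltr01 R).
apply: normed_cvg.
apply: (@series_le_cvg _ _ (fun k => C * exp_coeff `|w| k)).
- by move=> n; exact: normr_ge0.
- by move=> n; rewrite mulr_ge0 ?(ltW C0)// /exp_coeff/= divr_ge0 ?exprn_ge0.
- move=> n /=; rewrite normrM normrX gtr0_norm ?bessel_coeff_gt0//.
  rewrite /exp_coeff/= [leRHS]mulrCA [leRHS]mulrC ler_wpM2r ?exprn_ge0//.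
  by apply: le_trans (hC n) _; rewrite expr1n mul1r.
- apply: is_cvg_seriesZ; exact: is_cvg_series_exp_coeff.
Qed.

Lemma besselE_ge0 m w : -1 < m -> 0 <= w -> 0 <= besselE m w.
Proof.
move=> hm w0; apply: limr_ge; first exact: is_cvg_bessel_series.
apply: nearW => n; apply: sumr_ge0 => k _.
by rewrite mulr_ge0 ?exprn_ge0 ?bessel_coeff_ge0.
Qed.

Lemma besselE_le_expR m a : -1 < m -> 0 < a ->
  exists2 C, 0 < C & forall w, 0 <= w -> besselE m w <= C * expR (a * w).
Proof.
move=> hm a0; have [C C0 hC] := bessel_coeff_le hm a0.
exists C => // w w0; apply: limr_le; first exact: is_cvg_bessel_series.
apply: nearW => n.
apply: (@le_trans _ _ (C * series (exp_coeff (a * w)) n)); last first.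
  by rewrite ler_pM2l// series_exp_coeff_le// mulr_ge0// ltW.
rewrite /series/= mulr_sumr; apply: ler_sum => k _.
by rewrite /exp_coeff/= exprMn mulrAC mulrA ler_wpM2r ?exprn_ge0.
Qed.

(** The left side is (z/2)^-m I_m(z), which grows like exp z up to a power, so rates r > 1 are the
    natural range. A bound exponential in z^2 would be too weak off the diagonal at small times. The
    terms are compared with the even terms of the series of exp(r z); the ratios g of the
    coefficients have quotients tending to 1 < r^2. *)
Lemma besselE_le_expR_sqr m r : -1 < m -> 1 < r ->
  exists2 C, 0 < C & forall z, 0 <= z -> besselE m (z ^+ 2 / 4) <= C * expR (r * z).
Proof.
move=> hm r1; have r0 : 0 < r by lra.
pose g k := (2 * k)`!%:R / 4 ^+ k * bessel_coeff m k.
have g0 k : 0 < g k.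
  by rewrite mulr_gt0 ?bessel_coeff_gt0// divr_gt0 ?exprn_gt0// ltr0n fact_gt0.
(* The factor (2k + 2)(2k + 1) / 4 = (k + 1)(k + 1/2) meets the quotient 1 / ((k + 1)(k + m + 1)) of
   the coefficients. *)
have gS k : g k.+1 = (k%:R + 2^-1) / (k%:R + m + 1) * g k.
  have h : k%:R + m + 1 != 0 by rewrite gt_eqF//; have := ler0n R k; lra.
  have h2 : Gamma (k%:R + m + 1) != 0 by rewrite gt_eqF// Gamma_shift_gt0.
  have h3 : (k.+1%:R : R) != 0 by rewrite pnatr_eq0.
  have h4 : (k`!%:R : R) != 0 by rewrite pnatr_eq0 -lt0n fact_gt0.
  have h5 : (4 ^+ k : R) != 0 by rewrite expf_neq0// pnatr_eq0.
  rewrite /g /bessel_coeff Gamma_shiftS// mulnS addSn addSn add0n !factS !natrM exprS.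
  rewrite -(natr1 (2 * k).+1) -(natr1 (2 * k)) natrM.
  rewrite -(natr1 k) in h3 *.
  by field; rewrite h h2 h3 h4 h5.
pose q := r ^+ 2; have q1 : 1 < q by rewrite /q expr2; nra.
(* The quotient is at most q as soon as k (q - 1) >= 1/2 - q (m + 1), which gives the threshold. *)
have [C C0 hC] : exists2 C, 0 < C & forall k, g k <= C * q ^+ k.
  apply: (@geometric_bound _ _ (Num.truncn ((2^-1 - q * (m + 1)) / (q - 1))).+1) => //; first lra.
  move=> k hk; rewrite gS ler_pM2r//.
  have hk0 := ler0n R k.
  rewrite ler_pdivrMr; last lra.
  have : (2^-1 - q * (m + 1)) / (q - 1) < k%:R.
    by apply: lt_le_trans (truncnS_gt _) _; rewrite ler_nat.
  by rewrite ltr_pdivrMr; [lra|lra].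
exists C => // z z0; apply: limr_le; first exact: is_cvg_bessel_series.
apply: nearW => n.
apply: (@le_trans _ _ (C * series (exp_coeff (r * z)) (2 * n)%N)); last first.
  by rewrite ler_pM2l// series_exp_coeff_le// mulr_ge0// ltW.
have e0 k : 0 <= exp_coeff (r * z) k.
  by rewrite /exp_coeff/= divr_ge0// exprn_ge0// mulr_ge0// ltW.
(* Each new term is paid for by the even one of two further exponential terms; the odd one is
   nonnegative and dropped. *)
elim: n => [|n IH]; first by rewrite muln0 /pseries /series/= !big_geq// mulr0.
rewrite mulnS addSn addSn add0n seriesSr /pseries seriesSr -/(pseries _ _ n).
rewrite seriesSr -addrA mulrDr; apply: lerD => //.
rewrite mulrDr -[leLHS]addr0; apply: lerD; last by rewrite mulr_ge0 ?(ltW C0).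
have e1 : (z ^+ 2 / 4) ^+ n = z ^+ (2 * n) / 4 ^+ n.
  by rewrite (exprMn _ (z ^+ 2)) exprVn -exprM.
have e2 : (r * z) ^+ (2 * n) = q ^+ n * z ^+ (2 * n).
  by rewrite (exprMn _ r) /q -exprM.
rewrite /exp_coeff /= e1 e2.
have -> : bessel_coeff m n * (z ^+ (2 * n) / 4 ^+ n) = g n * (z ^+ (2 * n) / (2 * n)`!%:R).
  rewrite /g; move: (bessel_coeff m n) (z ^+ (2 * n)) => u v.
  by field; rewrite !gt_eqF.
by rewrite -(mulrA (q ^+ n)) [leRHS]mulrA ler_wpM2r// divr_ge0 ?exprn_ge0// ltW.
Qed.

Lemma pseries_diffs_bessel_coeff m :
  pseries_diffs (bessel_coeff m) = bessel_coeff (m + 1).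
Proof.
apply/funext => k; rewrite /pseries_diffs /bessel_coeff factS natrM.
have -> : k.+1%:R + m + 1 = k%:R + (m + 1) + 1 :> R by rewrite -natr1; ring.
by rewrite !invfM !mulrA divff ?mul1r// pnatr_eq0.
Qed.

Lemma is_derive_besselE m w : -1 < m -> is_derive w 1 (besselE m) (besselE (m + 1) w).
Proof.
move=> hm; rewrite /besselE -pseries_diffs_bessel_coeff.
apply: (@pseries_snd_diffs _ _ (`|w| + 1)); rewrite ?pseries_diffs_bessel_coeff;
  try (apply: is_cvg_bessel_series; lra).
by rewrite [ltRHS]ger0_norm ?addr_ge0// ltrDl.
Qed.

Lemma continuous_besselE m : -1 < m -> continuous (besselE m).
Proof. by move=> hm w; apply: is_derive_continuous (is_derive_besselE w hm). Qed.

(** In (k + s) c1(k) the part with k is a derivative, shifted by one index, and the factor w undoes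
    the shift; hence the different lengths of the partial sums. *)
Lemma pseries_rec (c c1 c2 : R^nat) (s w : R) n :
  (forall k, c k = (k%:R + s) * c1 k) -> (forall k, c2 k = k.+1%:R * c1 k.+1) ->
  pseries c w n.+1 = w * pseries c2 w n + s * pseries c1 w n.+1.
Proof.
move=> hc hc2.
have pS (g : R^nat) k : pseries g w k.+1 = pseries g w k + g k * w ^+ k by exact: seriesSr.
have p0 (g : R^nat) : pseries g w 0%N = 0 by rewrite /pseries /series/= big_geq.
elim: n => [|n IH]; first by rewrite !pS !p0 !expr0 !mulr1 hc mulr0 !add0r.
by rewrite pS IH (pS c1 n.+1) (pS c2) hc hc2 exprS; ring.
Qed.

(** The recurrence I_m - I_(m+2) = (2 (m + 1) / z) I_(m+1) with the branches factored out and w =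
    z^2 / 4; on coefficients it is the functional equation of Gamma. *)
Lemma besselE_rec m w : -1 < m ->
  w * besselE (m + 2) w + (m + 1) * besselE (m + 1) w = besselE m w.
Proof.
move=> hm.
have e n : pseries (bessel_coeff m) w n.+1 = w * pseries (bessel_coeff (m + 2)) w n
    + (m + 1) * pseries (bessel_coeff (m + 1)) w n.+1.
  apply: pseries_rec => k.
    rewrite /bessel_coeff [k%:R + (m + 1) + 1](_ : _ = (k.+1%:R + m + 1)); last first.
      by rewrite -natr1; ring.
    have h : k%:R + m + 1 != 0 by rewrite gt_eqF//; have := ler0n R k; lra.
    have h2 : Gamma (k%:R + m + 1) != 0 by rewrite gt_eqF// Gamma_shift_gt0.
    have h4 : (k`!%:R : R) != 0 by rewrite pnatr_eq0 -lt0n fact_gt0.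
    rewrite Gamma_shiftS//; move: (Gamma (k%:R + m + 1)) h2 => G h2.
    by rewrite addrA; field; rewrite h h2 h4.
  have -> : m + 2 = m + 1 + 1 by ring.
  by rewrite -pseries_diffs_bessel_coeff.
have h n : -1 < n -> pseries (bessel_coeff n) w x @[x --> \oo] --> besselE n w.
  by move=> ?; exact: is_cvg_bessel_series.
apply/esym; have hS : pseries (bessel_coeff m) w n.+1 @[n --> \oo] --> besselE m w.
  by rewrite (cvg_shiftS (pseries (bessel_coeff m) w)); exact: h.
have hR : w * pseries (bessel_coeff (m + 2)) w n
    + (m + 1) * pseries (bessel_coeff (m + 1)) w n.+1 @[n --> \oo] -->
    w * besselE (m + 2) w + (m + 1) * besselE (m + 1) w.
  apply: cvgD; apply: cvgM.
  - exact: cvg_cst.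
  - by apply: h; lra.
  - exact: cvg_cst.
  - by rewrite (cvg_shiftS (pseries (bessel_coeff (m + 1)) w)); apply: h; lra.
move: hS; rewrite (eq_cvg _ _ e) => hS.
exact: cvg_unique hS hR.
Qed.

End bessel_series.

(* The kernel pN with the branch of the Bessel function factored out, so that it
   makes sense, and is smooth, for all real x and y. *)
HB.lock Definition heatK (R : realType) (nu x y t : R) : R :=
  2 * (4 * t) `^ (- (nu + 1)) * besselE nu ((x * y / (4 * t)) ^+ 2)
  * expR (- ((x ^+ 2 + y ^+ 2) / (4 * t))).

(** * The Laplace transform of the series and the regularized kernel *)

Section heat_kernel_def.
Context {R : realType}.
Notation mu := (@lebesgue_measure R).
Implicit Types m nu x y t a b w : R.

Lemma nneseries_EFin (f : R^nat) : cvgn (series f) ->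
  (\sum_(n <oo) (f n)%:E)%E = (limn (series f))%:E.
Proof.
move=> cf; apply/cvg_lim => //.
rewrite (_ : (fun n => _) = EFin \o series f); last first.
  by apply/funext => n; rewrite /series/= sumEFin.
by apply: cvg_EFin => //; exact: nearW.
Qed.

Lemma measurable_besselE m (A : set R) : -1 < m -> measurable_fun A (besselE m).
Proof.
move=> hm; apply: measurable_funTS; apply: continuous_measurable_fun.
exact: continuous_besselE.
Qed.

(** All terms being nonnegative, the series is integrated term by term. The k-th Gaussian moment
    produces Gamma(k + m + 1), which cancels the one in [bessel_coeff] and leaves the exponential
    series of a / b. *)
Lemma laplace_besselE m a b : -1 < m -> 0 <= a -> 0 < b ->
  (\int[mu]_(y in `]0%R, +oo[)
     (besselE m (a * y ^+ 2) * expR (- (b * y ^+ 2)) * y `^ (2 * m + 1))%:E =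
   (expR (a / b) / (2 * b `^ (m + 1)))%:E)%E.
Proof.
move=> hm a0 b0.
have bm0 : 0 < b `^ (m + 1) by rewrite powR_gt0.
pose f k y := bessel_coeff m k * (a * y ^+ 2) ^+ k
   * (expR (- (b * y ^+ 2)) * y `^ (2 * m + 1)).
have f0 k y : 0 <= f k y.
  rewrite /f !mulr_ge0 ?bessel_coeff_ge0 ?exprn_ge0 ?expR_ge0 ?powR_ge0//.
  by rewrite mulr_ge0// sqr_ge0.
transitivity (\int[mu]_(y in `]0%R, +oo[) (\sum_(k <oo) (f k y)%:E))%E.
  apply: eq_integral => y _; rewrite nneseries_EFin.
    congr (_%:E); rewrite -mulrA /besselE /f.
    rewrite (_ : series _ = (fun n => pseries (bessel_coeff m) (a * y ^+ 2) n *
       (expR (- (b * y ^+ 2)) * y `^ (2 * m + 1)))); last first.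
      by apply/funext => n; rewrite /pseries /series/= mulr_suml.
    apply/esym/cvg_lim => //; apply: cvgM; last exact: cvg_cst.
    exact: is_cvg_bessel_series.
  rewrite (_ : series _ = (fun n => pseries (bessel_coeff m) (a * y ^+ 2) n *
     (expR (- (b * y ^+ 2)) * y `^ (2 * m + 1)))); last first.
    by apply/funext => n; rewrite /pseries /series/= mulr_suml.
  by apply: is_cvgM; [exact: is_cvg_bessel_series|exact: is_cvg_cst].
rewrite integral_nneseries//; last 2 first.
- move=> k; apply/measurable_EFinP; apply: measurable_funM.
    by apply: measurable_funM => //; apply: measurable_funX; apply: measurable_funM.
  apply: measurable_funM; last exact: measurable_powR_id.
  by apply: measurableT_comp => //; apply: measurable_funN; apply: measurable_funM.
- by move=> k y _; rewrite lee_fin.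
pose g k := exp_coeff (a / b) k * (2 * b `^ (m + 1))^-1.
have E k : (\int[mu]_(y in `]0%R, +oo[) (f k y)%:E = (g k)%:E)%E.
  have kpos : 0 < k%:R + m + 1 by have := ler0n R k; lra.
  transitivity ((bessel_coeff m k * a ^+ k)%:E * \int[mu]_(y in `]0%R, +oo[)
      (y `^ (2 * (k%:R + m + 1) - 1) * expR (- (b * y ^+ 2)))%:E)%E.
    rewrite -ge0_integralZl//; last 3 first.
    - apply/measurable_EFinP; apply: measurable_funM; first exact: measurable_powR_id.
      by apply: measurableT_comp => //; apply: measurable_funN; apply: measurable_funM.
    - by move=> y _; rewrite lee_fin mulr_ge0 ?powR_ge0 ?expR_ge0.
    - by rewrite lee_fin mulr_ge0 ?bessel_coeff_ge0 ?exprn_ge0.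
    apply: eq_integral => y; rewrite inE/= in_itv/= andbT => y0.
    rewrite -EFinM /f exprMn -exprM.
    have -> : y `^ (2 * (k%:R + m + 1) - 1) = y `^ (2 * k)%:R * y `^ (2 * m + 1).
      rewrite -powRD; last by rewrite (gt_eqF y0) implybT.
      by congr (_ `^ _); rewrite natrM; ring.
    rewrite (powR_mulrn _ (ltW y0)).
    by congr (_%:E); ring.
  rewrite gaussian_moment// -EFinM; congr (_%:E).
  have -> : b `^ (k%:R + m + 1) = b ^+ k * b `^ (m + 1).
    rewrite -addrA (@powRD _ b k%:R (m + 1)) ?powR_mulrn ?(ltW b0)//.
    by rewrite (gt_eqF b0) implybT.
  rewrite /g /exp_coeff/= exprMn exprVn /bessel_coeff.
  have h2 : Gamma (k%:R + m + 1) != 0 by rewrite gt_eqF// Gamma_shift_gt0.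
  move: (Gamma (k%:R + m + 1)) h2 => G h2.
  have h4 : (k`!%:R : R) != 0 by rewrite pnatr_eq0 -lt0n fact_gt0.
  have h5 : b ^+ k != 0 by rewrite expf_neq0// gt_eqF.
  by field; rewrite h2 h4 h5 gt_eqF.
under eq_eseriesr do rewrite E.
have C : series g n @[n --> \oo] --> expR (a / b) * (2 * b `^ (m + 1))^-1.
  rewrite (_ : series g = (fun n => series (exp_coeff (a / b)) n *
     (2 * b `^ (m + 1))^-1)); last first.
    by apply/funext => n; rewrite /series/= mulr_suml.
  by apply: cvgM; [exact: is_cvg_series_exp_coeff|exact: cvg_cst].
rewrite nneseries_EFin; last by apply/cvg_ex; eexists; exact: C.
by congr (_%:E); apply/cvg_lim.
Qed.

Lemma heatKC nu x y t : heatK nu x y t = heatK nu y x t.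
Proof. by rewrite heatK.unlock (mulrC x) (addrC (x ^+ 2)). Qed.

Lemma heatK_ge0 nu x y t : -1 < nu -> 0 <= heatK nu x y t.
Proof.
move=> hn; rewrite heatK.unlock !mulr_ge0 ?expR_ge0 ?powR_ge0//.
by rewrite besselE_ge0// sqr_ge0.
Qed.

Lemma besselIE nu x : 0 < x -> -1 < nu ->
  besselI nu x = (x / 2) `^ nu * besselE nu ((x / 2) ^+ 2).
Proof.
move=> x0 hn; rewrite /besselI /besselE.
rewrite (_ : series _ = (fun n => (x / 2) `^ nu *
    pseries (bessel_coeff nu) ((x / 2) ^+ 2) n)); last first.
  apply/funext => n; rewrite /pseries /series/= mulr_sumr.
  apply: eq_bigr => k _.
  have x20 : 0 < x / 2 by rewrite divr_gt0.
  rewrite powRD; last by rewrite (gt_eqF x20) implybT.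
  rewrite powR_mulrn ?(ltW x20)// GammaSn /bessel_coeff -exprM.
  by rewrite -mulrA (mulrC (_ ^+ _)).
by apply/cvg_lim => //; apply: cvgM; [exact: cvg_cst|exact: is_cvg_bessel_series].
Qed.

Lemma pN_heatK nu x y t : -1 < nu -> 0 < x -> 0 < y -> 0 < t ->
  pN nu x y t = heatK nu x y t.
Proof.
move=> hn x0 y0 t0; have z0 : 0 < x * y / (2 * t).
  by rewrite divr_gt0 ?mulr_gt0.
rewrite /pN besselIE// heatK.unlock.
have -> : x * y / (2 * t) / 2 = x * y / (4 * t) by field; rewrite gt_eqF.
set z := x * y / (2 * t) in z0 *.
have -> : x * y / (4 * t) = z / 2 by rewrite /z; field; rewrite gt_eqF.
(* The branch of [besselI] cancels the power of z; the leftover power of 2 turns 2 t into 4 t and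
   yields the factor 2. *)
have e : (2 * t) `^ (- (nu + 1)) * z `^ (- nu) * (z / 2) `^ nu
    = 2 * (4 * t) `^ (- (nu + 1)).
  have -> : z `^ (- nu) = (z / 2) `^ (- nu) * 2 `^ (- nu).
    by rewrite -powRM ?ler0n ?divfK ?pnatr_eq0// divr_ge0 ?(ltW z0).
  have -> : 4 * t = 2 * (2 * t) by ring.
  rewrite (@powRM _ 2 (2 * t)) ?mulr_ge0 ?(ltW t0)//.
  have z2 : (z / 2) `^ nu != 0 by rewrite gt_eqF// powR_gt0// divr_gt0.
  have -> : 2 `^ (- (nu + 1)) = 2 `^ (- nu) / 2 :> R.
    by rewrite opprD powRB ?powRr1// pnatr_eq0 implybT.
  rewrite (powRN (z / 2)); move: z2 ((2 * t) `^ _) (2 `^ _).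
  by move: ((z / 2) `^ nu) => A A0 P Q; field.
move: (besselE _ _) => E; rewrite -e.
by move: (expR _) => X; ring.
Qed.

(** A Gaussian evolves into a Gaussian. The value l = 0 gives the total mass, and l = 1 / (4 t) the
    Chernoff bound for decaying weights. *)
Lemma Rint_heatK_exp nu x t l : -1 < nu -> 0 < t -> 0 < 1 + 4 * l * t ->
  (\int[mu]_(y in `]0%R, +oo[)
     (expR (- (l * y ^+ 2)) * heatK nu x y t * y `^ (2 * nu + 1))%:E =
  ((1 + 4 * l * t) `^ (- (nu + 1)) * expR (- (l * x ^+ 2 / (1 + 4 * l * t))))%:E)%E.
Proof.
move=> hn t0 k0; have t4 : 0 < 4 * t by lra.
pose k := 1 + 4 * l * t; rewrite -/k in k0 *.
pose a := x ^+ 2 / (4 * t) ^+ 2; pose b := k / (4 * t).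
have b0 : 0 < b by rewrite divr_gt0.
have a0 : 0 <= a by rewrite divr_ge0 ?sqr_ge0.
pose c := 2 * (4 * t) `^ (- (nu + 1)) * expR (- (x ^+ 2 / (4 * t))).
have c0 : 0 <= c by rewrite !mulr_ge0 ?powR_ge0 ?expR_ge0.
transitivity (c%:E * \int[mu]_(y in `]0%R, +oo[)
    (besselE nu (a * y ^+ 2) * expR (- (b * y ^+ 2)) * y `^ (2 * nu + 1))%:E)%E.
  rewrite -ge0_integralZl//; last 2 first.
  - apply/measurable_EFinP; apply: measurable_funM; last exact: measurable_powR_id.
    apply: measurable_funM.
      apply: (@measurableT_comp _ _ _ _ _ _ (besselE nu)); first exact: measurable_besselE.
      by apply: measurable_funM.
    by apply: measurableT_comp => //; apply: measurable_funN; apply: measurable_funM.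
  - move=> y _; rewrite lee_fin !mulr_ge0 ?powR_ge0 ?expR_ge0//.
    by rewrite besselE_ge0// mulr_ge0// sqr_ge0.
  apply: eq_integral => y _; rewrite -EFinM; congr (_%:E).
  rewrite heatK.unlock.
  have -> : (x * y / (4 * t)) ^+ 2 = a * y ^+ 2.
    by rewrite /a; field; rewrite gt_eqF.
  have e : expR (- (l * y ^+ 2)) * expR (- ((x ^+ 2 + y ^+ 2) / (4 * t))) =
     expR (- (x ^+ 2 / (4 * t))) * expR (- (b * y ^+ 2)).
    by rewrite -!expRD; congr expR; rewrite /b /k; field; rewrite gt_eqF.
  rewrite /c; move: (besselE _ _) => E; set P := _ `^ (- _).
  transitivity (2 * P * E * y `^ (2 * nu + 1) *
    (expR (- (l * y ^+ 2)) * expR (- ((x ^+ 2 + y ^+ 2) / (4 * t)))));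
    [by ring|by rewrite e; ring].
rewrite laplace_besselE// -EFinM; congr (_%:E).
rewrite /b /c (@powRM _ k (4 * t)^-1) ?invr_ge0 ?(ltW k0) ?(ltW t4)//.
have -> : (4 * t)^-1 `^ (nu + 1) = (4 * t) `^ (- (nu + 1)).
  by rewrite -powR_inv1 ?(ltW t4)// -powRrM mulN1r.
rewrite (powRN k).
have p1 : (4 * t) `^ (- (nu + 1)) != 0 by rewrite gt_eqF// powR_gt0.
have p2 : k `^ (nu + 1) != 0 by rewrite gt_eqF// powR_gt0.
have e : expR (- (x ^+ 2 / (4 * t))) * expR (a / (k / (4 * t))) =
   expR (- (l * x ^+ 2 / k)).
  rewrite -expRD; congr expR; rewrite /a; move: (gt_eqF k0) => kn.
  by rewrite /k in kn *; field; rewrite kn gt_eqF.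
by rewrite -e; move: p1 p2; set P := _ `^ (- _); set Q := _ `^ _ => p1 p2;
  field; rewrite p1 p2.
Qed.

End heat_kernel_def.

(** * Derivatives and Gaussian bounds of the kernel *)

Section heat_kernel_calculus.
Context {R : realType}.
Implicit Types nu x y t a b : R.

Lemma powR_heat_shift nu t : 0 < t ->
  (4 * t) `^ (- (nu + 1 + 1)) = (4 * t) `^ (- (nu + 1)) / (4 * t).
Proof.
move=> t0; have t4 : 0 < 4 * t by lra.
by rewrite opprD powRB ?powRr1 ?(ltW t4)// (gt_eqF t4) implybT.
Qed.

(** Kernels of shifted index are rewritten with one common power of 4 t, so that relations among
    them become rational identities. *)
Lemma heatKS nu x y t : 0 < t -> heatK (nu + 1) x y t =
  2 * ((4 * t) `^ (- (nu + 1)) / (4 * t)) * besselE (nu + 1) ((x * y / (4 * t)) ^+ 2)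
  * expR (- ((x ^+ 2 + y ^+ 2) / (4 * t))).
Proof. by move=> t0; rewrite heatK.unlock powR_heat_shift. Qed.

Lemma heatKSS nu x y t : 0 < t -> heatK (nu + 2) x y t =
  2 * ((4 * t) `^ (- (nu + 1)) / (4 * t) ^+ 2) * besselE (nu + 2) ((x * y / (4 * t)) ^+ 2)
  * expR (- ((x ^+ 2 + y ^+ 2) / (4 * t))).
Proof.
move=> t0; rewrite heatK.unlock; congr (_ * _ * _ * _).
have -> : nu + 2 + 1 = nu + 1 + 1 + 1 by ring.
rewrite powR_heat_shift// powR_heat_shift//.
by field; rewrite gt_eqF.
Qed.

Lemma is_derive_comp_besselE nu (f : R -> R) x (df : R) : -1 < nu ->
  is_derive x 1 f df ->
  is_derive x 1 (fun y => besselE nu (f y)) (besselE (nu + 1) (f x) * df).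
Proof.
move=> hn h; exact: (is_derive1_comp (is_derive_besselE (f x) hn) h).
Qed.

Lemma is_derive_mul (f g : R -> R) x (df dg : R) :
  is_derive x 1 f df -> is_derive x 1 g dg ->
  is_derive x 1 (fun y => f y * g y) (f x * dg + g x * df).
Proof. by move=> hf hg; apply: is_deriveM. Qed.

Lemma is_derive_eq1 (f : R -> R) x (df dg : R) :
  is_derive x 1 f df -> df = dg -> is_derive x 1 f dg.
Proof. by move=> h <-. Qed.

Lemma is_derive_scale (c : R) (f : R -> R) x (df : R) :
  is_derive x 1 f df -> is_derive x 1 (fun y => c * f y) (c * df).
Proof.
move=> h; apply: (@is_derive_eq1 _ _ _ _ (is_derive_mul (is_derive_cst c x 1) h)).
by rewrite mulr0 addr0.
Qed.

Lemma is_derive_heatK_x nu x y t : -1 < nu -> 0 < t ->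
  is_derive x 1 (fun z => heatK nu z y t)
    (x / (2 * t) * (y ^+ 2 * heatK (nu + 1) x y t - heatK nu x y t)).
Proof.
move=> hn t0; rewrite heatKS// heatK.unlock.
have tn : t != 0 by rewrite gt_eqF.
have dw : is_derive x 1 (fun z => (z * y / (4 * t)) ^+ 2) (2 * x * (y / (4 * t)) ^+ 2).
  by apply: is_derive_eq; rewrite /GRing.scale/=; ring.
have dg : is_derive x 1 (fun z => - ((z ^+ 2 + y ^+ 2) / (4 * t))) (- (x / (2 * t))).
  by apply: is_derive_eq; rewrite /GRing.scale/=; field.
have := is_derive_mul (is_derive_scale (2 * (4 * t) `^ (- (nu + 1)))
  (is_derive_comp_besselE hn dw)) (is_derive_comp_expR dg).
move/is_derive_eq1; apply.
move: (besselE nu _) (besselE (nu + 1) _) (expR _) (_ `^ _) => E0 E1 X P.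
by field.
Qed.

Lemma is_derive_inv4 t : t != 0 ->
  is_derive t 1 (fun s : R => (4 * s)^-1) (- (4 * t ^+ 2)^-1).
Proof.
move=> t0; have h : 4 * t != 0 by rewrite mulf_neq0// pnatr_eq0.
have d4 : is_derive t 1 (fun s : R => 4 * s) 4.
  by apply: is_derive_eq; rewrite /GRing.scale/=; ring.
have := is_deriveV h d4; move/is_derive_eq1; apply.
by rewrite /GRing.scale/=; field.
Qed.

(** Arranged so that the summand with x^2 / (4 t^2) is also the one in the second space derivative;
    the heat equation is then a comparison of the remaining coefficients. *)
Lemma is_derive_heatK_t nu x y t : -1 < nu -> 0 < t ->
  is_derive t 1 (heatK nu x y)
    ((nu + 1) / t * (y ^+ 2 * heatK (nu + 1) x y t - heatK nu x y t)
     + x ^+ 2 / (4 * t ^+ 2) * (y ^+ 4 * heatK (nu + 2) x y t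
        - 2 * (y ^+ 2 * heatK (nu + 1) x y t) + heatK nu x y t)).
Proof.
move=> hn t0; have tn : t != 0 by rewrite gt_eqF.
have t4 : 0 < 4 * t by lra.
have di := is_derive_inv4 tn.
have d4 : is_derive t 1 (fun s : R => 4 * s) 4.
  by apply: is_derive_eq; rewrite /GRing.scale/=; ring.
have dp : is_derive t 1 (fun s => 2 * (4 * s) `^ (- (nu + 1)))
    (- (2 * (nu + 1) / t * (4 * t) `^ (- (nu + 1)))).
  have := is_derive_scale 2 (is_derive1_comp (is_derive1_powR (- (nu + 1)) t4) d4).
  move/is_derive_eq1; apply.
  rewrite powRB ?powRr1 ?(ltW t4)//; last by rewrite (gt_eqF t4) implybT.
  by move: (_ `^ _) => P; field.
have dw : is_derive t 1 (fun s => (x * y / (4 * s)) ^+ 2) (- ((x * y) ^+ 2 / (8 * t ^+ 3))).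
  have h := is_derive_scale (x * y) di.
  have := is_derive_mul h h; move/is_derive_eq1 => H.
  by rewrite (_ : (fun s => _) = (fun s => (x * y / (4 * s)) * (x * y / (4 * s)))) //; apply: H; field.
have dg : is_derive t 1 (fun s => - ((x ^+ 2 + y ^+ 2) / (4 * s)))
    ((x ^+ 2 + y ^+ 2) / (4 * t ^+ 2)).
  have := is_derive_scale (- (x ^+ 2 + y ^+ 2)) di; move/is_derive_eq1 => H.
  rewrite (_ : (fun s => _) = (fun s => - (x ^+ 2 + y ^+ 2) / (4 * s))); last first.
    by apply/funext => s; rewrite mulNr.
  by apply: H; field.
rewrite heatKS// heatKSS// heatK.unlock.
have := is_derive_mul (is_derive_mul dp (is_derive_comp_besselE hn dw)) (is_derive_comp_expR dg).
move/is_derive_eq1; apply.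
(* Direct differentiation yields the indices nu and nu + 1 only; eliminating nu through the
   recurrence brings in the index nu + 2 of the claim. *)
rewrite -(besselE_rec ((x * y / (4 * t)) ^+ 2) hn).
move: (besselE (nu + 2) _) (besselE (nu + 1) _) (expR _) (_ `^ _) => E2 E1 X P.
by field.
Qed.

(** Reduces the second moment of the kernel to the total masses of the kernels of index nu + 1 and
    nu + 2. *)
Lemma heatK_rec nu x y t : -1 < nu -> 0 < t ->
  y ^+ 2 * heatK nu x y t =
  x ^+ 2 * (y ^+ 4 * heatK (nu + 2) x y t)
  + 4 * t * (nu + 1) * (y ^+ 2 * heatK (nu + 1) x y t).
Proof.
move=> hn t0; rewrite heatKS// heatKSS// heatK.unlock.
rewrite -(besselE_rec ((x * y / (4 * t)) ^+ 2) hn).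
move: (besselE (nu + 2) _) (besselE (nu + 1) _) (expR _) (_ `^ _) => E2 E1 X P.
by field; rewrite gt_eqF.
Qed.

Lemma powR_heat_le nu a t : -1 < nu -> 0 < a -> a <= t ->
  (4 * t) `^ (- (nu + 1)) <= (4 * a) `^ (- (nu + 1)).
Proof.
move=> hn a0 at_.
have a4 : 0 < 4 * a by lra.
have t4 : 0 < 4 * t by lra.
rewrite !powRN lef_pV2 ?posrE ?powR_gt0//.
by apply: ge0_ler_powR; rewrite ?nnegrE//; lra.
Qed.

Lemma heatK_le_gaussian nu (B a b : R) : -1 < nu -> 0 < B -> 0 < a -> a <= b ->
  exists2 C, 0 < C & forall x y t, `|x| <= B -> a <= t <= b ->
    heatK nu x y t <= C * expR (- ((8 * b)^-1 * y ^+ 2)).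
Proof.
move=> hn B0 a0 ab; have b0 : 0 < b by exact: lt_le_trans ab.
(* With |x| <= B and a <= t, this rate times (x y / (4 t))^2 is at most y^2 / (8 b), half of the
   Gaussian exponent y^2 / (4 b). *)
pose d := 2 * a ^+ 2 / (b * B ^+ 2).
have d0 : 0 < d by rewrite divr_gt0 ?mulr_gt0 ?exprn_gt0.
have [C C0 hC] := besselE_le_expR hn d0.
pose P := (4 * a) `^ (- (nu + 1)).
have P0 : 0 < P by rewrite powR_gt0; lra.
exists (2 * P * C); first by rewrite !mulr_gt0.
move=> x y t xB /andP[at_ tb]; have t0 : 0 < t by exact: lt_le_trans at_.
rewrite heatK.unlock -!mulrA ler_pM2l//; apply: ler_pM; rewrite ?powR_ge0//.
- by rewrite mulr_ge0 ?expR_ge0// besselE_ge0 ?sqr_ge0.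
- exact: powR_heat_le.
apply: le_trans (ler_wpM2r (expR_ge0 _) (hC _ (sqr_ge0 _))) _.
rewrite -mulrA -expRD ler_pM2l// ler_expR.
have hw : d * (x * y / (4 * t)) ^+ 2 <= (8 * b)^-1 * y ^+ 2.
  rewrite /d expr_div_n exprMn.
  have x2 : x ^+ 2 <= B ^+ 2 by rewrite -(real_normK (num_real x)) lerXn2r// nnegrE// ltW.
  have e : 2 * a ^+ 2 / (b * B ^+ 2) * (x ^+ 2 * y ^+ 2 / (4 * t) ^+ 2) =
    (8 * b)^-1 * y ^+ 2 * ((a ^+ 2 / t ^+ 2) * (x ^+ 2 / B ^+ 2)).
    by field; rewrite !gt_eqF.
  rewrite e ler_piMr//.
    by rewrite mulr_ge0 ?sqr_ge0// invr_ge0 mulr_ge0// ltW.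
  apply: mulr_ile1; rewrite ?divr_ge0 ?sqr_ge0//.
    by rewrite ler_pdivrMr ?exprn_gt0// mul1r lerXn2r// nnegrE ltW.
  by rewrite ler_pdivrMr ?exprn_gt0// mul1r.
have hg : (4 * b)^-1 * y ^+ 2 <= (x ^+ 2 + y ^+ 2) / (4 * t).
  rewrite mulrC; apply: ler_pM; rewrite ?sqr_ge0 ?invr_ge0 ?mulr_ge0 ?(ltW b0)//.
    by rewrite lerDr sqr_ge0.
  by rewrite lef_pV2 ?posrE ?mulr_gt0// ler_pM2l.
by lra.
Qed.

Lemma measurable_heatK nu x t (A : set R) : -1 < nu ->
  measurable_fun A (fun y => heatK nu x y t).
Proof.
move=> hn; rewrite heatK.unlock; apply: measurable_funM.
  apply: measurable_funM => //.
  apply: (@measurableT_comp _ _ _ _ _ _ (besselE nu)); first exact: measurable_besselE.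
  by apply: measurable_funX; apply: measurable_funM => //; apply: measurable_funM.
apply: measurableT_comp => //; apply: measurable_funN; apply: measurable_funM => //.
by apply: measurable_funD.
Qed.

Lemma continuous_heatK nu x t y : -1 < nu -> 0 < t ->
  {for (x, t), continuous (fun z : R * R => heatK nu z.1 y z.2)}.
Proof.
move=> hn t0; have t4 : 0 < 4 * t by lra.
have c1 : {for (x, t), continuous (fun z : R * R => z.1)} by exact: cvg_fst.
have c2 : {for (x, t), continuous (fun z : R * R => z.2)} by exact: cvg_snd.
have c4 : {for (x, t), continuous (fun z : R * R => 4 * z.2)}.
  by apply: cvgM => //; exact: cvg_cst.
have ci : {for (x, t), continuous (fun z : R * R => (4 * z.2)^-1)}.
  by apply: cvgV => //=; rewrite gt_eqF.
rewrite heatK.unlock; apply: cvgM.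
  apply: cvgM.
    apply: cvgM; first exact: cvg_cst.
    apply: (@continuous_comp _ _ _ (fun z : R * R => 4 * z.2) (fun s => s `^ _)) => //.
    exact: continuous_powR.
  apply: (@continuous_comp _ _ _ (fun z : R * R => (z.1 * y / (4 * z.2)) ^+ 2) (besselE nu)).
    rewrite (_ : (fun z : R * R => _) = (fun z => (z.1 * y / (4 * z.2)) * (z.1 * y / (4 * z.2)))) //.
    by apply: cvgM; apply: cvgM => //; apply: cvgM => //; exact: cvg_cst.
  exact: continuous_besselE.
apply: (@continuous_comp _ _ _ (fun z : R * R => - ((z.1 ^+ 2 + y ^+ 2) / (4 * z.2))) (@expR R)).
  apply: cvgN; apply: cvgM => //; apply: cvgD; last exact: cvg_cst.
  rewrite (_ : (fun z : R * R => _) = (fun z => z.1 * z.1)) //.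
  exact: cvgM.
exact: continuous_expR.
Qed.

End heat_kernel_calculus.

(** * Limits along sequences and differentiation under the integral *)

Section sequential_limits.
Context {R : realType}.
Notation mu := (@lebesgue_measure R).

(** Dominated convergence and Pratt's theorem concern sequences, whereas the limits required are
    along neighbourhood filters. The set A confines the sequences to a region where uniform bounds
    hold. *)
Lemma cvg_within_seq (T : pseudoMetricType R) (U : topologicalType) (f : T -> U)
    (B A : set T) (z : T) (l : U) : within B (nbhs z) A ->
  (forall u : nat -> T, (forall n, B (u n) /\ A (u n)) -> u n @[n --> \oo] --> z ->
     f (u n) @[n --> \oo] --> l) ->
  f x @[x --> within B (nbhs z)] --> l.
Proof.
move=> hA hu V hV; apply: contrapT => hn.
have ex (n : nat) : exists x, [/\ ball z n.+1%:R^-1 x, B x, A x & ~ V (f x)].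
  apply: contrapT => hne; apply: hn.
  have hb : nbhs z (ball z (n.+1%:R^-1 : R)) by apply: nbhsx_ballx; rewrite invr_gt0.
  have : nbhs z [set x | B x -> V (f x)] by
    near=> x => Bx; apply: contrapT => nV; apply: hne; exists x; split => //;
    [near: x; exact: hb | move: Bx; near: x; exact: hA].
  by [].
have [u hu'] := choice ex.
have uz : u n @[n --> \oo] --> z.
  apply/cvg_ballP => e e0; near=> n.
  have [h _ _ _] := hu' n; apply: le_ball h.
  near: n.
  have /cvgrPdist_le/(_ _ e0) := @cvg_harmonic R.
  by apply: filterS => n; rewrite sub0r normrN ger0_norm// invr_ge0.
have := hu u (fun n => let: And4 _ b a _ := hu' n in conj b a) uz V hV.
move=> [n _ /(_ n (leqnn n))].
by have [_ _ _] := hu' n.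
Unshelve. all: end_near. Qed.

Lemma cvg_nbhs_seq (T : pseudoMetricType R) (U : topologicalType) (f : T -> U)
    (A : set T) (z : T) (l : U) : nbhs z A ->
  (forall u : nat -> T, (forall n, A (u n)) -> u n @[n --> \oo] --> z ->
     f (u n) @[n --> \oo] --> l) ->
  f x @[x --> z] --> l.
Proof.
move=> hA hu.
have h : f x @[x --> within setT (nbhs z)] --> l.
  apply: (@cvg_within_seq _ _ _ _ A).
    by apply: filterS hA => x Ax _.
  by move=> u h; apply: hu => n; case: (h n).
move=> V hV; have : \forall x \near z, setT x -> V (f x) by exact: h V hV.
by apply: filterS => x; exact.
Qed.

Lemma Rdominated_cvg (D : set R) (f_ : nat -> R -> R) (f g : R -> R) :
  measurable D -> (forall n, measurable_fun D (f_ n)) ->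
  (forall x, D x -> f_ n x @[n --> \oo] --> f x) ->
  mu.-integrable D (EFin \o g) -> (forall n x, D x -> `|f_ n x| <= g x) ->
  (\int[mu]_(x in D) f_ n x)%R @[n --> \oo] --> (\int[mu]_(x in D) f x)%R.
Proof.
move=> mD mf ff ig fg.
have mf' n : measurable_fun D (fun x => (f_ n x)%:E) by exact/measurable_EFinP.
have ff' x : D x -> (f_ n x)%:E @[n --> \oo] --> (f x)%:E.
  by move=> Dx; apply: cvg_EFin; [exact: nearW|exact: ff].
have fg' n x : D x -> (`|(f_ n x)%:E| <= (g x)%:E)%E.
  by move=> Dx; rewrite lee_fin; exact: fg.
have mfl : measurable_fun D (fun x => (f x)%:E).
  by apply: emeasurable_fun_cvg ff' => n; exact: mf'.
have [|| h1 _ h3] := @dominated_convergence _ _ _ mu D mD (fun n x => (f_ n x)%:E)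
    (fun x => (f x)%:E) (EFin \o g) mf' mfl _ ig _.
- exact: aeW.
- by apply: aeW => x n; exact: fg'.
apply: fine_cvg; rewrite fineK//.
exact: integrable_fin_num h1.
Qed.

Lemma is_derive_integral (D : set R) (f df : R -> R -> R) (a u v : R) (G : R -> R) :
  measurable D -> u < a < v ->
  (forall x, u < x < v -> mu.-integrable D (EFin \o f x)) ->
  (forall x y, u < x < v -> D y -> is_derive x 1 (f ^~ y) (df x y)) ->
  mu.-integrable D (EFin \o G) ->
  (forall x y, u < x < v -> D y -> `|df x y| <= G y) ->
  is_derive a 1 (fun x => (\int[mu]_(y in D) f x y)%R) (\int[mu]_(y in D) df a y)%R.
Proof.
move=> mD ha hf hd hG hb.
have Ia : (`]u, v[%classic : set R) a by rewrite /= in_itv.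
have I1 x : (`]u, v[%classic : set R) x -> mu.-integrable D (EFin \o f x).
  by rewrite /= in_itv/=; exact: hf.
have I2 x y : (`]u, v[%classic : set R) x -> D y -> derivable (f ^~ y) x 1.
  by rewrite /= in_itv/= => h Dy; have [] := hd x y h Dy.
have dE x y : u < x < v -> D y -> partial1of2 f x y = df x y.
  by move=> h Dy; rewrite /partial1of2 derive1E; have [] := hd x y h Dy.
have iG : mu.-integrable D (EFin \o (fun y => `|G y|)) by exact: integrable_abse hG.
have I3 x y : (`]u, v[%classic : set R) x -> D y -> `|partial1of2 f x y| <= `|G y|.
  rewrite /= in_itv/= => h Dy; rewrite dE//.
  exact: le_trans (hb x y h Dy) (ler_norm _).
have G0 y : 0 <= `|G y| by [].
split; first exact: (@derivable_under_integral _ _ _ mu f D mD a u v Ia I1 I2 _ G0 iG I3).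
rewrite -derive1E (@differentiation_under_integral _ _ _ mu f D mD a u v Ia I1 I2 _ G0 iG I3).
by apply: eq_Rintegral => y; rewrite inE => Dy; exact: dE.
Qed.

End sequential_limits.

(** * Heat potentials of tempered data *)

Section heat_potential.
Context {R : realType}.
Notation mu := (@lebesgue_measure R).
Notation D := (`]0%R, +oo[%classic : set R).
Implicit Types (nu x t : R) (psi : R -> R).

(** Guarantees that the potential exists at all positive times, and is stable under multiplication
    by y^2, which differentiating the potential produces. *)
Definition tempered psi := forall c, 0 < c ->
  mu.-integrable D (EFin \o (fun y => psi y * expR (- (c * y ^+ 2)))).

Lemma measurable_gaussian (c : R) (A : set R) :
  measurable_fun A (fun y : R => expR (- (c * y ^+ 2))).
Proof.
by apply: measurableT_comp => //; apply: measurable_funN; apply: measurable_funM.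
Qed.

Lemma measurable_tempered psi : tempered psi -> measurable_fun D psi.
Proof.
move=> /(_ 1 ltr01) /measurable_int /measurable_EFinP h.
rewrite (_ : psi = fun y => (psi y * expR (- (1 * y ^+ 2))) * expR (- (-1 * y ^+ 2))).
  by apply: measurable_funM => //; exact: measurable_gaussian.
apply/funext => y; rewrite -mulrA -expRD mul1r mulN1r opprK addNr expR0 mulr1.
by [].
Qed.

Lemma le_integrable_R (A : set R) (f g : R -> R) : measurable A ->
  measurable_fun A f -> (forall y, A y -> `|f y| <= `|g y|) ->
  mu.-integrable A (EFin \o g) -> mu.-integrable A (EFin \o f).
Proof.
by move=> mA mf h ig; apply: le_integrable ig => //; exact/measurable_EFinP.
Qed.

(** This is u <= exp u at u = c y^2 / 2. *)
Lemma sqr_gaussian_le (c y : R) : 0 < c ->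
  y ^+ 2 * expR (- (c * y ^+ 2)) <= 2 / c * expR (- (c / 2 * y ^+ 2)).
Proof.
move=> c0.
have h := expR_ge1Dx (c / 2 * y ^+ 2).
have e : - (c / 2 * y ^+ 2) = c / 2 * y ^+ 2 + - (c * y ^+ 2) by field.
rewrite e expRD [leRHS]mulrA ler_wpM2r ?expR_ge0// -ler_pdivrMl ?divr_gt0//.
have -> : (2 / c)^-1 * y ^+ 2 = c / 2 * y ^+ 2 by field; rewrite gt_eqF.
by apply: le_trans h; rewrite lerDr.
Qed.

Lemma tempered_sqr psi : tempered psi -> tempered (fun y => y ^+ 2 * psi y).
Proof.
move=> h c c0; have c20 : 0 < c / 2 by rewrite divr_gt0.
have := integrable_scale (2 / c) measurable_halfline (h _ c20).
apply: le_integrable_R; first exact: measurable_halfline.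
  apply: measurable_funM; last exact: measurable_gaussian.
  by apply: measurable_funM => //; exact: measurable_tempered.
move=> y _; have := sqr_gaussian_le y c0.
have := expR_ge0 (- (c * y ^+ 2)); have := expR_ge0 (- (c / 2 * y ^+ 2)).
move: (expR _) (expR _) => X1 X2 X10 X20 hX.
rewrite (normrM (y ^+ 2 * psi y)) (normrM (y ^+ 2)) (normrM (2 / c)) (normrM (psi y)).
rewrite (ger0_norm (sqr_ge0 y)) (ger0_norm X10) (ger0_norm X20) (@gtr0_norm _ (2 / c)) ?divr_gt0//.
by rewrite mulrAC mulrC [leRHS]mulrCA ler_wpM2l.
Qed.

(** The weight y^(2nu+1) belongs to psi, so the index of the kernel can be shifted independently of
    it. *)
Definition heatU nu psi x t : R := (\int[mu]_(y in D) (psi y * heatK nu x y t))%R.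

Lemma integrable_heatU nu psi x t : -1 < nu -> 0 < t -> tempered psi ->
  mu.-integrable D (EFin \o (fun y => psi y * heatK nu x y t)).
Proof.
move=> hn t0 h.
have B0 : 0 < `|x| + 1 by rewrite ltr_wpDl.
have [C C0 hC] := heatK_le_gaussian hn B0 t0 (lexx t).
have c0 : 0 < (8 * t)^-1 by rewrite invr_gt0 mulr_gt0.
have := integrable_scale C measurable_halfline (h _ c0).
apply: le_integrable_R; first exact: measurable_halfline.
  apply: measurable_funM; first exact: measurable_tempered.
  exact: measurable_heatK.
move=> y _; rewrite !normrM (ger0_norm (heatK_ge0 _ _ _ hn)) (gtr0_norm C0).
rewrite (ger0_norm (expR_ge0 _)) mulrCA ler_wpM2l// hC ?lexx//.
by rewrite lerDl.
Qed.

Lemma continuous_heatU nu psi x t : -1 < nu -> 0 < t -> tempered psi ->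
  {for (x, t), continuous (fun z : R * R => heatU nu psi z.1 z.2)}.
Proof.
move=> hn t0 h.
have B0 : 0 < `|x| + 1 by rewrite ltr_wpDl.
have t20 : 0 < t / 2 by rewrite divr_gt0.
have t22 : t / 2 <= 2 * t by lra.
have [C C0 hC] := heatK_le_gaussian hn B0 t20 t22.
have c0 : 0 < (8 * (2 * t))^-1 by rewrite invr_gt0 !mulr_gt0.
(* A neighbourhood of (x, t) on which a single Gaussian dominates all the kernels. *)
pose A := [set z : R * R | `|z.1| <= `|x| + 1 /\ t / 2 <= z.2 <= 2 * t].
apply: (@cvg_nbhs_seq _ _ _ _ A).
  rewrite /A; near=> z; split.
    apply: ltW; near: z.
    have : (fun z : R * R => `|z.1|) @ (x, t) --> `|x|.
      by apply: cvg_norm; exact: cvg_fst.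
    by move/cvgr_lt; apply; rewrite ltrDl.
  apply/andP; split; apply: ltW; near: z;
  have c2 : (fun z : R * R => z.2) @ (x, t) --> t by exact: cvg_snd.
    by apply: (cvgr_gt _ c2); lra.
  by apply: (cvgr_lt _ c2); lra.
move=> u uA uz.
apply: (@Rdominated_cvg _ D (fun n y => psi y * heatK nu (u n).1 y (u n).2) _
   (fun y => C * `|psi y * expR (- ((8 * (2 * t))^-1 * y ^+ 2))|)).
- exact: measurable_halfline.
- move=> n; apply: measurable_funM; first exact: measurable_tempered.
  exact: measurable_heatK.
- move=> y _; apply: cvgM; first exact: cvg_cst.
  exact: (cvg_comp _ _ uz (@continuous_heatK _ nu x t y hn t0)).
- apply: integrable_scale; first exact: measurable_halfline.
  by have /integrable_abse := h _ c0.
- move=> n y _; have [h1 h2] := uA n.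
  rewrite !normrM (ger0_norm (heatK_ge0 _ _ _ hn)).
  rewrite (ger0_norm (expR_ge0 _)) mulrCA ler_wpM2l//.
  exact: hC.
Unshelve. all: end_near. Qed.

End heat_potential.

(** * Derivatives of potentials and the heat equation *)

Section heat_potential_derivatives.
Context {R : realType}.
Notation mu := (@lebesgue_measure R).
Notation D := (`]0%R, +oo[%classic : set R).
Implicit Types (nu x t : R) (psi : R -> R).

Lemma integrable_add (A : set R) (f g : R -> R) : measurable A ->
  mu.-integrable A (EFin \o f) -> mu.-integrable A (EFin \o g) ->
  mu.-integrable A (EFin \o (fun y => f y + g y)).
Proof.
move=> mA hf hg; rewrite (_ : EFin \o _ = (EFin \o f) \+ (EFin \o g))%E //.
exact: integrableD.
Qed.

Lemma heatK_dominated nu psi (B a b : R) : -1 < nu -> tempered psi ->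
  0 < B -> 0 < a -> a <= b ->
  exists G : R -> R, mu.-integrable D (EFin \o G) /\
    forall x y t, `|x| <= B -> a <= t <= b -> `|psi y * heatK nu x y t| <= G y.
Proof.
move=> hn h B0 a0 ab.
have [C C0 hC] := heatK_le_gaussian hn B0 a0 ab.
have c0 : 0 < (8 * b)^-1 by rewrite invr_gt0 mulr_gt0//; exact: lt_le_trans ab.
exists (fun y => C * `|psi y * expR (- ((8 * b)^-1 * y ^+ 2))|); split.
  apply: integrable_scale; first exact: measurable_halfline.
  by have /integrable_abse := h _ c0.
move=> x y t hx ht; rewrite !normrM (ger0_norm (heatK_ge0 _ _ _ hn)).
rewrite (ger0_norm (expR_ge0 _)) mulrCA ler_wpM2l//.
exact: hC.
Qed.

(** Letting (X q, T q) run along a curve treats the space and the time derivative at once. The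
    powers of y go to the datum, so the three integrals that appear are again potentials. *)
Lemma is_derive_heatU_curve nu psi (X T a0 a1 a2 : R -> R) (p u v B a b M : R) :
  -1 < nu -> tempered psi -> u < p < v -> 0 < B -> 0 < a -> a <= b ->
  (forall q, u < q < v -> [/\ `|X q| <= B, a <= T q <= b &
     [/\ `|a0 q| <= M, `|a1 q| <= M & `|a2 q| <= M]]) ->
  (forall q y, u < q < v -> is_derive q 1 (fun q => heatK nu (X q) y (T q))
     (a0 q * heatK nu (X q) y (T q) + a1 q * (y ^+ 2 * heatK (nu + 1) (X q) y (T q))
      + a2 q * (y ^+ 4 * heatK (nu + 2) (X q) y (T q)))) ->
  is_derive p 1 (fun q => heatU nu psi (X q) (T q))
    (a0 p * heatU nu psi (X p) (T p)
     + a1 p * heatU (nu + 1) (fun y => y ^+ 2 * psi y) (X p) (T p)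
     + a2 p * heatU (nu + 2) (fun y => y ^+ 2 * (y ^+ 2 * psi y)) (X p) (T p)).
Proof.
move=> hn h hp B0 a0' ab hq hd.
have hn1 : -1 < nu + 1 by lra.
have hn2 : -1 < nu + 2 by lra.
have h1 := tempered_sqr h; have h2 := tempered_sqr h1.
have [G0 [iG0 hG0]] := heatK_dominated hn h B0 a0' ab.
have [G1 [iG1 hG1]] := heatK_dominated hn1 h1 B0 a0' ab.
have [G2 [iG2 hG2]] := heatK_dominated hn2 h2 B0 a0' ab.
have Tpos q : u < q < v -> 0 < T q.
  by move=> /hq[_ /andP[+ _] _]; exact: lt_le_trans.
pose df q y := a0 q * (psi y * heatK nu (X q) y (T q))
  + a1 q * (y ^+ 2 * psi y * heatK (nu + 1) (X q) y (T q))
  + a2 q * (y ^+ 2 * (y ^+ 2 * psi y) * heatK (nu + 2) (X q) y (T q)).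
have D1 : is_derive p 1 (fun q => heatU nu psi (X q) (T q)) (\int[mu]_(y in D) df p y)%R.
  apply: (@is_derive_integral _ D (fun q y => psi y * heatK nu (X q) y (T q)) df p u v
     (fun y => M * G0 y + M * G1 y + M * G2 y)) => //.
  - by move=> q hq'; apply: integrable_heatU => //; exact: Tpos.
  - move=> q y hq' _; have := is_derive_scale (psi y) (hd q y hq').
    by move/is_derive_eq1; apply; rewrite /df; ring.
  - by do 2?[apply: integrable_add => //]; exact: integrable_scale.
  - move=> q y hq' _; have [hX hT [M0 M1 M2]] := hq q hq'.
    rewrite /df; apply: le_trans (ler_normD _ _) _; apply: lerD.
      apply: le_trans (ler_normD _ _) _; apply: lerD.
        by rewrite (normrM (a0 q)); apply: ler_pM => //; exact: hG0.
      by rewrite (normrM (a1 q)); apply: ler_pM => //; exact: hG1.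
    by rewrite (normrM (a2 q)); apply: ler_pM => //; exact: hG2.
apply: (is_derive_eq1 D1).
have I0 := integrable_heatU (X p) hn (Tpos p hp) h.
have I1 := integrable_heatU (X p) hn1 (Tpos p hp) h1.
have I2 := integrable_heatU (X p) hn2 (Tpos p hp) h2.
rewrite /df RintegralD//; last 2 first.
- by apply: integrable_add => //; exact: integrable_scale.
- exact: integrable_scale.
rewrite RintegralD//; try exact: integrable_scale.
by rewrite !RintegralZl.
Qed.

Lemma is_derive_heatU_x nu psi x t : -1 < nu -> tempered psi -> 0 < t ->
  is_derive x 1 (fun z => heatU nu psi z t)
    (x / (2 * t) * (heatU (nu + 1) (fun y => y ^+ 2 * psi y) x t - heatU nu psi x t)).
Proof.
move=> hn h t0.
have B0 : 0 < `|x| + 1 by rewrite ltr_wpDl.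
have D1 := @is_derive_heatU_curve nu psi id (fun=> t) (fun q => - (q / (2 * t)))
  (fun q => q / (2 * t)) (fun=> 0) x (x - 1) (x + 1) (`|x| + 1) t t ((`|x| + 1) / (2 * t))
  hn h _ B0 t0 (lexx t).
apply: is_derive_eq1 (D1 _ _ _) _.
- by rewrite gtrBl ltrDl ltr01.
- move=> q /andP[q1 q2].
  have hq : `|q| <= `|x| + 1.
    rewrite -[q in `|q|](subrK x); apply: le_trans (ler_normD _ _) _.
    rewrite addrC lerD2l ler_norml; lra.
  rewrite lexx normrN normr0 normrM (gtr0_norm (_ : 0 < (2 * t)^-1)) ?invr_gt0 ?mulr_gt0//.
  have r0 : 0 <= (2 * t)^-1 by rewrite invr_ge0; lra.
  split => //; split; [exact: ler_wpM2r|exact: ler_wpM2r|].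
  by rewrite mulr_ge0// ltW.
- move=> q y _; apply: is_derive_eq1 (is_derive_heatK_x q y hn t0) _; ring.
- by rewrite mul0r addr0; ring.
Qed.

Lemma is_derive_heatU_t nu psi x t : -1 < nu -> tempered psi -> 0 < t ->
  is_derive t 1 (heatU nu psi x)
    ((nu + 1) / t * (heatU (nu + 1) (fun y => y ^+ 2 * psi y) x t - heatU nu psi x t)
     + x ^+ 2 / (4 * t ^+ 2) *
       (heatU (nu + 2) (fun y => y ^+ 2 * (y ^+ 2 * psi y)) x t
        - 2 * heatU (nu + 1) (fun y => y ^+ 2 * psi y) x t + heatU nu psi x t)).
Proof.
move=> hn h t0.
have B0 : 0 < `|x| + 1 by rewrite ltr_wpDl.
have t20 : 0 < t / 2 by lra.
have t22 : t / 2 <= 2 * t by lra.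
pose a0 q := - ((nu + 1) / q) + x ^+ 2 / (4 * q ^+ 2).
pose a1 q := (nu + 1) / q - 2 * (x ^+ 2 / (4 * q ^+ 2)).
pose a2 q := x ^+ 2 / (4 * q ^+ 2).
(* Built from functions nonincreasing in q, the coefficients are bounded by their parts at the left
   end t / 2. *)
pose M := (nu + 1) / (t / 2) + 2 * (x ^+ 2 / (4 * (t / 2) ^+ 2)).
have D1 := @is_derive_heatU_curve nu psi (fun=> x) id a0 a1 a2 t (t / 2) (2 * t)
  (`|x| + 1) (t / 2) (2 * t) M hn h _ B0 t20 t22.
apply: is_derive_eq1 (D1 _ _ _) _.
- by apply/andP; split; lra.
- move=> q /andP[q1 q2].
  have q0 : 0 < q by exact: lt_trans q1.
  split; [by rewrite lerDl|by rewrite (ltW q1) (ltW q2)|].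
  have e1 : 0 <= (nu + 1) / q <= (nu + 1) / (t / 2).
    rewrite divr_ge0 ?(ltW q0)//=; last lra.
    by rewrite ler_wpM2l ?lef_pV2 ?posrE ?(ltW q1)//; lra.
  have e2 : 0 <= x ^+ 2 / (4 * q ^+ 2) <= x ^+ 2 / (4 * (t / 2) ^+ 2).
    have hq2 : 0 < q ^+ 2 by rewrite exprn_gt0.
    apply/andP; split; first by apply: divr_ge0; [exact: sqr_ge0|lra].
    rewrite ler_wpM2l ?sqr_ge0// lef_pV2 ?posrE ?mulr_gt0 ?exprn_gt0//.
    by rewrite ler_pM2l// lerXn2r ?nnegrE ?(ltW q1) ?(ltW t20) ?(ltW q0).
  rewrite /a0 /a1 /a2 /M.
  move: e1 e2; move: (_ / q) (_ / (t / 2)) (_ / (4 * q ^+ 2)) (_ / (4 * (t / 2) ^+ 2)).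
  move=> A1 A2 A3 A4 /andP[? ?] /andP[? ?].
  by rewrite !ler_norml; split; lra.
- move=> q y /andP[q1 _].
  have q0 : 0 < q by exact: lt_trans q1.
  apply: is_derive_eq1 (is_derive_heatK_t x y hn q0) _; rewrite /a0 /a1 /a2.
  by move: (_ / q) (_ / (4 * q ^+ 2)) => A1 A2; ring.
- rewrite /a0 /a1 /a2.
  by move: (_ / t) (_ / (4 * t ^+ 2)) => A1 A2; ring.
Qed.

Lemma continuous_eq_near (T : topologicalType) (U : topologicalType) (f g : T -> U) (z : T) :
  (\forall x \near z, f x = g x) -> {for z, continuous g} -> {for z, continuous f}.
Proof.
move=> h cg; have e := nbhs_singleton h.
suff : f x @[x --> z] --> f z by [].
rewrite e; apply: cvg_trans cg.
by apply: near_eq_cvg; apply: filterS h => x ->.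
Qed.

Lemma near_snd_gt0 (z : R * R) : 0 < z.2 -> \forall w \near z, 0 < w.2.
Proof.
move=> h; have c : (fun w : R * R => w.2) @ z --> z.2 by exact: cvg_snd.
exact: (cvgr_gt _ c).
Qed.

Lemma near_fst_gt0 (z : R * R) : 0 < z.1 -> \forall w \near z, 0 < w.1.
Proof.
move=> h; have c : (fun w : R * R => w.1) @ z --> z.1 by exact: cvg_fst.
exact: (cvgr_gt _ c).
Qed.

Lemma dy_heatU nu psi x t : -1 < nu -> tempered psi -> 0 < t ->
  dy (heatU nu psi) x t =
  x / (2 * t) * (heatU (nu + 1) (fun y => y ^+ 2 * psi y) x t - heatU nu psi x t).
Proof.
move=> hn h t0; rewrite /dy derive1E.
by have [_ ->] := is_derive_heatU_x x hn h t0.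
Qed.

Lemma is_derive_dy_heatU nu psi x t : -1 < nu -> tempered psi -> 0 < t ->
  is_derive x 1 (fun z => dy (heatU nu psi) z t)
   ((2 * t)^-1 * (heatU (nu + 1) (fun y => y ^+ 2 * psi y) x t - heatU nu psi x t)
    + x ^+ 2 / (4 * t ^+ 2) *
       (heatU (nu + 2) (fun y => y ^+ 2 * (y ^+ 2 * psi y)) x t
        - 2 * heatU (nu + 1) (fun y => y ^+ 2 * psi y) x t + heatU nu psi x t)).
Proof.
move=> hn h t0; have hn1 : -1 < nu + 1 by lra.
rewrite (_ : (fun z => _) = (fun z => z / (2 * t) *
  (heatU (nu + 1) (fun y => y ^+ 2 * psi y) z t - heatU nu psi z t))); last first.
  by apply/funext => z; rewrite dy_heatU.
have d1 := is_derive_heatU_x x hn1 (tempered_sqr h) t0.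
have d0 := is_derive_heatU_x x hn h t0.
have dB : is_derive x 1 (fun z => heatU (nu + 1) (fun y => y ^+ 2 * psi y) z t
    - heatU nu psi z t) _ := is_deriveB d1 d0.
have dx : is_derive x 1 (fun z : R => z / (2 * t)) (2 * t)^-1.
  by apply: is_derive_eq; rewrite /GRing.scale/=; ring.
have := is_derive_mul dx dB; move/is_derive_eq1; apply.
have -> : nu + 1 + 1 = nu + 2 by ring.
move: (heatU _ _ _ _) (heatU _ _ _ _) (heatU _ _ _ _) => U2 U1 U0.
by field; rewrite gt_eqF.
Qed.

Lemma heatU_solution nu psi : -1 < nu -> tempered psi ->
  C21 (heatU nu psi) /\ bessel_heat_equation nu (heatU nu psi).
Proof.
move=> hn h.
have hn1 : -1 < nu + 1 by lra.
have hn2 : -1 < nu + 2 by lra.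
have h1 := tempered_sqr h; have h2 := tempered_sqr h1.
have yyE x t : 0 < t -> dy (dy (heatU nu psi)) x t =
   (2 * t)^-1 * (heatU (nu + 1) (fun y => y ^+ 2 * psi y) x t - heatU nu psi x t)
    + x ^+ 2 / (4 * t ^+ 2) *
       (heatU (nu + 2) (fun y => y ^+ 2 * (y ^+ 2 * psi y)) x t
        - 2 * heatU (nu + 1) (fun y => y ^+ 2 * psi y) x t + heatU nu psi x t).
  by move=> t0; rewrite {1}/dy derive1E; have [_ ->] := is_derive_dy_heatU x hn h t0.
have tE x t : 0 < t -> dt (heatU nu psi) x t =
    ((nu + 1) / t * (heatU (nu + 1) (fun y => y ^+ 2 * psi y) x t - heatU nu psi x t)
     + x ^+ 2 / (4 * t ^+ 2) *
       (heatU (nu + 2) (fun y => y ^+ 2 * (y ^+ 2 * psi y)) x t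
        - 2 * heatU (nu + 1) (fun y => y ^+ 2 * psi y) x t + heatU nu psi x t)).
  by move=> t0; rewrite /dt derive1E; have [_ ->] := is_derive_heatU_t x hn h t0.
have c0 z : 0 < z.2 -> {for z, continuous (fun z : R * R => heatU nu psi z.1 z.2)}.
  by case: z => x t t0; exact: continuous_heatU.
have c1 z : 0 < z.2 -> {for z, continuous (fun z : R * R =>
    heatU (nu + 1) (fun y => y ^+ 2 * psi y) z.1 z.2)}.
  by case: z => x t t0; exact: continuous_heatU.
have c2 z : 0 < z.2 -> {for z, continuous (fun z : R * R =>
    heatU (nu + 2) (fun y => y ^+ 2 * (y ^+ 2 * psi y)) z.1 z.2)}.
  by case: z => x t t0; exact: continuous_heatU.
have cf (z : R * R) : {for z, continuous (fun z : R * R => z.1)} by exact: cvg_fst.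
have cs (z : R * R) : {for z, continuous (fun z : R * R => z.2)} by exact: cvg_snd.
have ci (k : R) (z : R * R) : 0 < k -> 0 < z.2 -> {for z, continuous (fun z : R * R => (k * z.2)^-1)}.
  move=> k0 z0; apply: cvgV; first by rewrite gt_eqF// mulr_gt0.
  by apply: cvgM; [exact: cvg_cst|exact: cs].
have ci2 (z : R * R) : 0 < z.2 -> {for z, continuous (fun z : R * R => z.1 ^+ 2 / (4 * z.2 ^+ 2))}.
  move=> z0; apply: cvgM.
    rewrite (_ : (fun z : R * R => _) = (fun z => z.1 * z.1)) //.
    by apply: cvgM; exact: cf.
  apply: cvgV; first by rewrite gt_eqF// mulr_gt0// exprn_gt0.
  apply: cvgM; first exact: cvg_cst.
  rewrite (_ : (fun z : R * R => _) = (fun z => z.2 * z.2)) //.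
  by apply: cvgM; exact: cs.
split; last first.
  move=> x t x0 t0; rewrite yyE// tE// dy_heatU//.
  (* The brackets with x^2 / (4 t^2) coincide, and what remains is 1/(2t) + (2 nu + 1)/(2t) = (nu +
     1)/t. *)
  move: (heatU _ _ _ _) (heatU _ _ _ _) (heatU _ _ _ _) => U1 U0 U2.
  by field; rewrite !gt_eqF.
split.
  move=> x t x0 t0; split.
  - by have [] := is_derive_heatU_x x hn h t0.
  - by have [] := is_derive_dy_heatU x hn h t0.
  - by have [] := is_derive_heatU_t x hn h t0.
split => x t x0 t0.
- exact: continuous_heatU.
- apply: (@continuous_eq_near _ _ _ (fun z : R * R => z.1 * (2 * z.2)^-1 *
    (heatU (nu + 1) (fun y => y ^+ 2 * psi y) z.1 z.2 - heatU nu psi z.1 z.2))).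
    by apply: filterS (near_snd_gt0 (t0 : 0 < (x, t).2)) => z z0; rewrite dy_heatU.
  apply: cvgM; last by apply: cvgB; [exact: c1|exact: c0].
  by apply: cvgM; [exact: cf|exact: ci].
- apply: (@continuous_eq_near _ _ _ (fun z : R * R => (2 * z.2)^-1 *
    (heatU (nu + 1) (fun y => y ^+ 2 * psi y) z.1 z.2 - heatU nu psi z.1 z.2)
    + z.1 ^+ 2 / (4 * z.2 ^+ 2) *
       (heatU (nu + 2) (fun y => y ^+ 2 * (y ^+ 2 * psi y)) z.1 z.2
        - 2 * heatU (nu + 1) (fun y => y ^+ 2 * psi y) z.1 z.2 + heatU nu psi z.1 z.2))).
    by apply: filterS (near_snd_gt0 (t0 : 0 < (x, t).2)) => z z0; rewrite yyE.
  apply: cvgD; apply: cvgM.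
  + exact: ci.
  + by apply: cvgB; [exact: c1|exact: c0].
  + exact: ci2.
  + apply: cvgD; last exact: c0.
    apply: cvgB; first exact: c2.
    by apply: cvgM; [exact: cvg_cst|exact: c1].
- apply: (@continuous_eq_near _ _ _ (fun z : R * R => (nu + 1) * (1 * z.2)^-1 *
    (heatU (nu + 1) (fun y => y ^+ 2 * psi y) z.1 z.2 - heatU nu psi z.1 z.2)
    + z.1 ^+ 2 / (4 * z.2 ^+ 2) *
       (heatU (nu + 2) (fun y => y ^+ 2 * (y ^+ 2 * psi y)) z.1 z.2
        - 2 * heatU (nu + 1) (fun y => y ^+ 2 * psi y) z.1 z.2 + heatU nu psi z.1 z.2))).
    by apply: filterS (near_snd_gt0 (t0 : 0 < (x, t).2)) => z z0; rewrite tE// mul1r.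
  apply: cvgD; apply: cvgM.
  + by apply: cvgM; [exact: cvg_cst|exact: ci].
  + by apply: cvgB; [exact: c1|exact: c0].
  + exact: ci2.
  + apply: cvgD; last exact: c0.
    apply: cvgB; first exact: c2.
    by apply: cvgM; [exact: cvg_cst|exact: c1].
Qed.

End heat_potential_derivatives.

(** * Polynomial weights under the heat flow *)

Section weights.
Context {R : realType}.
Notation mu := (@lebesgue_measure R).
Notation D := (`]0%R, +oo[%classic : set R).
Implicit Types (nu s x y t : R).

(** A power of the Japanese bracket. The exponent s may have either sign: the weight decays for s >
    0 and grows for s < 0. *)
Definition cweight s y : R := (1 + y ^+ 2) `^ (- s).

Lemma bracket_gt0 y : 0 < 1 + y ^+ 2.
Proof. by rewrite ltr_wpDr ?sqr_ge0. Qed.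

Lemma bracket_ge1 y : 1 <= 1 + y ^+ 2.
Proof. by rewrite lerDl sqr_ge0. Qed.

Lemma cweight_gt0 s y : 0 < cweight s y.
Proof. by rewrite powR_gt0// bracket_gt0. Qed.

Lemma cweight_ge0 s y : 0 <= cweight s y.
Proof. exact/ltW/cweight_gt0. Qed.

Lemma measurable_cweight s (A : set R) : measurable_fun A (cweight s).
Proof.
apply: (@measurableT_comp _ _ _ _ _ _ (@powR R ^~ (- s))).
  exact: measurable_powR.
by apply: measurable_funD.
Qed.

Lemma powR_le_abs (a b p : R) : 1 <= a -> a <= b -> a `^ p <= b `^ `|p|.
Proof.
move=> a1 ab; have a0 : 0 <= a by lra.
apply: (@le_trans _ _ (a `^ `|p|)); first by apply: ler_powR => //; exact: ler_norm.
by apply: ge0_ler_powR; rewrite ?nnegrE//; lra.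
Qed.

Lemma cweightV s y : (cweight s y)^-1 = cweight (- s) y.
Proof. by rewrite /cweight -powRN. Qed.

Lemma gaussian_le_cweight s (c : R) : 0 < c ->
  exists2 C, 0 < C & forall y, expR (- (c * y ^+ 2)) <= C * cweight s y.
Proof.
move=> c0; have [C C0 hC] := powR_le_expR (normr_ge0 s) c0.
exists (C * expR c); first by rewrite mulr_gt0// expR_gt0.
move=> y; rewrite -ler_pdivrMr ?cweight_gt0// cweightV /cweight opprK.
have h1 := bracket_ge1 y.
have h : (1 + y ^+ 2) `^ s <= C * expR (c * (1 + y ^+ 2)).
  by apply: le_trans (hC _ (bracket_gt0 y)); exact: powR_le_abs.
apply: le_trans (ler_wpM2l (expR_ge0 _) h) _.
rewrite mulrCA -expRD ler_pM2l// ler_expR; lra.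
Qed.

Lemma integral_heatK1 nu x t : -1 < nu -> 0 < t ->
  (\int[mu]_(y in D) (heatK nu x y t * y `^ (2 * nu + 1))%:E = 1)%E.
Proof.
move=> hn t0; have := @Rint_heatK_exp R nu x t 0 hn t0.
rewrite mulr0 mul0r addr0 ltr01 => /(_ isT).
under eq_integral do rewrite mul0r oppr0 expR0 mul1r.
by rewrite powR1 mul0r mul0r oppr0 expR0 mulr1.
Qed.

Lemma integral_heatK_sqr nu x t : -1 < nu -> 0 < t ->
  (\int[mu]_(y in D) (y ^+ 2 * heatK nu x y t * y `^ (2 * nu + 1))%:E
   = (x ^+ 2 + 4 * t * (nu + 1))%:E)%E.
Proof.
move=> hn t0.
have hn1 : -1 < nu + 1 by lra.
have hn2 : -1 < nu + 2 by lra.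
have c0 : 0 <= 4 * t * (nu + 1) by rewrite !mulr_ge0//; lra.
transitivity (\int[mu]_(y in D) ((x ^+ 2)%:E * (heatK (nu + 2) x y t * y `^ (2 * (nu + 2) + 1))%:E
   + (4 * t * (nu + 1))%:E * (heatK (nu + 1) x y t * y `^ (2 * (nu + 1) + 1))%:E))%E.
  apply: eq_integral => y; rewrite inE/= in_itv/= andbT => y0.
  rewrite -!EFinM -EFinD heatK_rec//; congr (_%:E).
  have -> : 2 * (nu + 2) + 1 = (2 * nu + 1) + 1 + 1 + 1 + 1 by ring.
  have -> : 2 * (nu + 1) + 1 = (2 * nu + 1) + 1 + 1 by ring.
  rewrite !powRS//; ring.
have m j : -1 < j -> measurable_fun D (fun y => (heatK j x y t * y `^ (2 * j + 1))%:E).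
  move=> hj; apply/measurable_EFinP; apply: measurable_funM.
    exact: measurable_heatK.
  exact: measurable_powR_id.
have p j y : -1 < j -> (0 <= (heatK j x y t * y `^ (2 * j + 1))%:E)%E.
  by move=> hj; rewrite lee_fin mulr_ge0 ?powR_ge0 ?heatK_ge0.
rewrite ge0_integralD//; last 4 first.
- by move=> y _; rewrite mule_ge0 ?p// lee_fin sqr_ge0.
- by apply: measurable_funeM; exact: m.
- by move=> y _; rewrite mule_ge0 ?p.
- by apply: measurable_funeM; exact: m.
rewrite !ge0_integralZl//; try exact: m; try (by move=> y _; exact: p).
- by rewrite !integral_heatK1// !mule1 -EFinD.
- by rewrite lee_fin sqr_ge0.
Qed.

Lemma ge0_le_integralD (f g : R -> R) : (forall y, 0 < y -> 0 <= f y <= g y) ->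
  measurable_fun D f -> measurable_fun D g ->
  (\int[mu]_(y in D) (f y)%:E <= \int[mu]_(y in D) (g y)%:E)%E.
Proof.
move=> fg mf mg; apply: ge0_le_integral => //; try exact: measurable_halfline.
- by move=> y /=; rewrite in_itv/= andbT => /fg /andP[+ _].
- exact/measurable_EFinP.
- exact/measurable_EFinP.
- by move=> y /=; rewrite in_itv/= andbT => /fg /andP[_]; rewrite lee_fin.
Qed.

Lemma measurable_heatK_density nu x t (f : R -> R) : -1 < nu -> measurable_fun D f ->
  measurable_fun D (fun y => f y * heatK nu x y t * y `^ (2 * nu + 1)).
Proof.
move=> hn mf; apply: measurable_funM; last exact: measurable_powR_id.
by apply: measurable_funM => //; exact: measurable_heatK.
Qed.

(** The kernel has mass 1, so an affine majorant of the weight integrates to the same affine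
    expression. The function g will be a Gaussian for s >= 0 and y^2 for s <= 0. *)
Lemma heat_cweight_affine nu s (a b x t : R) (g : R -> R) : -1 < nu -> 0 < t ->
  0 <= a -> 0 <= b -> measurable_fun D g -> (forall y, 0 <= g y) ->
  (forall y, cweight s y <= a + b * g y) ->
  (\int[mu]_(y in D) (cweight s y * heatK nu x y t * y `^ (2 * nu + 1))%:E
   <= a%:E + b%:E * \int[mu]_(y in D) (g y * heatK nu x y t * y `^ (2 * nu + 1))%:E)%E.
Proof.
move=> hn t0 a0 b0 mg g0 hg.
have mK : measurable_fun D (fun y => heatK nu x y t * y `^ (2 * nu + 1)).
  by apply: measurable_funM; [exact: measurable_heatK|exact: measurable_powR_id].
have mgK := measurable_heatK_density x t hn mg.
have K0 y : 0 <= heatK nu x y t * y `^ (2 * nu + 1) by rewrite mulr_ge0 ?powR_ge0 ?heatK_ge0.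
have gK0 y : 0 <= g y * heatK nu x y t * y `^ (2 * nu + 1) by rewrite -mulrA mulr_ge0.
have mD := @measurable_halfline R.
have E : (a%:E + b%:E * \int[mu]_(y in D) (g y * heatK nu x y t * y `^ (2 * nu + 1))%:E =
    \int[mu]_(y in D) (a * (heatK nu x y t * y `^ (2 * nu + 1))
      + b * (g y * heatK nu x y t * y `^ (2 * nu + 1)))%:E)%E.
  rewrite -[X in (X + _)%E]mule1 -(integral_heatK1 x hn t0) -!ge0_integralZl_EFin//;
    try exact/measurable_EFinP; try by move=> y _; rewrite lee_fin.
  rewrite -ge0_integralD//; try (by apply: measurable_funeM; exact/measurable_EFinP);
    by move=> y _; rewrite mule_ge0// lee_fin.
rewrite E; apply: ge0_le_integralD.
- move=> y _; rewrite !mulr_ge0 ?cweight_ge0 ?heatK_ge0 ?powR_ge0//=.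
  have -> : a * (heatK nu x y t * y `^ (2 * nu + 1)) + b * (g y * heatK nu x y t * y `^ (2 * nu + 1))
    = (a + b * g y) * (heatK nu x y t * y `^ (2 * nu + 1)) by ring.
  by rewrite -mulrA ler_wpM2r.
- by apply: measurable_heatK_density => //; exact: measurable_cweight.
- by apply: measurable_funD; exact: measurable_funM.
Qed.

(* Where y >= x/2 the two weights are comparable; where y < x/2 the Chernoff
   bound exp (l (x^2/4 - y^2)) with l = 1/(4t) makes the kernel mass Gaussian in x. *)
Lemma heat_cweight_le_ge0 nu s (T : R) : -1 < nu -> 0 <= s -> 0 < T ->
  exists2 C, 0 < C & forall x t, 0 < t <= T ->
   (\int[mu]_(y in D) (cweight s y * heatK nu x y t * y `^ (2 * nu + 1))%:E
     <= (C * cweight s x)%:E)%E.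
Proof.
move=> hn s0 T0.
have c0 : 0 < (16 * T)^-1 by rewrite invr_gt0 mulr_gt0.
have [C C0 hC] := gaussian_le_cweight s c0.
exists (4 `^ s + C); first by rewrite addr_gt0// powR_gt0.
move=> x t /andP[t0 tT].
pose l := (4 * t)^-1; have l0 : 0 < l by rewrite invr_gt0 mulr_gt0.
have k2 : 1 + 4 * l * t = 2 by rewrite /l; field; rewrite gt_eqF.
have a0 : 0 <= 4 `^ s * cweight s x by rewrite mulr_ge0 ?powR_ge0.
have hb y : cweight s y <= 4 `^ s * cweight s x + expR (l * x ^+ 2 / 4) * expR (- (l * y ^+ 2)).
  rewrite -expRD.
  have [h|h] := leP (x ^+ 2 / 4) (y ^+ 2).
    apply: ler_wpDr; first exact: expR_ge0.
    rewrite /cweight !powRN.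
    rewrite -ler_pdivrMl ?powR_gt0// -invfM -powRM ?ler0n ?(ltW (bracket_gt0 _))//.
    rewrite lef_pV2 ?posrE ?powR_gt0 ?mulr_gt0 ?bracket_gt0//.
    by apply: ge0_ler_powR; rewrite ?nnegrE//; have := sqr_ge0 y; have := sqr_ge0 x; lra.
  apply: ler_wpDl => //; apply: (@le_trans _ _ 1).
    rewrite /cweight powRN invf_le1 ?powR_gt0 ?bracket_gt0//.
    by rewrite -[leLHS](powRr0 (1 + y ^+ 2)); apply: ler_powR => //; exact: bracket_ge1.
  rewrite -[leLHS]expR0 ler_expR.
  have : 0 <= l * (x ^+ 2 / 4 - y ^+ 2) by rewrite mulr_ge0 ?(ltW l0)//; lra.
  by rewrite mulrBr mulrA.
have mg : measurable_fun D (fun y => expR (- (l * y ^+ 2))) by exact: measurable_gaussian.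
apply: le_trans (heat_cweight_affine x hn t0 a0 (expR_ge0 _) mg (fun y => expR_ge0 _) hb) _.
rewrite Rint_heatK_exp ?k2// -EFinM -EFinD lee_fin mulrDl lerD2l.
have h2 : 2 `^ (- (nu + 1)) <= 1 :> R.
  by rewrite -[leRHS](powRr0 2); apply: ler_powR; lra.
apply: (@le_trans _ _ (expR (l * x ^+ 2 / 4) * expR (- (l * x ^+ 2 / 2)))).
  by rewrite ler_wpM2l ?expR_ge0// ler_piMl ?expR_ge0.
rewrite -expRD; apply: le_trans (hC x); rewrite ler_expR.
have -> : l * x ^+ 2 / 4 - l * x ^+ 2 / 2 = - ((16 * t)^-1 * x ^+ 2).
  by rewrite /l; field; rewrite gt_eqF.
rewrite lerN2 ler_wpM2r ?sqr_ge0// lef_pV2 ?posrE ?mulr_gt0//.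
by rewrite ler_pM2l.
Qed.

(** With r = (1 + y^2) / (1 + x^2) and 0 <= -s <= 1 one has r^(-s) <= 1 + r, and the integral of r
    is a second moment. This is where -1 <= s enters. *)
Lemma heat_cweight_le_le0 nu s (T : R) : -1 < nu -> -1 <= s -> s <= 0 -> 0 < T ->
  exists2 C, 0 < C & forall x t, 0 < t <= T ->
   (\int[mu]_(y in D) (cweight s y * heatK nu x y t * y `^ (2 * nu + 1))%:E
     <= (C * cweight s x)%:E)%E.
Proof.
move=> hn s1 s0 T0.
have N0 : 0 < nu + 1 by lra.
exists (2 + 4 * T * (nu + 1)); first by rewrite addr_gt0// !mulr_gt0.
move=> x t /andP[t0 tT].
have b0 := bracket_gt0 x; have b1 := bracket_ge1 x.
pose W := cweight s x; have W0 : 0 <= W by exact: cweight_ge0.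
pose A := W * (1 + (1 + x ^+ 2)^-1); pose B := W * (1 + x ^+ 2)^-1.
have A0 : 0 <= A by rewrite mulr_ge0// addr_ge0// invr_ge0 ltW.
have B0 : 0 <= B by rewrite mulr_ge0// invr_ge0 ltW.
have msq : measurable_fun D (fun y : R => y ^+ 2) by exact: measurable_funX.
have hb y : cweight s y <= A + B * y ^+ 2.
  have r0 : 0 < (1 + y ^+ 2) / (1 + x ^+ 2) by rewrite divr_gt0 ?bracket_gt0.
  have -> : cweight s y = W * ((1 + y ^+ 2) / (1 + x ^+ 2)) `^ (- s).
    rewrite /W /cweight -powRM ?(ltW b0) ?(ltW r0)//; congr (_ `^ _).
    by field; rewrite gt_eqF.
  have -> : A + B * y ^+ 2 = W * (1 + (1 + y ^+ 2) / (1 + x ^+ 2)).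
    by rewrite /A /B; field; rewrite gt_eqF.
  rewrite ler_wpM2l//.
  move: ((1 + y ^+ 2) / (1 + x ^+ 2)) r0 => r r0.
  have [r1|r1] := leP 1 r.
    by rewrite (@le_trans _ _ r) ?lerDr// ler1_powR//; lra.
  rewrite (@le_trans _ _ 1) ?lerDl ?(ltW r0)//.
  by rewrite -[leRHS](powRr0 r); apply: ger_powR; lra.
apply: le_trans (heat_cweight_affine x hn t0 A0 B0 msq (fun y => sqr_ge0 y) hb) _.
rewrite integral_heatK_sqr// -EFinM -EFinD lee_fin /A /B -/W.
have -> : W * (1 + (1 + x ^+ 2)^-1) + W / (1 + x ^+ 2) * (x ^+ 2 + 4 * t * (nu + 1))
   = (2 + 4 * t * (nu + 1) / (1 + x ^+ 2)) * W by field; rewrite gt_eqF.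
rewrite ler_wpM2r// lerD2l ler_pdivrMr// .
apply: (@le_trans _ _ (4 * T * (nu + 1))); first by rewrite ler_pM2r// ler_pM2l.
by rewrite ler_peMr// !mulr_ge0 ?(ltW T0) ?(ltW N0).
Qed.

(** The lemma is applied with s = (nu + 1/2) / 2, which exceeds -1/4, and with s + 1 for the
    derivative. *)
Lemma heat_cweight_le nu s (T : R) : -1 < nu -> -1 <= s -> 0 < T ->
  exists2 C, 0 < C & forall x t, 0 < t <= T ->
   (\int[mu]_(y in D) (cweight s y * heatK nu x y t * y `^ (2 * nu + 1))%:E
     <= (C * cweight s x)%:E)%E.
Proof.
move=> hn s1 T0; have [s0|/ltW s0] := leP 0 s.
  exact: heat_cweight_le_ge0.
exact: heat_cweight_le_le0.
Qed.

End weights.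

(** * Concentration of the kernel on the diagonal *)

Section approximate_identity.
Context {R : realType}.
Notation mu := (@lebesgue_measure R).
Notation D := (`]0%R, +oo[%classic : set R).
Implicit Types (nu s x y t : R) (phi psi : R -> R).

(* With |x - y| = d >= delta and x <= B, an exponent rate r close enough to 1
   in the bound E(z^2/4) <= C exp (r z) leaves the factor exp (- d^2/8t). *)
Lemma heatK_offdiag nu (B delta : R) : -1 < nu -> 0 < B -> 0 < delta ->
  exists2 C, 0 < C & forall x y t, 0 < x <= B -> 0 < y -> delta <= `|y - x| ->
    0 < t <= 1 -> heatK nu x y t <= C * t * expR (- (32^-1 * y ^+ 2)).
Proof.
move=> hn B0 d0.
(* The two members of the minimum handle the two terms of x y <= B (B + d): together they give 2 eps
   x y <= d^2 / 2. *)
pose eps := Num.min (delta ^+ 2 / (8 * B ^+ 2)) (delta / (8 * B)).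
have e0 : 0 < eps by rewrite lt_min !divr_gt0 ?mulr_gt0 ?exprn_gt0.
have e1 : eps * (8 * B ^+ 2) <= delta ^+ 2.
  by rewrite -ler_pdivlMr ?mulr_gt0 ?exprn_gt0// ge_min lexx.
have e2 : eps * (8 * B) <= delta.
  by rewrite -ler_pdivlMr ?mulr_gt0// ge_min lexx orbT.
have r1 : 1 < 1 + eps by rewrite ltrDl.
have [C C0 hC] := besselE_le_expR_sqr hn r1.
have n20 : 0 <= nu + 2 by lra.
(* One half of d^2 / (8 t) absorbs t^-(nu+2), one power more than the kernel carries, whence the
   factor t; the other half, as t <= 1, gives the Gaussian in y. *)
pose c := delta ^+ 2 / 16; have c0 : 0 < c by rewrite divr_gt0 ?exprn_gt0.
have [C1 C10 hC1] := powR_le_expR n20 c0.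
pose P := 2 * 4 `^ (- (nu + 1)) : R.
have P0 : 0 < P by rewrite mulr_gt0// powR_gt0.
exists (P * C * C1 * expR (16^-1 * B ^+ 2)); first by rewrite !mulr_gt0// expR_gt0.
move=> x y t /andP[x0 xB] y0 hd /andP[t0 t1].
have ti : 0 < t^-1 by rewrite invr_gt0.
rewrite heatK.unlock.
have -> : (x * y / (4 * t)) ^+ 2 = (x * y / (2 * t)) ^+ 2 / 4 by field; rewrite gt_eqF.
have z0 : 0 <= x * y / (2 * t) by rewrite divr_ge0// ?mulr_ge0 ?ltW// mulr_gt0.
have p0 : 0 <= 2 * (4 * t) `^ (- (nu + 1)) by rewrite mulr_ge0 ?powR_ge0.
apply: le_trans (ler_wpM2r (expR_ge0 _) (ler_wpM2l p0 (hC _ z0))) _.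
have -> : 2 * (4 * t) `^ (- (nu + 1)) = P * t^-1 `^ (nu + 2) * t.
  rewrite /P powRM ?(ltW t0)// -!mulrA; congr (_ * (_ * _)).
  have -> : nu + 2 = (nu + 1) + 1 by ring.
  rewrite powRS// -mulrA mulVf ?mulr1 ?gt_eqF//.
  by rewrite -powR_inv1 ?(ltW t0)// -powRrM mulN1r.
pose d := `|y - x|.
have dd : d ^+ 2 = (y - x) ^+ 2 by rewrite /d real_normK ?num_real.
have yd : y <= B + d by have := ler_norm (y - x); rewrite -/d; lra.
have d00 : 0 < d by exact: lt_le_trans hd.
have hdd : delta ^+ 2 <= d ^+ 2 by rewrite lerXn2r// nnegrE ltW.
have hexp : (1 + eps) * (x * y / (2 * t)) - (x ^+ 2 + y ^+ 2) / (4 * t)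
   <= t^-1 * (- (d ^+ 2 / 8)).
  have -> : (1 + eps) * (x * y / (2 * t)) - (x ^+ 2 + y ^+ 2) / (4 * t) =
     t^-1 * ((2 * eps * (x * y) - (y - x) ^+ 2) / 4) by field; rewrite gt_eqF.
  rewrite ler_pM2l// -dd.
  have h1 : x * y <= B * (B + d) by apply: ler_pM => //; exact: ltW.
  have h2 : eps * (x * y) <= eps * (B * (B + d)) by rewrite ler_pM2l.
  have h3 : eps * (8 * B) * d <= delta * d by rewrite ler_pM2r.
  have h4 : delta * d <= d ^+ 2 by rewrite expr2 ler_pM2r.
  lra.
have h8 : t^-1 * (- (d ^+ 2 / 8)) <= - (c * t^-1) + (16^-1 * B ^+ 2 - 32^-1 * y ^+ 2).
  have a1 : d ^+ 2 <= t^-1 * d ^+ 2.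
    by rewrite ler_peMl ?sqr_ge0// invf_ge1.
  have a2 : t^-1 * delta ^+ 2 <= t^-1 * d ^+ 2 by rewrite ler_pM2l.
  have a3 : y ^+ 2 <= 2 * B ^+ 2 + 2 * d ^+ 2.
    have : y ^+ 2 <= (B + d) ^+ 2 by rewrite lerXn2r// nnegrE ltW// addr_gt0.
    have := sqr_ge0 (B - d); rewrite sqrrB sqrrD; lra.
  by rewrite /c; lra.
have := hC1 _ ti; set Q := t^-1 `^ (nu + 2) => hQ.
have hX : expR ((1 + eps) * (x * y / (2 * t))) * expR (- ((x ^+ 2 + y ^+ 2) / (4 * t)))
   <= expR (- (c * t^-1)) * (expR (16^-1 * B ^+ 2) * expR (- (32^-1 * y ^+ 2))).
  by rewrite -!expRD ler_expR; exact: le_trans hexp h8.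
have hQ0 : 0 <= Q by exact: powR_ge0.
rewrite mulrA -mulrA.
apply: le_trans (ler_wpM2l _ hX) _.
  by rewrite !mulr_ge0 ?(ltW P0) ?(ltW C0) ?(ltW t0).
have hQ2 : Q * expR (- (c * t^-1)) <= C1.
  by rewrite expRN ler_pdivrMr ?expR_gt0.
have -> : P * Q * t * C * (expR (- (c * t^-1)) *
    (expR (16^-1 * B ^+ 2) * expR (- (32^-1 * y ^+ 2)))) =
  P * C * (Q * expR (- (c * t^-1))) * expR (16^-1 * B ^+ 2) * t * expR (- (32^-1 * y ^+ 2)).
  by ring.
have PC : 0 <= P * C by rewrite mulr_ge0 ?(ltW P0) ?(ltW C0).
by rewrite ler_wpM2r ?expR_ge0// ler_wpM2r ?(ltW t0)// ler_wpM2r ?expR_ge0// ler_wpM2l.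
Qed.

(** The density with respect to dy of phi times the reference measure, the form in which [heatU]
    takes its datum. *)
Definition radial nu phi : R -> R := fun y => phi y * y `^ (2 * nu + 1).

Lemma integrable_ge0_R (A : set R) (f : R -> R) : measurable A -> measurable_fun A f ->
  (forall y, A y -> 0 <= f y) -> (\int[mu]_(y in A) (f y)%:E < +oo)%E ->
  mu.-integrable A (EFin \o f).
Proof.
move=> mA mf f0 h; apply/integrableP; split; first exact/measurable_EFinP.
rewrite (_ : (\int[mu]_(y in A) `|(EFin \o f) y| = \int[mu]_(y in A) (f y)%:E)%E)//.
by apply: eq_integral => y; rewrite inE => Ay; rewrite /= ger0_norm// f0.
Qed.

Lemma tempered_cst nu (c : R) : -1 < nu -> tempered (radial nu (fun=> c)).
Proof.
move=> hn b b0.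
rewrite (_ : EFin \o _ = EFin \o (fun y => c * (y `^ (2 * nu + 1) * expR (- (b * y ^+ 2))))).
  apply: integrable_scale; first exact: measurable_halfline.
  apply: integrable_ge0_R; first exact: measurable_halfline.
  - apply: measurable_funM; first exact: measurable_powR_id.
    exact: measurable_gaussian.
  - by move=> y _; rewrite mulr_ge0 ?powR_ge0 ?expR_ge0.
  - have := @gaussian_moment R (nu + 1) b _ b0.
    have -> : 2 * (nu + 1) - 1 = 2 * nu + 1 by ring.
    by move=> -> //; [rewrite ltry|lra].
by apply/funext => y; rewrite /radial/= mulrA.
Qed.

Lemma tempered_sub psi1 psi2 : tempered psi1 -> tempered psi2 ->
  tempered (fun y => psi1 y - psi2 y).
Proof.
move=> h1 h2 c c0.
rewrite (_ : EFin \o _ = (fun y => (psi1 y * expR (- (c * y ^+ 2)))%:E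
    - (psi2 y * expR (- (c * y ^+ 2)))%:E)%E).
  by apply: integrableB; [exact: measurable_halfline|exact: h1|exact: h2].
by apply/funext => y; rewrite /= mulrBl EFinB.
Qed.

Lemma tempered_abs psi : tempered psi -> tempered (fun y => `|psi y|).
Proof.
move=> h c c0; have /integrable_abse := h c c0.
rewrite (_ : (abse \o _)%E = EFin \o (fun y => `|psi y| * expR (- (c * y ^+ 2)))) //.
by apply/funext => y; rewrite /= normrM (ger0_norm (expR_ge0 _)).
Qed.

Lemma le_heatU_abs nu psi x t : -1 < nu -> 0 < t -> tempered psi ->
  `|heatU nu psi x t| <= heatU nu (fun y => `|psi y|) x t.
Proof.
move=> hn t0 h; apply: le_trans (le_normr_Rintegral _ _) _.
- exact: measurable_halfline.
- exact: integrable_heatU.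
rewrite le_eqVlt; apply/orP; left; apply/eqP; apply: eq_Rintegral => y _.
by rewrite normrM (ger0_norm (heatK_ge0 _ _ _ hn)).
Qed.

Lemma heatU_cst nu (c : R) x t : -1 < nu -> 0 < t -> heatU nu (radial nu (fun=> c)) x t = c.
Proof.
move=> hn t0; have I := integrable_heatU x hn t0 (tempered_cst 1 hn).
have e1 : heatU nu (radial nu (fun=> 1)) x t = 1.
  rewrite /heatU /Rintegral (_ : (\int[mu]_(y in D) _)%E = 1%E) //.
  rewrite -[RHS](integral_heatK1 x hn t0).
  by apply: eq_integral => y _; rewrite /radial mul1r mulrC.
rewrite -[RHS]mulr1 -e1 /heatU -RintegralZl//.
by apply: eq_Rintegral => y _; rewrite /radial mul1r mulrA.
Qed.

Lemma heatU_sub nu psi1 psi2 x t : -1 < nu -> 0 < t -> tempered psi1 -> tempered psi2 ->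
  heatU nu (fun y => psi1 y - psi2 y) x t = heatU nu psi1 x t - heatU nu psi2 x t.
Proof.
move=> hn t0 h1 h2; rewrite /heatU -RintegralB; last 3 first.
- exact: measurable_halfline.
- exact: integrable_heatU.
- exact: integrable_heatU.
by apply: eq_Rintegral => y _; rewrite mulrBl.
Qed.

(** Constants are preserved, so the difference is the evolution of phi - c. Within delta of x it
    contributes at most eta by unit mass; elsewhere the off-diagonal bound supplies the factor t.
    The constant C does not depend on phi or c, because the lemma is also applied to the varying
    data f(., s) in the uniqueness proof. *)
Lemma heatU_near nu (B delta : R) : -1 < nu -> 0 < B -> 0 < delta ->
  exists2 C, 0 < C & forall phi c eta x t, 0 < x <= B -> 0 < t <= 1 -> 0 <= eta ->
    tempered (radial nu phi) ->
    (forall y, 0 < y -> `|y - x| < delta -> `|phi y - c| <= eta) ->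
    `|heatU nu (radial nu phi) x t - c| <=
      eta + C * t * ((\int[mu]_(y in D) (`|radial nu phi y| * expR (- (32^-1 * y ^+ 2))))%R + `|c|).
Proof.
move=> hn B0 d0; have [C C0 hC] := heatK_offdiag hn B0 d0.
have q0 : (0 : R) < 32^-1 by [].
pose M := (\int[mu]_(y in D) (radial nu (fun=> 1) y * expR (- (32^-1 * y ^+ 2))))%R.
have iM := tempered_cst 1 hn q0.
have M0 : 0 <= M.
  by apply: Rintegral_ge0 => y _; rewrite !mulr_ge0 ?powR_ge0 ?expR_ge0.
exists (C * (1 + M)); first by rewrite mulr_gt0//; lra.
move=> phi c eta x t hx /andP[t0 t1] eta0 hphi hc.
have hcst := tempered_cst c hn.
have ht : tempered (fun y => radial nu phi y - radial nu (fun=> c) y) by exact: tempered_sub.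
rewrite -{1}(heatU_cst c x hn t0) -heatU_sub//.
apply: le_trans (le_heatU_abs _ _ _ _) _ => //.
have iN : mu.-integrable D (EFin \o (fun y => `|radial nu phi y| * expR (- (32^-1 * y ^+ 2)))).
  exact: tempered_abs hphi _ q0.
set N := (\int[mu]_(y in D) (`|radial nu phi y| * expR (- (32^-1 * y ^+ 2))))%R.
have iK := integrable_heatU x hn t0 (tempered_cst eta hn).
have iK1 : mu.-integrable D (EFin \o (fun y =>
   C * t * (`|radial nu phi y| * expR (- (32^-1 * y ^+ 2))))).
  exact: integrable_scale.
have iK2 : mu.-integrable D (EFin \o (fun y =>
   C * t * `|c| * (radial nu (fun=> 1) y * expR (- (32^-1 * y ^+ 2))))).
  exact: integrable_scale.
apply: (@le_trans _ _ (\int[mu]_(y in D) (radial nu (fun=> eta) y * heatK nu x y t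
  + (C * t * (`|radial nu phi y| * expR (- (32^-1 * y ^+ 2))))
  + (C * t * `|c| * (radial nu (fun=> 1) y * expR (- (32^-1 * y ^+ 2)))))%R)%R).
  apply: le_Rintegral => //.
  - exact: integrable_heatU hn t0 (tempered_abs ht).
  - by do 2?[apply: integrable_add => //].
  move=> y /=; rewrite in_itv/= andbT => y0.
  have w0 : 0 <= y `^ (2 * nu + 1) by exact: powR_ge0.
  rewrite /radial mul1r -mulrBl normrM (ger0_norm w0) normrM (ger0_norm w0).
  have K0 := heatK_ge0 x y t hn.
  set w := y `^ _ in w0 *; set G := expR _; set K := heatK nu x y t in K0 *.
  have G0 : 0 <= G by exact: expR_ge0.
  have [h|h] := ltP `|y - x| delta.
    have h1 := hc y y0 h.
    rewrite -addrA -[leLHS]addr0; apply: lerD.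
      by rewrite ler_wpM2r// ler_wpM2r.
    rewrite addr_ge0 ?mulr_ge0 ?(ltW C0) ?(ltW t0)//.
  have hK : K <= C * t * G by apply: hC; rewrite ?t0.
  have h2 : `|phi y - c| <= `|phi y| + `|c| by exact: ler_normB.
  rewrite -addrA -[leLHS]add0r; apply: lerD; first by rewrite !mulr_ge0.
  apply: (@le_trans _ _ ((`|phi y| + `|c|) * w * (C * t * G))).
    by apply: ler_pM => //; rewrite ?mulr_ge0// ler_wpM2r.
  by rewrite le_eqVlt; apply/orP; left; apply/eqP; ring.
rewrite RintegralD//; last exact: integrable_add.
rewrite RintegralD// !RintegralZl// -/N -/M.
rewrite -[X in X + _ + _]/(heatU nu (radial nu (fun=> eta)) x t) heatU_cst//.
rewrite -addrA lerD2l.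
have N0 : 0 <= N by apply: Rintegral_ge0 => y _; rewrite mulr_ge0 ?expR_ge0.
have -> : C * (1 + M) * t * (N + `|c|) = C * t * N + C * t * `|c| * M
   + C * t * (M * N + `|c|) by ring.
rewrite -[leLHS]addr0 lerD2l.
by rewrite mulr_ge0 ?addr_ge0 ?mulr_ge0 ?(ltW C0) ?(ltW t0).
Qed.

End approximate_identity.

(** * The weighted L^1 norm and the topology of C_nu *)

Section weighted_L1.
Context {R : realType}.
Notation mu := (@lebesgue_measure R).
Notation D := (`]0%R, +oo[%classic : set R).
Implicit Types (nu s x y t : R) (phi psi : R -> R).

Lemma powR_sqr y s : 0 < y -> y `^ (2 * s) = (y ^+ 2) `^ s.
Proof. by move=> y0; rewrite powRrM powR_mulrn// ltW. Qed.

Lemma cweight_far s (r : R) : 0 < r -> exists2 C, 0 < C &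
  forall y, r <= y -> y `^ (- (2 * s)) <= C * cweight s y.
Proof.
move=> r0; exists ((1 + r ^- 2) `^ `|s|).
  by rewrite powR_gt0// ltr_wpDr// invr_ge0 sqr_ge0.
move=> y ry; have y0 : 0 < y by exact: lt_le_trans ry.
have y20 : 0 < y ^+ 2 by rewrite exprn_gt0.
have i0 : 0 <= y ^- 2 by rewrite invr_ge0 ltW.
have -> : y `^ (- (2 * s)) = (1 + y ^- 2) `^ s * cweight s y.
  have -> : cweight s y = (y ^+ 2) `^ (- s) * (1 + y ^- 2) `^ (- s).
    rewrite /cweight -powRM ?(ltW y20) ?addr_ge0//; congr (_ `^ _).
    by field; rewrite gt_eqF.
  rewrite -mulrN powR_sqr// mulrCA -powRD ?subrr ?powRr0 ?mulr1//.
  have z0 : 0 < 1 + y ^- 2 by rewrite ltr_wpDr.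
  by rewrite (gt_eqF z0) implybT.
rewrite ler_wpM2r ?cweight_ge0//; apply: powR_le_abs; first by rewrite lerDl.
rewrite lerD2l lef_pV2 ?posrE ?exprn_gt0// lerXn2r// nnegrE ltW//.
Qed.

Lemma cweight_far_rev s (r : R) : 0 < r -> exists2 C, 0 < C &
  forall y, r <= y -> cweight s y <= C * y `^ (- (2 * s)).
Proof.
move=> r0; have [C C0 hC] := cweight_far (- s) r0.
exists C => // y ry; have y0 : 0 < y by exact: lt_le_trans ry.
have := hC y ry; rewrite -cweightV -mulrN opprK ler_pdivlMr ?cweight_gt0//.
by rewrite powRN ler_pdivlMr ?powR_gt0// mulrC.
Qed.

Lemma cweight_near s (r : R) : 0 < r -> exists2 C, 0 < C &
  forall y, 0 < y <= r -> cweight s y <= C.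
Proof.
move=> r0; exists ((1 + r ^+ 2) `^ `|s|); first by rewrite powR_gt0// bracket_gt0.
move=> y /andP[y0 yr]; rewrite -(normrN s); apply: powR_le_abs.
  exact: bracket_ge1.
by rewrite lerD2l lerXn2r// nnegrE ltW.
Qed.

Lemma cweight_near_rev s (r : R) : 0 < r -> exists2 C, 0 < C &
  forall y, 0 < y <= r -> 1 <= C * cweight s y.
Proof.
move=> r0; have [C C0 hC] := cweight_near (- s) r0.
exists C => // y hy; have := hC y hy.
by rewrite -cweightV -[X in X <= _]mul1r ler_pdivrMr ?cweight_gt0.
Qed.

Definition weighted_int nu s phi :=
  mu.-integrable D (EFin \o (fun y => radial nu phi y * cweight s y)).

Lemma weighted_int_measurable nu s phi : weighted_int nu s phi ->
  measurable_fun D (radial nu phi).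
Proof.
move=> /measurable_int /measurable_EFinP h.
rewrite (_ : radial nu phi = fun y => (radial nu phi y * cweight s y) * cweight (- s) y).
  by apply: measurable_funM => //; exact: measurable_cweight.
by apply/funext => y; rewrite -cweightV mulfK// gt_eqF// cweight_gt0.
Qed.

Lemma weighted_int_tempered nu s phi : weighted_int nu s phi -> tempered (radial nu phi).
Proof.
move=> h c c0; have [C C0 hC] := gaussian_le_cweight s c0.
have := integrable_scale C (@measurable_halfline R) h.
apply: le_integrable_R; first exact: measurable_halfline.
  apply: measurable_funM; last exact: measurable_gaussian.
  exact: weighted_int_measurable h.
move=> y _; rewrite [leRHS]normrM (gtr0_norm C0) !(normrM (radial nu phi y)).
rewrite (ger0_norm (expR_ge0 _)) (ger0_norm (cweight_ge0 _ _)) [leRHS]mulrCA.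
by rewrite ler_wpM2l// hC.
Qed.

Lemma weighted_int_abs nu s phi : weighted_int nu s phi ->
  weighted_int nu s (fun y => `|phi y|).
Proof.
move=> h; have /integrable_abse := h.
rewrite /weighted_int (_ : (abse \o _)%E =
  EFin \o (fun y => radial nu (fun y => `|phi y|) y * cweight s y)) //.
apply/funext => y; rewrite /= /radial !normrM (ger0_norm (cweight_ge0 _ _)).
by rewrite (ger0_norm (powR_ge0 _ _)).
Qed.

Lemma measurable_continuous_halfline (f : R -> R) :
  (forall y, 0 < y -> {for y, continuous f}) -> measurable_fun D f.
Proof.
move=> cf; apply: open_continuous_measurable_fun => //.
by move=> y; rewrite inE/= in_itv/= andbT; exact: cf.
Qed.

Lemma ge0_le_integral_sub (A B : set R) (f g : R -> R) (C : R) :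
  measurable A -> measurable B -> A `<=` B -> B `<=` D ->
  measurable_fun D f -> measurable_fun D g -> 0 <= C ->
  (forall y, 0 <= f y) -> (forall y, 0 <= g y) -> (forall y, A y -> f y <= C * g y) ->
  (\int[mu]_(y in A) (f y)%:E <= C%:E * \int[mu]_(y in B) (g y)%:E)%E.
Proof.
move=> mA mB AB BD mf mg C0 f0 g0 fg; have mD := @measurable_halfline R.
have mgB : measurable_fun B (EFin \o g) by apply/measurable_EFinP; exact: measurable_funS mg.
have AD := subset_trans AB BD.
apply: (@le_trans _ _ (C%:E * \int[mu]_(y in A) (g y)%:E)%E); last first.
  rewrite lee_wpmul2l ?lee_fin//; apply: ge0_subset_integral => // y _.
  by rewrite /= lee_fin.
have mgA : measurable_fun A (EFin \o g) by apply: measurable_funS mgB.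
rewrite -ge0_integralZl//; last by move=> y _; rewrite /= lee_fin.
apply: ge0_le_integral => //.
- by move=> y _; rewrite lee_fin.
- by apply/measurable_EFinP; exact: measurable_funS mf.
- exact: measurable_funeM.
Qed.

Lemma measurable_weighted nu s (g : R -> R) : measurable_fun D g ->
  measurable_fun D (fun y => `|radial nu g y| * cweight s y).
Proof.
move=> mg; apply: measurable_funM; last exact: measurable_cweight.
by apply: measurableT_comp => //; apply: measurable_funM => //; exact: measurable_powR_id.
Qed.

Lemma measurable_abs_powR (p : R) (g : R -> R) : measurable_fun D g ->
  measurable_fun D (fun y => `|g y| * y `^ p).
Proof.
by move=> mg; apply: measurable_funM; [exact: measurableT_comp|exact: measurable_powR_id].
Qed.

Lemma weighted_ge0 nu s (g : R -> R) y : 0 <= `|radial nu g y| * cweight s y.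
Proof. by rewrite mulr_ge0// cweight_ge0. Qed.

Lemma subset_near (r : R) : `]0%R, r[ `<=` D.
Proof. by move=> y /=; rewrite !in_itv/= andbT => /andP[]. Qed.

Lemma subset_far (r : R) : 0 < r -> `]r, +oo[ `<=` D.
Proof. by move=> r0 y /=; rewrite !in_itv/= !andbT; exact: lt_trans. Qed.

Lemma weighted_le_Cnu nu : exists2 C, 0 < C & forall g, measurable_fun D g ->
  (\int[mu]_(y in D) (`|radial nu g y| * cweight ((nu + 2^-1) / 2) y)%:E
    <= C%:E * (Cnu_near nu 1 g + Cnu_far nu 1 g))%E.
Proof.
set s := (nu + 2^-1) / 2.
have [C1 C10 hC1] := cweight_near s (@ltr01 R).
have [C2 C20 hC2] := cweight_far_rev s (@ltr01 R).
exists (C1 + C2); first exact: addr_gt0.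
move=> phi mphi.
have mw := measurable_weighted nu s mphi.
have sub1 := @subset_near 1.
have sub2 : (`[1%R, +oo[%classic : set R) `<=` D.
  by move=> y /=; rewrite !in_itv/= !andbT; exact: lt_le_trans.
have DE : D = `]0%R, 1%R[ `|` `[1%R, +oo[.
  apply/seteqP; split => y; last by case; [exact: sub1|exact: sub2].
  rewrite /= !in_itv/= !andbT => y0; have [y1|y1] := ltP y 1; [left|right] => //.
  by rewrite y0.
rewrite {1}DE ge0_integral_setU//=; last 3 first.
- by rewrite -DE; apply/measurable_EFinP.
- by move=> y _; rewrite lee_fin weighted_ge0.
- rewrite disj_set2E; apply/eqP/seteqP; split => // y [] /=.
  by rewrite !in_itv/= andbT => /andP[_ h1 h2]; have := lt_le_trans h1 h2; rewrite ltxx.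
rewrite ge0_muleDr; try by apply: integral_ge0 => y _; rewrite lee_fin mulr_ge0 ?powR_ge0.
have C12 : 0 <= C1 + C2 by rewrite ltW// addr_gt0.
apply: leeD.
  apply: ge0_le_integral_sub => //; first exact: measurable_abs_powR.
  - by move=> y; exact: weighted_ge0.
  - by move=> y; rewrite mulr_ge0 ?powR_ge0.
  move=> y /=; rewrite in_itv/= => /andP[y0 y1].
  rewrite /radial normrM (ger0_norm (powR_ge0 _ _)) mulrC ler_wpM2r ?mulr_ge0 ?powR_ge0//.
  by apply: le_trans (hC1 y _) _; rewrite ?y0 ?lerDl ltW.
rewrite /Cnu_far integral_itv_obnd_cbnd; last first.
  by apply/measurable_EFinP; apply: measurable_funS (measurable_abs_powR _ mphi) => //; exact: subset_far.
apply: ge0_le_integral_sub => //; first exact: measurable_abs_powR.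
- by move=> y; exact: weighted_ge0.
- by move=> y; rewrite mulr_ge0 ?powR_ge0.
move=> y /=; rewrite in_itv/= andbT => y1.
have y0 : 0 < y by exact: lt_le_trans y1.
rewrite /radial normrM (ger0_norm (powR_ge0 y (2 * nu + 1))) -mulrA [leRHS]mulrCA ler_wpM2l//.
have -> : nu + 2^-1 = (2 * nu + 1) + (- (2 * s)) by rewrite /s; field.
rewrite (@powRD _ y (2 * nu + 1)); last by rewrite (gt_eqF y0) implybT.
rewrite [leRHS]mulrCA ler_wpM2l ?powR_ge0//; apply: le_trans (hC2 y y1) _.
by rewrite ler_wpM2r ?powR_ge0// lerDr ltW.
Qed.

Lemma weighted_int_abse nu s g :
  (\int[mu]_(y in D) `|(EFin \o (fun y => radial nu g y * cweight s y)%R) y| =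
   \int[mu]_(y in D) (`|radial nu g y| * cweight s y)%:E)%E.
Proof.
by apply: eq_integral => y _; rewrite /= (normrM (radial nu g y)) (ger0_norm (cweight_ge0 _ _)).
Qed.

Lemma weighted_int_fin nu s g : weighted_int nu s g ->
  (\int[mu]_(y in D) (`|radial nu g y| * cweight s y)%:E < +oo)%E.
Proof. by move=> /integrableP[_]; rewrite weighted_int_abse. Qed.

Lemma in_Cnu_weighted_int nu phi : in_Cnu nu phi ->
  weighted_int nu ((nu + 2^-1) / 2) phi.
Proof.
move=> [cphi hphi]; have mphi := measurable_continuous_halfline cphi.
have [hn hf] := hphi 1 ltr01.
apply/integrableP; split.
  apply/measurable_EFinP; apply: measurable_funM; last exact: measurable_cweight.
  by apply: measurable_funM => //; exact: measurable_powR_id.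
have [C C0 hC] := weighted_le_Cnu nu.
rewrite weighted_int_abse; apply: le_lt_trans (hC _ mphi) _.
by rewrite lte_mul_pinfty ?lee_fin ?(ltW C0)// lte_add_pinfty.
Qed.

Lemma Cnu_near_le nu s (r : R) : 0 < r -> exists2 C, 0 < C & forall g,
  measurable_fun D g ->
  (Cnu_near nu r g <= C%:E * \int[mu]_(y in D) (`|radial nu g y| * cweight s y)%:E)%E.
Proof.
move=> r0; have [C C0 hC] := cweight_near_rev s r0.
exists C => // g mg; apply: ge0_le_integral_sub; rewrite ?(ltW C0)//.
- exact: subset_near.
- exact: measurable_abs_powR.
- exact: measurable_weighted.
- by move=> y; rewrite mulr_ge0 ?powR_ge0.
- by move=> y; exact: weighted_ge0.
move=> y /=; rewrite in_itv/= => /andP[y0 yr].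
rewrite /radial normrM (ger0_norm (powR_ge0 _ _)) mulrCA.
by rewrite ler_peMr ?mulr_ge0 ?powR_ge0// hC// y0 ltW.
Qed.

(** The index m is kept apart from nu because the pairs (nu, s) and (nu + 1, s + 1) give the same
    exponent 2 m + 1 - 2 s; the second pair is the one met by derivatives. *)
Lemma Cnu_far_le nu m s (r : R) : 0 < r -> 2 * m + 1 - 2 * s = nu + 2^-1 ->
  exists2 C, 0 < C & forall g, measurable_fun D g ->
  (Cnu_far nu r g <= C%:E * \int[mu]_(y in D) (`|radial m g y| * cweight s y)%:E)%E.
Proof.
move=> r0 hm; have [C C0 hC] := cweight_far s r0.
exists C => // g mg; apply: ge0_le_integral_sub; rewrite ?(ltW C0)//.
- exact: subset_far.
- exact: measurable_abs_powR.
- exact: measurable_weighted.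
- by move=> y; rewrite mulr_ge0 ?powR_ge0.
- by move=> y; exact: weighted_ge0.
move=> y /=; rewrite in_itv/= andbT => ry.
have y0 : 0 < y by exact: lt_trans ry.
rewrite /radial normrM (ger0_norm (powR_ge0 _ _)) -!mulrA mulrCA.
rewrite ler_wpM2l// -hm powRD; last by rewrite (gt_eqF y0) implybT.
by rewrite [leRHS]mulrCA ler_wpM2l ?powR_ge0// hC// ltW.
Qed.

(* The exponent makes the weight comparable to y^(2nu+1) at the origin and to
   y^(nu+1/2) at infinity, the two weights of C_nu. *)
Definition wnorm nu g : R := \int[mu]_(y in D) (`|radial nu g y| * cweight ((nu + 2^-1) / 2) y).

Lemma wnorm_integrable nu g : weighted_int nu ((nu + 2^-1) / 2) g ->
  mu.-integrable D (EFin \o (fun y => `|radial nu g y| * cweight ((nu + 2^-1) / 2) y)).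
Proof.
move=> h; apply: eq_integrable (integrable_norm h); first exact: measurable_halfline.
by move=> y _; rewrite /= normrM (ger0_norm (cweight_ge0 _ _)).
Qed.

Lemma wnorm_EFin nu g : weighted_int nu ((nu + 2^-1) / 2) g ->
  (wnorm nu g)%:E = (\int[mu]_(y in D) (`|radial nu g y| * cweight ((nu + 2^-1) / 2) y)%:E)%E.
Proof.
move=> h; rewrite /wnorm /Rintegral fineK//.
by apply: integrable_fin_num (wnorm_integrable h); exact: measurable_halfline.
Qed.

End weighted_L1.

(** * Duality and convergence with moving majorants *)

Section heat_L1_continuity.
Context {R : realType}.
Notation mu := (@lebesgue_measure R).
Notation D := (`]0%R, +oo[%classic : set R).
Implicit Types (nu s x y t : R) (phi psi : R -> R).

Lemma tonelli_halfline (F : R -> R -> R) :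
  measurable_fun setT (fun z : R * R => F z.1 z.2) -> (forall x y, 0 <= F x y) ->
  (\int[mu]_(x in D) \int[mu]_(y in D) (F x y)%:E =
   \int[mu]_(y in D) \int[mu]_(x in D) (F x y)%:E)%E.
Proof.
move=> mF F0.
pose G (z : R * R) : \bar R := (F z.1 z.2 * (\1_D z.1 * \1_D z.2))%:E.
have mG : measurable_fun setT G.
  apply/measurable_EFinP; apply: measurable_funM => //; apply: measurable_funM.
    by apply: (@measurableT_comp _ _ _ _ _ _ (\1_D : R -> R)) => //; exact: measurable_fst.
  by apply: (@measurableT_comp _ _ _ _ _ _ (\1_D : R -> R)) => //; exact: measurable_snd.
have G0 z : (0 <= G z)%E by rewrite lee_fin !mulr_ge0.
have := @fubini_tonelli _ _ _ _ R mu mu G mG G0.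
have L (H : R -> R -> R) : (\int[mu]_x \int[mu]_y (H x y * (\1_D x * \1_D y))%:E =
   \int[mu]_(x in D) \int[mu]_(y in D) (H x y)%:E)%E.
  rewrite [RHS]integral_mkcond; apply: eq_integral => x _.
  rewrite patchE; case: ifPn => xD.
    rewrite [RHS]integral_mkcond; apply: eq_integral => y _.
    rewrite patchE !indicE xD mul1r; case: ifPn => yD; first by rewrite mulr1.
    by rewrite mulr0.
  by apply: integral0_eq => y _; rewrite indicE (negbTE xD) mul0r mulr0.
rewrite L => ->.
rewrite -[RHS]L; apply: eq_integral => y _; apply: eq_integral => x _.
by rewrite /G /= [X in _ * X]mulrC.
Qed.

Lemma measurable_heatK2 nu t : -1 < nu ->
  measurable_fun setT (fun z : R * R => heatK nu z.1 z.2 t).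
Proof.
move=> hn; rewrite heatK.unlock.
apply: measurable_funM.
  apply: measurable_funM => //.
  apply: (@measurableT_comp _ _ _ _ _ _ (besselE nu)); first exact: measurable_besselE.
  by apply: measurable_funX; do 2?[apply: measurable_funM => //].
apply: measurableT_comp => //; apply: measurable_funN; apply: measurable_funM => //.
by apply: measurable_funD; exact: measurable_funX.
Qed.

Lemma heatU_EFin nu psi x t : -1 < nu -> 0 < t -> tempered psi ->
  ((heatU nu psi x t)%:E = \int[mu]_(y in D) (psi y * heatK nu x y t)%:E)%E.
Proof.
move=> hn t0 h; rewrite /heatU /Rintegral fineK//.
exact: integrable_fin_num (integrable_heatU x hn t0 h).
Qed.

Lemma continuous_heatU_x nu psi x t : -1 < nu -> 0 < t -> tempered psi ->
  {for x, continuous (fun x => heatU nu psi x t)}.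
Proof. by move=> hn t0 h; exact: is_derive_continuous (is_derive_heatU_x x hn h t0). Qed.

Lemma tempered_cweight nu s : -1 < nu -> tempered (radial nu (cweight s)).
Proof.
move=> hn c c0; have c20 : 0 < c / 2 by rewrite divr_gt0.
have [C C0 hC] := gaussian_le_cweight (- s) c20.
have := integrable_scale C (@measurable_halfline R) (tempered_cst 1 hn c20).
apply: le_integrable_R; first exact: measurable_halfline.
  apply: measurable_funM; last exact: measurable_gaussian.
  by apply: measurable_funM; [exact: measurable_cweight|exact: measurable_powR_id].
move=> y _.
have e : expR (- (c * y ^+ 2)) = expR (- (c / 2 * y ^+ 2)) * expR (- (c / 2 * y ^+ 2)).
  by rewrite -expRD; congr expR; field.
have := hC y; rewrite -cweightV ler_pdivlMr ?cweight_gt0// => h.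
rewrite e /radial mul1r !ger0_norm ?mulr_ge0 ?cweight_ge0 ?powR_ge0 ?expR_ge0 ?(ltW C0)//.
have -> : cweight s y * y `^ (2 * nu + 1) * (expR (- (c / 2 * y ^+ 2)) * expR (- (c / 2 * y ^+ 2)))
  = (expR (- (c / 2 * y ^+ 2)) * cweight s y) * (y `^ (2 * nu + 1) * expR (- (c / 2 * y ^+ 2))).
  by ring.
by rewrite ler_wpM2r// mulr_ge0 ?powR_ge0 ?expR_ge0.
Qed.

Lemma heatU_cweight_le nu s (T : R) : -1 < nu -> -1 <= s -> 0 < T ->
  exists2 C, 0 < C & forall x t, 0 < t <= T ->
    heatU nu (radial nu (cweight s)) x t <= C * cweight s x.
Proof.
move=> hn s1 T0; have [C C0 hC] := heat_cweight_le hn s1 T0.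
exists C => // x t ht; have /andP[t0 _] := ht.
rewrite -lee_fin heatU_EFin//; last exact: tempered_cweight.
apply: le_trans (hC x t ht).
rewrite le_eqVlt; apply/orP; left; apply/eqP; apply: eq_integral => y _.
by rewrite /radial mulrAC.
Qed.

Lemma heatU_ge0 nu psi x t : -1 < nu -> (forall y, 0 < y -> 0 <= psi y) ->
  0 <= heatU nu psi x t.
Proof.
move=> hn h; apply: Rintegral_ge0 => y /=; rewrite in_itv/= andbT => y0.
by rewrite mulr_ge0 ?heatK_ge0// h.
Qed.

Lemma heatU_duality nu s phi t (T : R) : -1 < nu -> -1 <= s -> 0 < t <= T ->
  weighted_int nu s phi ->
  (\int[mu]_(x in D) (heatU nu (fun y => `|radial nu phi y|) x t
      * x `^ (2 * nu + 1) * cweight s x)%:E =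
   \int[mu]_(y in D) (`|radial nu phi y| * heatU nu (radial nu (cweight s)) y t)%:E)%E.
Proof.
move=> hn s1 /andP[t0 tT] h.
have ht := weighted_int_tempered h.
have ha := tempered_abs ht.
have mp := weighted_int_measurable h.
have mD := @measurable_halfline R.
(* Measurability of [radial nu phi] is known on the half-line; extension by 0 makes the integrand
   measurable on the whole plane. *)
pose q := (radial nu phi) \_ D.
have mq : measurable_fun setT q by apply/(measurable_restrictT _ mD).
have qE y : 0 < y -> q y = radial nu phi y.
  by move=> y0; rewrite /q patchE ifT// inE/= in_itv/= y0.
pose F x y := `|q y| * heatK nu x y t * (x `^ (2 * nu + 1) * cweight s x).
have F0 x y : 0 <= F x y by rewrite !mulr_ge0 ?heatK_ge0 ?powR_ge0 ?cweight_ge0.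
have mF : measurable_fun setT (fun z : R * R => F z.1 z.2).
  apply: measurable_funM.
    apply: measurable_funM; last exact: measurable_heatK2.
    apply: measurableT_comp => //.
    by apply: (@measurableT_comp _ _ _ _ _ _ q) => //; exact: measurable_snd.
  apply: measurable_funM.
    apply: (@measurableT_comp _ _ _ _ _ _ (@powR R ^~ (2 * nu + 1))).
      exact: measurable_powR.
    exact: measurable_fst.
  apply: (@measurableT_comp _ _ _ _ _ _ (cweight s)); first exact: measurable_cweight.
  exact: measurable_fst.
transitivity (\int[mu]_(x in D) \int[mu]_(y in D) (F x y)%:E)%E.
  apply: eq_integral => x _; rewrite -mulrA mulrC EFinM heatU_EFin//.
  rewrite -ge0_integralZl//; last 3 first.
  - apply/measurable_EFinP; apply: measurable_funM; last exact: measurable_heatK.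
    exact: measurableT_comp.
  - by move=> y _; rewrite lee_fin mulr_ge0 ?heatK_ge0.
  - by rewrite lee_fin mulr_ge0 ?powR_ge0 ?cweight_ge0.
  apply: eq_integral => y; rewrite inE/= in_itv/= andbT => y0.
  by rewrite -EFinM /F qE// mulrC.
rewrite tonelli_halfline//; apply: eq_integral => y; rewrite inE/= in_itv/= andbT => y0.
rewrite EFinM heatU_EFin//; last exact: tempered_cweight.
rewrite -ge0_integralZl//; last 2 first.
- apply/measurable_EFinP; apply: measurable_funM; last exact: measurable_heatK.
  by apply: measurable_funM; [exact: measurable_cweight|exact: measurable_powR_id].
- by move=> x _; rewrite lee_fin !mulr_ge0 ?powR_ge0 ?cweight_ge0 ?heatK_ge0.
apply: eq_integral => x _; rewrite -EFinM /F qE// (heatKC nu x y) /radial.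
by congr (_%:E); ring.
Qed.

Lemma integrable_heatU_cweight nu s phi t : -1 < nu -> -1 <= s -> 0 < t ->
  weighted_int nu s phi ->
  mu.-integrable D (EFin \o (fun y => `|radial nu phi y| * heatU nu (radial nu (cweight s)) y t)).
Proof.
move=> hn s1 t0 h; have [C C0 hC] := heatU_cweight_le hn s1 t0.
have := integrable_scale C (@measurable_halfline R) h.
apply: le_integrable_R; first exact: measurable_halfline.
  apply: measurable_funM.
    by apply: measurableT_comp => //; exact: weighted_int_measurable h.
  apply: measurable_continuous_halfline => y _.
  by apply: continuous_heatU_x => //; exact: tempered_cweight.
move=> y _; have p : 0 <= heatU nu (radial nu (cweight s)) y t.
  by apply: heatU_ge0 => // z z0; rewrite mulr_ge0 ?cweight_ge0 ?powR_ge0.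
rewrite normrM normr_id (ger0_norm p) (normrM C) (gtr0_norm C0) (normrM (radial nu phi y)).
rewrite (ger0_norm (cweight_ge0 _ _)) mulrCA ler_wpM2l// hC// t0 lexx.
by [].
Qed.

Lemma integrable_heatU_weighted nu s phi t : -1 < nu -> -1 <= s -> 0 < t ->
  weighted_int nu s phi ->
  mu.-integrable D (EFin \o (fun x => heatU nu (fun y => `|radial nu phi y|) x t
      * x `^ (2 * nu + 1) * cweight s x)).
Proof.
move=> hn s1 t0 h.
have ha := tempered_abs (weighted_int_tempered h).
apply: integrable_ge0_R.
- exact: measurable_halfline.
- apply: measurable_funM; last exact: measurable_cweight.
  apply: measurable_funM; last exact: measurable_powR_id.
  by apply: measurable_continuous_halfline => y _; exact: continuous_heatU_x.
- by move=> y _; rewrite !mulr_ge0 ?powR_ge0 ?cweight_ge0// heatU_ge0.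
rewrite (@heatU_duality _ _ _ _ t)//; last by rewrite t0 lexx.
have I := integrable_heatU_cweight hn s1 t0 h.
have /integrableP[_] := I.
apply: le_lt_trans; rewrite le_eqVlt; apply/orP; left; apply/eqP.
apply: eq_integral => y _.
have p : 0 <= `|radial nu phi y| * heatU nu (radial nu (cweight s)) y t.
  rewrite mulr_ge0// heatU_ge0// => z z0.
  by rewrite mulr_ge0 ?cweight_ge0 ?powR_ge0.
by rewrite /= (ger0_norm p).
Qed.

Lemma cvg_abs_sub (u : nat -> R) (l : R) : u n @[n --> \oo] --> l ->
  `|u n - l| @[n --> \oo] --> (0 : R).
Proof.
move=> h; rewrite -(normr0 R); apply: cvg_norm; rewrite -(subrr l).
by apply: cvgB => //; exact: cvg_cst.
Qed.

(* |f_n - f| <= min (|f_n - f|, 2 g) + (g_n - g)^+: the first term is dominated,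
   and the positive part of g_n - g is controlled by its integral and by the
   dominated (g - g_n)^+. *)
Lemma pratt (f_ g_ : nat -> R -> R) (f g : R -> R) :
  (forall n, measurable_fun D (f_ n)) -> measurable_fun D f ->
  (forall n, mu.-integrable D (EFin \o g_ n)) -> mu.-integrable D (EFin \o g) ->
  (forall n y, 0 < y -> `|f_ n y| <= g_ n y) ->
  (forall y, 0 < y -> f_ n y @[n --> \oo] --> f y) ->
  (forall y, 0 < y -> g_ n y @[n --> \oo] --> g y) ->
  (\int[mu]_(y in D) g_ n y)%R @[n --> \oo] --> (\int[mu]_(y in D) g y)%R ->
  (\int[mu]_(y in D) `|f_ n y - f y|)%R @[n --> \oo] --> (0 : R).
Proof.
move=> mf_ mf ig_ ig fg cf cg cI.
have mD := @measurable_halfline R.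
have mg_ n : measurable_fun D (g_ n) by have /measurable_int/measurable_EFinP := ig_ n.
have mg : measurable_fun D g by have /measurable_int/measurable_EFinP := ig.
have fgl y : 0 < y -> `|f y| <= g y.
  move=> y0; have c1 : `|f_ n y| @[n --> \oo] --> `|f y| by apply: cvg_norm; exact: cf.
  by apply: (ler_cvg_to c1 (cg y y0)); apply: nearW => n; exact: fg.
have g0 y (y0 : 0 < y) : 0 <= g y := le_trans (normr_ge0 _) (fgl y y0).
have mmin n : measurable_fun D (fun y => Num.min `|f_ n y - f y| (2 * g y)).
  apply: measurable_minr; last exact: measurable_funM.
  by apply: measurableT_comp => //; exact: measurable_funB.
have mpos n : measurable_fun D (fun y => Num.max (g y - g_ n y) 0).
  by apply: measurable_maxr => //; exact: measurable_funB.
have h1 : (\int[mu]_(y in D) Num.min `|f_ n y - f y| (2 * g y))%R @[n --> \oo] -->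
    (\int[mu]_(y in D) (fun=> 0) y)%R.
  apply: (@Rdominated_cvg _ D _ _ (fun y => 2 * g y)) => //.
  - move=> y; rewrite /= in_itv/= andbT => y0.
    have c := cvg_abs_sub (cf y y0).
    apply: (@squeeze_cvgr _ _ _ _ (fun=> 0) (fun n => `|f_ n y - f y|)) => //.
      apply: nearW => n; rewrite ge_min lexx andbT le_min normr_ge0/=.
      by rewrite mulr_ge0// g0.
    exact: cvg_cst.
  - exact: integrable_scale.
  - move=> n y /=; rewrite in_itv/= andbT => y0.
    have p : 0 <= 2 * g y by rewrite mulr_ge0// g0.
    by rewrite ger0_norm ?ge_min ?lexx ?orbT// le_min normr_ge0.
have h2 : (\int[mu]_(y in D) Num.max (g y - g_ n y) 0)%R @[n --> \oo] -->
    (\int[mu]_(y in D) (fun=> 0) y)%R.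
  apply: (@Rdominated_cvg _ D _ _ g) => //.
  - move=> y; rewrite /= in_itv/= andbT => y0.
    have c := cvg_abs_sub (cg y y0).
    apply: (@squeeze_cvgr _ _ _ _ (fun=> 0) (fun n => `|g_ n y - g y|)) => //.
      apply: nearW => n; rewrite distrC le_max lexx orbT/= ge_max normr_ge0 andbT.
      exact: ler_norm.
    exact: cvg_cst.
  - move=> n y /=; rewrite in_itv/= andbT => y0.
    have p : 0 <= g_ n y by exact: le_trans (fg n y y0).
    rewrite ger0_norm ?le_max ?lexx ?orbT// ge_max g0// andbT.
    by rewrite lerBlDr lerDl.
have i0 : (\int[mu]_(y in D) (fun=> 0) y)%R = 0 :> R.
  by rewrite /Rintegral integral0.
rewrite i0 in h1 h2.
have h3 : (\int[mu]_(y in D) Num.min `|f_ n y - f y| (2 * g y))%R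
   + ((\int[mu]_(y in D) g_ n y)%R - (\int[mu]_(y in D) g y)%R)
   + (\int[mu]_(y in D) Num.max (g y - g_ n y) 0)%R @[n --> \oo] --> (0 : R).
  rewrite -[X in _ --> X]addr0; apply: cvgD => //.
  rewrite -[X in _ --> X]addr0; apply: cvgD => //.
  by apply/subr_cvg0.
apply: (@squeeze_cvgr _ _ _ _ (fun=> 0) _ _ _ _ _ h3); last exact: cvg_cst.
apply: nearW => n; rewrite Rintegral_ge0//=.
have imin : mu.-integrable D (EFin \o (fun y => Num.min `|f_ n y - f y| (2 * g y))).
  have := integrable_scale 2 mD ig; apply: le_integrable_R => // y.
  rewrite /= in_itv/= andbT => y0.
  have p : 0 <= 2 * g y by rewrite mulr_ge0// g0.
  by rewrite (ger0_norm p) ger0_norm ?ge_min ?lexx ?orbT// le_min normr_ge0.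
have imax : mu.-integrable D (EFin \o (fun y => Num.max (g y - g_ n y) 0)).
  move: ig; apply: le_integrable_R => // y.
  rewrite /= in_itv/= andbT => y0.
  have p : 0 <= g_ n y by exact: le_trans (fg n y y0).
  rewrite ger0_norm ?le_max ?lexx ?orbT// ge_max normr_ge0 andbT.
  by rewrite (le_trans _ (ler_norm _))// lerBlDr lerDl.
have isub : mu.-integrable D (EFin \o (fun y => g_ n y - g y)).
  have := integrable_add mD (ig_ n) (integrable_scale (-1) mD ig).
  rewrite (_ : (fun y => g_ n y + -1 * g y) = (fun y => g_ n y - g y)) //.
  by apply/funext => y; rewrite mulN1r.
rewrite -RintegralB// -RintegralD// -RintegralD//; last exact: integrable_add.
apply: le_Rintegral => //.
- have := integrable_add mD (ig_ n) ig; apply: le_integrable_R => //.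
    by apply: measurableT_comp => //; exact: measurable_funB.
  move=> y; rewrite /= in_itv/= andbT => y0; rewrite normr_id.
  apply: le_trans (ler_normB _ _) _; apply: le_trans (ler_norm _).
  by apply: lerD; [exact: fg|exact: fgl].
- by do 2?[apply: integrable_add => //].
move=> y; rewrite /= in_itv/= andbT => y0.
have a1 := fg n y y0; have a2 := fgl y y0; have a3 := ler_normB (f_ n y) (f y).
move: `|f_ n y - f y| a3 => d a3.
rewrite /Num.min /Num.max; case: ifP => c1; case: ifP => c2; lra.
Qed.

End heat_L1_continuity.

(** * Initial values and convergence in weighted L^1 *)

Section existence_lemmas.
Context {R : realType}.
Notation mu := (@lebesgue_measure R).
Notation D := (`]0%R, +oo[%classic : set R).
Implicit Types (nu s x y t : R) (phi psi : R -> R).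

Lemma heatU_initial nu phi y : -1 < nu -> tempered (radial nu phi) -> 0 < y ->
  {for y, continuous phi} ->
  heatU nu (radial nu phi) z.1 z.2
    @[z --> within [set z : R * R | 0 < z.2] (nbhs (y, 0 : R))] --> phi y.
Proof.
move=> hn h y0 cy; apply/cvgrPdist_le => e e0.
have e20 : 0 < e / 2 by rewrite divr_gt0.
have /cvgrPdist_le/(_ _ e20) := cy; rewrite -filter_from_norm_nbhs => -[d /= d0 hd].
(* The bound d / 2 keeps points within [dl] of [z.1] within d of y; the bound y / 2 keeps [z.1]
   positive and below 2 y. *)
pose dl := Num.min (d / 2) (y / 2).
have dl0 : 0 < dl by rewrite lt_min !divr_gt0.
have y20 : 0 < 2 * y by rewrite mulr_gt0.
have [C C0 hC] := heatU_near hn y20 dl0.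
pose N := (\int[mu]_(z in D) (`|radial nu phi z| * expR (- (32^-1 * z ^+ 2))))%R + `|phi y|.
have N0 : 0 <= N by rewrite addr_ge0// Rintegral_ge0// => z _; rewrite mulr_ge0 ?expR_ge0.
(* Before this time the off-diagonal error C t N is at most e / 2; N + 1 replaces N to keep the
   denominator positive. *)
pose tau := e / (2 * (C * (N + 1))).
have CN : 0 < C * (N + 1) by rewrite mulr_gt0// ltr_wpDl.
have tau0 : 0 < tau by rewrite divr_gt0// mulr_gt0.
have c1 : (fun w : R * R => w.1) @ (y, 0 : R) --> y by exact: cvg_fst.
have c2 : (fun w : R * R => w.2) @ (y, 0 : R) --> (0 : R) by exact: cvg_snd.
have n1 : \forall z \near (y, 0 : R), `|z.1 - y| < dl.
  by have /cvgrPdist_lt/(_ _ dl0) := c1; apply: filterS => z; rewrite distrC.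
have n2 : \forall z \near (y, 0 : R), z.2 < tau by exact: (cvgr_lt _ c2).
have n3 : \forall z \near (y, 0 : R), z.2 < 1 by apply: (cvgr_lt _ c2).
near=> z.
have z2 : 0 < z.2 by near: z; exact: withinT.
have a1 : `|z.1 - y| < dl by near: z; exact: cvg_within n1.
have a2 : z.2 < tau by near: z; exact: cvg_within n2.
have a3 : z.2 < 1 by near: z; exact: cvg_within n3.
have dle : dl <= d / 2 /\ dl <= y / 2 by rewrite /dl !ge_min !lexx orbT.
have [dle1 dle2] := dle.
rewrite distrC; apply: le_trans (hC phi (phi y) (e / 2) z.1 z.2 _ _ (ltW e20) h _) _.
- by move: a1; rewrite ltr_norml => /andP[? ?]; apply/andP; split; lra.
- by rewrite z2 ltW.
- move=> w w0 hw; rewrite distrC; apply: hd => /=.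
  have := ler_normD (y - z.1) (z.1 - w); rewrite addrA subrK => /le_lt_trans; apply.
  by move: a1 hw; rewrite (distrC z.1 y) (distrC w); lra.
rewrite -/N -[leRHS](@subrK _ (e / 2)) addrC lerD2r.
have -> : e - e / 2 = tau * (C * (N + 1)) by rewrite /tau; field; rewrite !gt_eqF//; lra.
rewrite mulrC mulrA [leLHS]mulrC.
have hh : z.2 * (C * N) <= tau * (C * (N + 1)).
  apply: ler_pM; rewrite ?(ltW z2) ?(ltW a2) ?mulr_ge0 ?(ltW C0)//.
  by rewrite ler_pM2l// lerDl.
by apply: le_trans hh; rewrite le_eqVlt; apply/orP; left; apply/eqP; ring.
Unshelve. all: end_near. Qed.

Lemma heatU_initial_seq nu phi y (u : nat -> R) : -1 < nu -> tempered (radial nu phi) ->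
  0 < y -> {for y, continuous phi} -> (forall n, 0 < u n) -> u n @[n --> \oo] --> (0 : R) ->
  heatU nu (radial nu phi) y (u n) @[n --> \oo] --> phi y.
Proof.
move=> hn h y0 cy u0 cu.
apply: (cvg_comp (fun n => (y, u n)) (fun z => heatU nu (radial nu phi) z.1 z.2) _
  (heatU_initial hn h y0 cy)).
have c : (y, u n) @[n --> \oo] --> (y, 0 : R) by exact: (cvg_pair (cvg_cst y) cu).
move=> A hA; have h' : \forall n \near \oo, 0 < u n -> A (y, u n) by exact: c _ hA.
by apply: filterS h' => n; apply; exact: u0.
Qed.

Lemma heatU_time_seq nu psi x t (u : nat -> R) : -1 < nu -> 0 < t -> tempered psi ->
  u n @[n --> \oo] --> t -> heatU nu psi x (u n) @[n --> \oo] --> heatU nu psi x t.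
Proof.
move=> hn t0 h cu.
have [hd _] := is_derive_heatU_t x hn h t0.
apply: (cvg_comp _ _ cu).
exact: is_derive_continuous (is_derive_heatU_t x hn h t0).
Qed.

(** Pratt's theorem with majorants P_u |phi|. The limits fl, gl and Wl are parameters so that both
    cases are covered: times tending to 0, with limits phi, |phi| and the weight itself, and times
    tending to some t > 0. The last hypothesis is the duality identity at the limit time. *)
Lemma heatU_L1_cvg nu s (T : R) phi (u : nat -> R) (fl gl Wl : R -> R) :
  -1 < nu -> -1 <= s -> weighted_int nu s phi -> (forall n, 0 < u n <= T) ->
  measurable_fun D fl ->
  mu.-integrable D (EFin \o (fun x => gl x * x `^ (2 * nu + 1) * cweight s x)) ->
  (forall x, 0 < x -> heatU nu (radial nu phi) x (u n) @[n --> \oo] --> fl x) ->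
  (forall x, 0 < x -> heatU nu (fun y => `|radial nu phi y|) x (u n) @[n --> \oo] --> gl x) ->
  (forall x, 0 < x -> heatU nu (radial nu (cweight s)) x (u n) @[n --> \oo] --> Wl x) ->
  (\int[mu]_(x in D) (gl x * x `^ (2 * nu + 1) * cweight s x))%R =
    (\int[mu]_(y in D) (`|radial nu phi y| * Wl y))%R ->
  (\int[mu]_(y in D) (`|radial nu (fun x => heatU nu (radial nu phi) x (u n) - fl x) y|
     * cweight s y))%R @[n --> \oo] --> (0 : R).
Proof.
move=> hn s1 h uT mfl igl cfl cgl cWl eI.
have T0 : 0 < T by have /andP[h1 h2] := uT 0%N; exact: lt_le_trans h2.
have mD := @measurable_halfline R.
have ht := weighted_int_tempered h; have ha := tempered_abs ht.
have u0 n : 0 < u n by have /andP[] := uT n.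
have mU psi n : tempered psi -> measurable_fun D (fun x => heatU nu psi x (u n)).
  by move=> hp; apply: measurable_continuous_halfline => x _; exact: continuous_heatU_x.
have mw (f : R -> R) : measurable_fun D f ->
    measurable_fun D (fun x => f x * x `^ (2 * nu + 1) * cweight s x).
  move=> mf; apply: measurable_funM; last exact: measurable_cweight.
  by apply: measurable_funM => //; exact: measurable_powR_id.
have w0 x : 0 <= x `^ (2 * nu + 1) * cweight s x by rewrite mulr_ge0 ?powR_ge0 ?cweight_ge0.
have := @pratt R (fun n x => heatU nu (radial nu phi) x (u n) * x `^ (2 * nu + 1) * cweight s x)
  (fun n x => heatU nu (fun y => `|radial nu phi y|) x (u n) * x `^ (2 * nu + 1) * cweight s x)
  (fun x => fl x * x `^ (2 * nu + 1) * cweight s x)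
  (fun x => gl x * x `^ (2 * nu + 1) * cweight s x).
have -> : (fun n => (\int[mu]_(y in D) `|heatU nu (radial nu phi) y (u n) * y `^ (2 * nu + 1) * cweight s y
      - fl y * y `^ (2 * nu + 1) * cweight s y|)%R) =
   (fun n => (\int[mu]_(y in D) (`|radial nu (fun x => heatU nu (radial nu phi) x (u n) - fl x) y|
     * cweight s y))%R).
  apply/funext => n; apply: eq_Rintegral => y _; rewrite /radial -!mulrBl.
  by rewrite (normrM _ (cweight s y)) (ger0_norm (cweight_ge0 s y)).
apply.
- by move=> n; apply: mw; exact: mU.
- exact: mw.
- by move=> n; apply: integrable_heatU_weighted.
- exact: igl.
- move=> n y y0; rewrite -!mulrA normrM (ger0_norm (w0 y)) ler_wpM2r//.
  exact: le_heatU_abs.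
- by move=> y y0; apply: cvgM; [apply: cvgM; [exact: cfl|exact: cvg_cst]|exact: cvg_cst].
- by move=> y y0; apply: cvgM; [apply: cvgM; [exact: cgl|exact: cvg_cst]|exact: cvg_cst].
rewrite eI.
(* Duality rewrites the integrals of the moving majorants against the fixed |phi| and the evolved
   weight, which a multiple of the weight dominates up to time T. *)
have -> : (fun n => (\int[mu]_(y in D) (heatU nu (fun y => `|radial nu phi y|) y (u n)
     * y `^ (2 * nu + 1) * cweight s y))%R) =
   (fun n => (\int[mu]_(y in D) (`|radial nu phi y| * heatU nu (radial nu (cweight s)) y (u n)))%R).
  by apply/funext => n; rewrite /Rintegral (heatU_duality hn s1 (uT n) h).
have [C C0 hC] := heatU_cweight_le hn s1 T0.
apply: (@Rdominated_cvg _ D _ _ (fun y => C * `|radial nu phi y * cweight s y|)) => //.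
- move=> n; apply: measurable_funM; last by apply: mU; exact: tempered_cweight.
  by apply: measurableT_comp => //; exact: weighted_int_measurable h.
- move=> y; rewrite /= in_itv/= andbT => y0.
  by apply: cvgM; [exact: cvg_cst|exact: cWl].
- by apply: integrable_scale => //; have /integrable_abse := h.
- move=> n y _; have p : 0 <= heatU nu (radial nu (cweight s)) y (u n).
    by apply: heatU_ge0 => // z z0; rewrite mulr_ge0 ?cweight_ge0 ?powR_ge0.
  rewrite normrM normr_id (ger0_norm p) (normrM (radial nu phi y)).
  by rewrite (ger0_norm (cweight_ge0 _ _)) mulrCA ler_wpM2l// hC.
Qed.

Lemma weighted_int_heatU nu s phi t : -1 < nu -> -1 <= s -> 0 < t ->
  weighted_int nu s phi -> weighted_int nu s (fun x => heatU nu (radial nu phi) x t).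
Proof.
move=> hn s1 t0 h; have ht := weighted_int_tempered h.
have := integrable_heatU_weighted hn s1 t0 h.
apply: le_integrable_R; first exact: measurable_halfline.
  apply: measurable_funM; last exact: measurable_cweight.
  apply: measurable_funM; last exact: measurable_powR_id.
  by apply: measurable_continuous_halfline => y _; exact: continuous_heatU_x.
move=> y _; apply: le_trans (ler_norm _).
have w0 : 0 <= y `^ (2 * nu + 1) * cweight s y by rewrite mulr_ge0 ?powR_ge0 ?cweight_ge0.
rewrite /radial -!mulrA normrM (ger0_norm w0) ler_wpM2r//.
exact: le_heatU_abs.
Qed.

Lemma weighted_int_sub nu s f g : weighted_int nu s f -> weighted_int nu s g ->
  weighted_int nu s (fun x => f x - g x).
Proof.
move=> hf hg; have mD := @measurable_halfline R.
have := integrable_add mD hf (integrable_scale (-1) mD hg).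
rewrite /weighted_int (_ : (fun y => _ + _) =
  (fun y => radial nu (fun x => f x - g x) y * cweight s y)) //.
by apply/funext => y; rewrite /radial; ring.
Qed.

Lemma Cnu_cvg0_seq nu (F : nat -> R -> R) (r : R) : 0 < r ->
  (forall n, measurable_fun D (F n)) ->
  (forall n, weighted_int nu ((nu + 2^-1) / 2) (F n)) ->
  wnorm nu (F n) @[n --> \oo] --> (0 : R) ->
  Cnu_near nu r (F n) @[n --> \oo] --> 0%E /\ Cnu_far nu r (F n) @[n --> \oo] --> 0%E.
Proof.
move=> r0 mF iF cF.
have cE (C : R) : (C%:E * (wnorm nu (F n))%:E)%E @[n --> \oo] --> 0%E.
  rewrite -(mule0 C%:E); apply: cvgeZl => //.
  by apply: cvg_EFin => //; exact: nearW.
have hs : 2 * nu + 1 - 2 * ((nu + 2^-1) / 2) = nu + 2^-1 by field.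
have [C1 _ hC1] := Cnu_near_le nu ((nu + 2^-1) / 2) r0.
have [C2 _ hC2] := Cnu_far_le r0 hs.
split; [apply: (squeeze_cvge _ (cvg_cst 0%E) (cE C1))|apply: (squeeze_cvge _ (cvg_cst 0%E) (cE C2))];
  apply: nearW => n; rewrite wnorm_EFin ?hC1 ?hC2// andbT; apply: integral_ge0 => y _;
  by rewrite lee_fin mulr_ge0 ?powR_ge0.
Qed.

End existence_lemmas.

(** * The potential solves the Cauchy-Neumann problem *)

Section existence.
Context {R : realType}.
Notation mu := (@lebesgue_measure R).
Notation D := (`]0%R, +oo[%classic : set R).
Implicit Types (nu s x y t : R) (phi psi : R -> R).

(** The space derivative carries a factor x, so the flux is x^(2nu+2), which tends to 0 as nu > -1,
    times a function that is jointly continuous up to x = 0. *)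
Lemma neumann_heatU nu psi : -1 < nu -> tempered psi ->
  neumann_condition nu (heatU nu psi).
Proof.
move=> hn h t t0.
have hn1 : -1 < nu + 1 by lra.
have h1 := tempered_sqr h.
pose F (z : R * R) := z.1 `^ (2 * nu + 2) * ((2 * z.2)^-1 *
  (heatU (nu + 1) (fun y => y ^+ 2 * psi y) z.1 z.2 - heatU nu psi z.1 z.2)).
have e : \forall z \near within [set z : R * R | 0 < z.1] (nbhs (0 : R, t)),
    F z = z.1 `^ (2 * nu + 1) * dy (heatU nu psi) z.1 z.2.
  have n2 := near_snd_gt0 (t0 : 0 < (0 : R, t).2).
  near=> z.
  have z1 : 0 < z.1 by near: z; exact: withinT.
  have z2 : 0 < z.2 by near: z; exact: cvg_within n2.
  rewrite dy_heatU// /F; have -> : 2 * nu + 2 = (2 * nu + 1) + 1 by ring.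
  rewrite powRS// -!mulrA; congr (_ * (_ * _)).
apply: cvg_trans (near_eq_cvg e) _.
suff H : F z @[z --> within [set z : R * R | 0 < z.1] (nbhs (0 : R, t))] --> 0 * ((2 * t)^-1 *
    (heatU (nu + 1) (fun y => y ^+ 2 * psi y) 0 t - heatU nu psi 0 t)).
  by move: H; rewrite mul0r.
rewrite /F; apply: cvgM.
  have p : 0 < 2 * nu + 2 by lra.
  apply: (cvg_comp (fun z : R * R => z.1) (fun x => x `^ (2 * nu + 2)) _ (powR_cvg0 p)).
  move=> A hA; have c1 : (fun w : R * R => w.1) @ (0 : R, t) --> (0 : R) by exact: cvg_fst.
  exact: c1 _ hA.
have c (f : R * R -> R) : {for (0 : R, t), continuous f} ->
    f z @[z --> within [set z : R * R | 0 < z.1] (nbhs (0 : R, t))] --> f (0 : R, t).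
  by move=> cf; apply: cvg_trans cf; apply: cvg_app; exact: cvg_within.
apply: (c (fun z => (2 * z.2)^-1 *
  (heatU (nu + 1) (fun y => y ^+ 2 * psi y) z.1 z.2 - heatU nu psi z.1 z.2))).
apply: cvgM.
  apply: cvgV; first by rewrite gt_eqF// mulr_gt0.
  by apply: cvgM; [exact: cvg_cst|exact: cvg_snd].
by apply: cvgB; exact: continuous_heatU.
Unshelve. all: end_near. Qed.

(** Shifting the index multiplies the density by y^2 and shifting s divides it by 1 + y^2, so the
    integrand does not increase. *)
Lemma weighted_int_shift nu s phi : weighted_int nu s phi ->
  weighted_int (nu + 1) (s + 1) phi.
Proof.
move=> h; have mp := weighted_int_measurable h; move: h.
have e y : 0 < y -> radial (nu + 1) phi y = y ^+ 2 * radial nu phi y.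
  move=> y0; rewrite /radial; have -> : 2 * (nu + 1) + 1 = (2 * nu + 1) + 1 + 1 by ring.
  by rewrite !powRS//; ring.
apply: le_integrable_R; first exact: measurable_halfline.
  apply: measurable_funM; last exact: measurable_cweight.
  apply: (@eq_measurable_fun _ _ _ _ D (fun y => y ^+ 2 * radial nu phi y)).
    by move=> y; rewrite inE/= in_itv/= andbT => /e ->.
  exact: measurable_funM.
move=> y; rewrite /= in_itv/= andbT => y0; rewrite e//.
have -> : cweight (s + 1) y = cweight s y / (1 + y ^+ 2).
  rewrite /cweight opprD powRD; last by rewrite (gt_eqF (bracket_gt0 y)) implybT.
  by rewrite powR_inv1// ltW// bracket_gt0.
have b0 := bracket_gt0 y.
have -> : y ^+ 2 * radial nu phi y * (cweight s y / (1 + y ^+ 2)) =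
  (y ^+ 2 / (1 + y ^+ 2)) * (radial nu phi y * cweight s y) by ring.
rewrite (normrM (y ^+ 2 / _)) ger0_norm ?divr_ge0 ?sqr_ge0 ?(ltW b0)//.
rewrite ler_piMl// ler_pdivrMr// mul1r lerDr.
by [].
Qed.

Lemma heatU_eq nu psi1 psi2 x t : (forall y, 0 < y -> psi1 y = psi2 y) ->
  heatU nu psi1 x t = heatU nu psi2 x t.
Proof.
move=> h; apply: eq_Rintegral => y; rewrite inE/= in_itv/= andbT => y0.
by rewrite h.
Qed.

Lemma heatU_shift nu phi x t :
  heatU (nu + 1) (fun y => y ^+ 2 * radial nu phi y) x t = heatU (nu + 1) (radial (nu + 1) phi) x t.
Proof.
apply: heatU_eq => y y0; rewrite /radial.
have -> : 2 * (nu + 1) + 1 = (2 * nu + 1) + 1 + 1 by ring.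
by rewrite !powRS//; ring.
Qed.

Lemma heatU_bounded nu psi t (r : R) : -1 < nu -> 0 < t -> 0 < r -> tempered psi ->
  exists M, forall x, `|x| <= r -> `|heatU nu psi x t| <= M.
Proof.
move=> hn t0 r0 h; have [G [iG hG]] := heatK_dominated hn h r0 t0 (lexx t).
exists (\int[mu]_(y in D) G y)%R => x xr.
apply: le_trans (le_normr_Rintegral _ _) _.
- exact: measurable_halfline.
- exact: integrable_heatU.
apply: le_Rintegral => //.
- by have /integrable_abse := integrable_heatU x hn t0 h.
- by move=> y _; apply: hG; rewrite ?lexx.
Qed.

Lemma Cnu_near_bounded nu (r M : R) (g : R -> R) : -1 < nu -> 0 < r -> measurable_fun D g ->
  (forall y, 0 < y <= r -> `|g y| <= M) -> (Cnu_near nu r g < +oo)%E.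
Proof.
move=> hn r0 mg hM.
have M0 : 0 <= M by apply: le_trans (hM r _) => //; rewrite r0 lexx.
have MC : 0 <= M * expR (r ^+ 2) by rewrite mulr_ge0 ?expR_ge0.
(* Integrability of y^(2nu+1) at 0 is taken from the Gaussian moment; on []0, r[] the factor
   exp(r^2) undoes the Gaussian. *)
pose G (y : R) := radial nu (fun=> 1) y * expR (- (1 * y ^+ 2)).
have iG : mu.-integrable D (EFin \o G) by exact: tempered_cst.
have G0 y : 0 <= G y by rewrite /G /radial !mulr_ge0 ?expR_ge0 ?powR_ge0.
apply: (@le_lt_trans _ _ ((M * expR (r ^+ 2))%:E * \int[mu]_(y in D) (G y)%:E)%E); last first.
  rewrite lte_mul_pinfty ?lee_fin//.
  by rewrite ltey_eq (integrable_fin_num _ iG)//; exact: measurable_halfline.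
apply: ge0_le_integral_sub => //.
- exact: subset_near.
- exact: measurable_abs_powR.
- by move: iG => /measurable_int/measurable_EFinP.
- by move=> y; rewrite mulr_ge0 ?powR_ge0.
move=> y /=; rewrite in_itv/= => /andP[y0 yr].
have -> : M * expR (r ^+ 2) * G y =
  M * (expR (r ^+ 2) * expR (- (1 * y ^+ 2))) * y `^ (2 * nu + 1) by rewrite /G /radial; ring.
rewrite ler_wpM2r ?powR_ge0// -expRD.
apply: le_trans (hM y _) _; first by rewrite y0 ltW.
rewrite ler_peMr// -[leLHS]expR0 ler_expR mul1r subr_ge0.
by rewrite lerXn2r// ?nnegrE ltW.
Qed.

Lemma Cnu_far_fin nu m s (r : R) g : 0 < r -> 2 * m + 1 - 2 * s = nu + 2^-1 ->
  measurable_fun D g -> weighted_int m s g -> (Cnu_far nu r g < +oo)%E.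
Proof.
move=> r0 hm mg hg; have [C C0 hC] := Cnu_far_le r0 hm.
apply: le_lt_trans (hC g mg) _; rewrite lte_mul_pinfty ?lee_fin ?(ltW C0)//.
exact: weighted_int_fin.
Qed.

Lemma Cnu_far_lin nu (r a : R) (f g h : R -> R) : measurable_fun D f -> measurable_fun D g ->
  measurable_fun D h -> 0 < r -> 0 <= a -> (forall y, 0 < y -> `|h y| <= a * (`|f y| + `|g y|)) ->
  (Cnu_far nu r f < +oo)%E -> (Cnu_far nu r g < +oo)%E -> (Cnu_far nu r h < +oo)%E.
Proof.
move=> mf mg mh r0 a0 hh ff fg.
have m1 (k : R -> R) : measurable_fun D k ->
    measurable_fun `]r, +oo[ (fun y => (`|k y| * y `^ (nu + 2^-1))%:E).
  move=> mk; apply/measurable_EFinP; apply: measurable_funS (measurable_abs_powR _ mk).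
    exact: measurable_halfline.
  exact: subset_far.
apply: (@le_lt_trans _ _ (a%:E * (Cnu_far nu r f + Cnu_far nu r g))%E); last first.
  by rewrite lte_mul_pinfty ?lee_fin//; exact: lte_add_pinfty.
rewrite /Cnu_far -ge0_integralD//; try exact: m1;
  try by move=> y _; rewrite lee_fin mulr_ge0 ?powR_ge0.
under [in leRHS]eq_integral do rewrite -EFinD -mulrDl.
apply: ge0_le_integral_sub => //.
- exact: subset_far.
- exact: measurable_abs_powR.
- apply: measurable_funM; last exact: measurable_powR_id.
  by apply: measurable_funD; exact: measurableT_comp.
- by move=> y; rewrite mulr_ge0 ?powR_ge0.
- by move=> y; rewrite mulr_ge0 ?powR_ge0 ?addr_ge0.
move=> y /=; rewrite in_itv/= andbT => ry.
by rewrite mulrA ler_wpM2r ?powR_ge0// hh//; exact: lt_trans ry.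
Qed.

(** On the half-line the derivative divided by y is (U1 - U0) / (2 t), where U1 is the evolution of
    the same phi for the index nu + 1. Both are bounded near 0, and both have the decay of C_nu at
    infinity by their weighted integrability. *)
Lemma in_C1nu_heatU nu phi t : -1 < nu -> 0 < t ->
  weighted_int nu ((nu + 2^-1) / 2) phi ->
  in_C1nu nu (fun x => heatU nu (radial nu phi) x t).
Proof.
move=> hn t0; set s := (nu + 2^-1) / 2 => h.
have s1 : -1 <= s by rewrite /s ler_pdivlMr//; lra.
have hn1 : -1 < nu + 1 by lra.
have ht := weighted_int_tempered h.
have h1 := weighted_int_shift h; have ht1 := weighted_int_tempered h1.
pose U0 x := heatU nu (radial nu phi) x t.
pose U1 x := heatU (nu + 1) (radial (nu + 1) phi) x t.
have c0 x : {for x, continuous U0} by exact: continuous_heatU_x.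
have c1 x : {for x, continuous U1} by exact: continuous_heatU_x.
have m0 : measurable_fun D U0 by apply: measurable_continuous_halfline => y _; exact: c0.
have m1 : measurable_fun D U1 by apply: measurable_continuous_halfline => y _; exact: c1.
have dE x : derive1 U0 x = x / (2 * t) * (U1 x - U0 x).
  by rewrite -[LHS]/(dy (heatU nu (radial nu phi)) x t) dy_heatU// heatU_shift.
have n0 r : 0 < r -> (Cnu_near nu r U0 < +oo)%E.
  move=> r0; have [M hM] := heatU_bounded hn t0 r0 ht.
  apply: (Cnu_near_bounded hn r0 m0) => y /andP[y0 yr].
  by apply: hM; rewrite ger0_norm// ltW.
have f0 r : 0 < r -> (Cnu_far nu r U0 < +oo)%E.
  move=> r0; apply: (@Cnu_far_fin nu nu s) => //; first by rewrite /s; field.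
  exact: weighted_int_heatU.
have f1 r : 0 < r -> (Cnu_far nu r U1 < +oo)%E.
  move=> r0; apply: (@Cnu_far_fin nu (nu + 1) (s + 1)) => //; first by rewrite /s; field.
  by apply: weighted_int_heatU => //; lra.
have cq x : 0 < x -> {for x, continuous (fun y => y^-1 * derive1 U0 y)}.
  move=> x0; apply: (@continuous_eq_near _ _ _ (fun y => (2 * t)^-1 * (U1 y - U0 y))).
    have nx : \forall y \near x, 0 < y by exact: lt_nbhsr.
    by apply: filterS nx => y y0; rewrite dE; field; rewrite !gt_eqF.
  by apply: cvgM; [exact: cvg_cst|apply: cvgB; [exact: c1|exact: c0]].
have qE y : 0 < y -> `|y^-1 * derive1 U0 y| <= (2 * t)^-1 * (`|U1 y| + `|U0 y|).
  move=> y0; rewrite dE.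
  have -> : y^-1 * (y / (2 * t) * (U1 y - U0 y)) = (2 * t)^-1 * (U1 y - U0 y).
    by field; rewrite !gt_eqF.
  rewrite normrM (gtr0_norm (_ : 0 < (2 * t)^-1)) ?invr_gt0 ?mulr_gt0//.
  by rewrite ler_pM2l ?invr_gt0 ?mulr_gt0// ler_normB.
have mq := measurable_continuous_halfline cq.
split.
- by move=> y _; have [] := is_derive_heatU_x y hn ht t0.
- move=> y y0; rewrite (_ : derive1 _ = (fun y => y / (2 * t) * (U1 y - U0 y))); last first.
    by apply/funext => z; exact: dE.
  apply: cvgM; last by apply: cvgB; [exact: c1|exact: c0].
  by apply: cvgM => //; exact: cvg_cst.
- by split => [y _|r r0]; [exact: c0|split; [exact: n0|exact: f0]].
- split => // r r0; split.
    have [M0 hM0] := heatU_bounded hn t0 r0 ht.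
    have [M1 hM1] := heatU_bounded hn1 t0 r0 ht1.
    apply: (@Cnu_near_bounded nu r ((2 * t)^-1 * (M1 + M0)) _ hn r0 mq) => y /andP[y0 yr].
    apply: le_trans (qE y y0) _.
    rewrite ler_pM2l ?invr_gt0 ?mulr_gt0//; apply: lerD.
      by apply: hM1; rewrite ger0_norm// ltW.
    by apply: hM0; rewrite ger0_norm// ltW.
  apply: (@Cnu_far_lin nu r (2 * t)^-1 U1 U0) => //; last 2 first.
  - exact: f1.
  - exact: f0.
  by rewrite invr_ge0 mulr_ge0 ?(ltW t0).
Qed.

Lemma continuous_in_Cnu_heatU nu phi : -1 < nu -> in_Cnu nu phi ->
  continuous_in_Cnu nu phi (heatU nu (radial nu phi)).
Proof.
move=> hn hphi; have h := in_Cnu_weighted_int hphi; have [cphi _] := hphi.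
set s := (nu + 2^-1) / 2 in h.
have s1 : -1 <= s by rewrite /s ler_pdivlMr//; lra.
have ht := weighted_int_tempered h; have ha := tempered_abs ht.
have hW := tempered_cweight s hn.
have mphi := measurable_continuous_halfline cphi.
have mU t : 0 < t -> measurable_fun D (fun x => heatU nu (radial nu phi) x t).
  by move=> t0; apply: measurable_continuous_halfline => x _; exact: continuous_heatU_x.
have absE x t : heatU nu (fun y => `|radial nu phi y|) x t =
    heatU nu (radial nu (fun y => `|phi y|)) x t.
  by apply: heatU_eq => y y0; rewrite /radial normrM (ger0_norm (powR_ge0 _ _)).
have hta : tempered (radial nu (fun y => `|phi y|)).
  exact: weighted_int_tempered (weighted_int_abs h).
have cab y : 0 < y -> {for y, continuous (fun y => `|phi y|)}.
  by move=> y0; apply: cvg_norm; exact: cphi.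
have cw y : {for y, continuous (cweight s)}.
  apply: (@continuous_comp _ _ _ (fun y : R => 1 + y ^+ 2) (fun z => z `^ (- s))).
    apply: cvgD; first exact: cvg_cst.
    by rewrite (_ : (fun y : R => y ^+ 2) = (fun y => y * y)) //; exact: cvgM.
  by apply: continuous_powR; exact: bracket_gt0.
have A (r : R) (u : nat -> R) : 0 < r -> (forall n, 0 < u n <= 1) -> u n @[n --> \oo] --> (0 : R) ->
    Cnu_near nu r (fun y => heatU nu (radial nu phi) y (u n) - phi y) @[n --> \oo] --> 0%E /\
    Cnu_far nu r (fun y => heatU nu (radial nu phi) y (u n) - phi y) @[n --> \oo] --> 0%E.
  move=> r0 uT cu; have u0 n : 0 < u n by have /andP[] := uT n.
  apply: (@Cnu_cvg0_seq _ nu (fun n y => heatU nu (radial nu phi) y (u n) - phi y)) => //.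
  - by move=> n; apply: measurable_funB => //; exact: mU.
  - by move=> n; apply: weighted_int_sub => //; exact: weighted_int_heatU.
  apply: (@heatU_L1_cvg _ nu s 1 phi u phi (fun y => `|phi y|) (cweight s)) => //.
  - rewrite (_ : (fun x => _) = (fun x => radial nu (fun y => `|phi y|) x * cweight s x)) //.
    exact: weighted_int_abs.
  - by move=> x x0; apply: heatU_initial_seq => //; exact: cphi.
  - move=> x x0; rewrite (eq_cvg _ _ (fun n => absE x (u n))).
    by apply: heatU_initial_seq => //; exact: cab.
  - by move=> x x0; apply: heatU_initial_seq.
  - by apply: eq_Rintegral => y _; rewrite /radial normrM (ger0_norm (powR_ge0 _ _)).
have B (r t : R) (u : nat -> R) : 0 < r -> 0 < t -> (forall n, 0 < u n <= 2 * t) ->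
    u n @[n --> \oo] --> t ->
    Cnu_near nu r (fun y => heatU nu (radial nu phi) y (u n) - heatU nu (radial nu phi) y t)
       @[n --> \oo] --> 0%E /\
    Cnu_far nu r (fun y => heatU nu (radial nu phi) y (u n) - heatU nu (radial nu phi) y t)
       @[n --> \oo] --> 0%E.
  move=> r0 t0 uT cu; have u0 n : 0 < u n by have /andP[] := uT n.
  apply: (@Cnu_cvg0_seq _ nu (fun n y => heatU nu (radial nu phi) y (u n)
     - heatU nu (radial nu phi) y t)) => //.
  - by move=> n; apply: measurable_funB; exact: mU.
  - by move=> n; apply: weighted_int_sub => //; exact: weighted_int_heatU.
  apply: (@heatU_L1_cvg _ nu s (2 * t) phi u (fun x => heatU nu (radial nu phi) x t)
    (fun x => heatU nu (fun y => `|radial nu phi y|) x t)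
    (fun x => heatU nu (radial nu (cweight s)) x t)) => //.
  - exact: mU.
  - exact: integrable_heatU_weighted.
  - by move=> x x0; exact: heatU_time_seq.
  - by move=> x x0; exact: heatU_time_seq.
  - by move=> x x0; exact: heatU_time_seq.
  - rewrite /Rintegral (heatU_duality hn s1 (_ : 0 < t <= t) h)//.
    by rewrite t0 lexx.
move=> r r0.
have n1 : within (fun t : R => 0 < t) (nbhs (0 : R)) [set t | t <= 1].
  have : \forall t \near (0 : R), t < 1 by apply: lt_nbhsl.
  by apply: filterS => t /ltW.
split.
- apply: (cvg_within_seq n1) => u hu cu.
  by apply: (A r u r0 _ cu).1 => n; have [h1 h2] := hu n; rewrite h1.
- apply: (cvg_within_seq n1) => u hu cu.
  by apply: (A r u r0 _ cu).2 => n; have [h1 h2] := hu n; rewrite h1.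
- move=> t t0.
  have n2 : nbhs t [set u : R | 0 < u <= 2 * t].
    have p1 : \forall u \near t, 0 < u by exact: lt_nbhsr.
    have p2 : \forall u \near t, u < 2 * t by apply: lt_nbhsl; lra.
    by near=> u; apply/andP; split; [near: u; exact: p1|apply: ltW; near: u; exact: p2].
  split; apply: (cvg_nbhs_seq n2) => u hu cu.
    exact: (B r t u r0 t0 hu cu).1.
  exact: (B r t u r0 t0 hu cu).2.
Unshelve. all: end_near. Qed.

Lemma heatU_cauchy_neumann nu phi : -1 < nu -> in_Cnu nu phi ->
  cauchy_neumann_solution nu phi (heatU nu (radial nu phi)).
Proof.
move=> hn hphi; have h := in_Cnu_weighted_int hphi; have [cphi _] := hphi.
have ht := weighted_int_tempered h.
split.
- exact: heatU_solution.
- by move=> y y0; apply: heatU_initial => //; exact: cphi.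
- exact: neumann_heatU.
- by move=> t t0; exact: in_C1nu_heatU.
- exact: continuous_in_Cnu_heatU.
Qed.

End existence.

(** * Lagrange's identity, the cutoff and the commutator *)

Section flux.
Context {R : realType}.
Notation mu := (@lebesgue_measure R).
Implicit Types (nu s x y t b : R).

(** Lagrange's identity: the operator is y^-(2nu+1) (y^(2nu+1) F')', and the products of first
    derivatives cancel. *)
Lemma is_derive_flux nu (F F1 V V1 : R -> R) (F2 V2 y : R) : 0 < y ->
  is_derive y 1 F (F1 y) -> is_derive y 1 F1 F2 ->
  is_derive y 1 V (V1 y) -> is_derive y 1 V1 V2 ->
  is_derive y 1 (fun y => y `^ (2 * nu + 1) * (F1 y * V y - F y * V1 y))
    (y `^ (2 * nu + 1) * ((F2 + (2 * nu + 1) / y * F1 y) * V y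
       - F y * (V2 + (2 * nu + 1) / y * V1 y))).
Proof.
move=> y0 dF dF1 dV dV1.
have dm := is_derive1_powR (2 * nu + 1) y0.
have d1 := is_derive_mul dF1 dV; have d2 := is_derive_mul dF dV1.
have dB : is_derive y 1 (fun y => F1 y * V y - F y * V1 y) _ := is_deriveB d1 d2.
apply: is_derive_eq1 (is_derive_mul dm dB) _.
have -> : y `^ (2 * nu + 1 - 1) = y `^ (2 * nu + 1) / y.
  rewrite powRB ?powRr1 ?(ltW y0)//; by rewrite (gt_eqF y0) implybT.
by move: (y `^ _) => m; field; rewrite gt_eqF.
Qed.

(** An even polynomial: its first derivative is O(y) at 0, so neither the term (2 nu + 1) / y times
    that derivative nor the flux near 0 is made worse by the cutoff. *)
Definition cutoff b y : R := (1 - (y / b) ^+ 2) ^+ 2.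
Definition cutoff' b y : R := - (4 * y / b ^+ 2) * (1 - (y / b) ^+ 2).
Definition cutoff'' b y : R := - (4 / b ^+ 2) + 12 * y ^+ 2 / b ^+ 4.

Lemma is_derive_cutoff b y : b != 0 -> is_derive y 1 (cutoff b) (cutoff' b y).
Proof.
move=> b0; rewrite /cutoff /cutoff'; apply: is_derive_eq.
by rewrite /GRing.scale/=; field.
Qed.

Lemma is_derive_cutoff' b y : b != 0 -> is_derive y 1 (cutoff' b) (cutoff'' b y).
Proof.
move=> b0; rewrite /cutoff' /cutoff''; apply: is_derive_eq.
by rewrite /GRing.scale/=; field.
Qed.

Lemma cutoff_bounds b y : 0 < y -> y <= b ->
  [/\ 0 <= cutoff b y <= 1, `|cutoff' b y| <= 4 * y / b ^+ 2 & `|cutoff'' b y| <= 16 / b ^+ 2].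
Proof.
move=> y0 yb; have b0 : 0 < b by exact: lt_le_trans yb.
have r0 : 0 <= y / b <= 1 by rewrite divr_ge0 ?(ltW y0) ?(ltW b0)//= ler_pdivrMr// mul1r.
have r2 : 0 <= (y / b) ^+ 2 <= 1.
  by have /andP[h1 h2] := r0; rewrite sqr_ge0/= expr_le1.
have /andP[r20 r21] := r2.
have p : 0 <= 1 - (y / b) ^+ 2 <= 1 by apply/andP; split; lra.
have /andP[p0 p1] := p.
split.
- by rewrite /cutoff sqr_ge0/= expr_le1.
- rewrite /cutoff' normrM normrN (ger0_norm p0) ger0_norm.
    by rewrite ler_piMr// divr_ge0 ?sqr_ge0// mulr_ge0// ltW.
  by rewrite divr_ge0 ?sqr_ge0// mulr_ge0// ltW.
- rewrite /cutoff''.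
  have -> : 12 * y ^+ 2 / b ^+ 4 = 12 / b ^+ 2 * (y / b) ^+ 2 by field; rewrite gt_eqF.
  have q0 : 0 <= b ^- 2 by rewrite invr_ge0 sqr_ge0.
  by move: (b ^- 2) q0 ((y / b) ^+ 2) r20 r21 => q q0 z z0 z1; rewrite ler_norml; nra.
Qed.

Lemma cutoff_end b : b != 0 -> cutoff b b = 0 /\ cutoff' b b = 0.
Proof. by move=> b0; rewrite /cutoff /cutoff' divff// expr1n subrr expr0n/= mulr0. Qed.

Context (nu x : R) (hn : -1 < nu).

(* poleK1 and poleK2 are the terms that differentiating poleK0 produces. *)
Definition poleK0 y t := heatK nu y x t.
Definition poleK1 y t := x ^+ 2 * heatK (nu + 1) y x t.
Definition poleK2 y t := x ^+ 4 * heatK (nu + 2) y x t.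

Definition poleK_y y t := y / (2 * t) * (poleK1 y t - poleK0 y t).
Definition poleK_yy y t := (2 * t)^-1 * (poleK1 y t - poleK0 y t)
  + y ^+ 2 / (4 * t ^+ 2) * (poleK2 y t - 2 * poleK1 y t + poleK0 y t).
Definition poleK_t y t := (nu + 1) / t * (poleK1 y t - poleK0 y t)
  + y ^+ 2 / (4 * t ^+ 2) * (poleK2 y t - 2 * poleK1 y t + poleK0 y t).

Lemma is_derive_poleK_t y t : 0 < t -> is_derive t 1 (poleK0 y) (poleK_t y t).
Proof. by move=> t0; exact: is_derive_heatK_t. Qed.

Lemma is_derive_poleK_y y t : 0 < t -> is_derive y 1 (poleK0 ^~ t) (poleK_y y t).
Proof. by move=> t0; exact: is_derive_heatK_x. Qed.

Lemma is_derive_poleK_yy y t : 0 < t -> is_derive y 1 (poleK_y ^~ t) (poleK_yy y t).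
Proof.
move=> t0; have hn1 : -1 < nu + 1 by have := hn; lra.
have d0 := is_derive_poleK_y y t0.
have d1 : is_derive y 1 (poleK1 ^~ t) (y / (2 * t) * (poleK2 y t - poleK1 y t)).
  apply: is_derive_eq1 (is_derive_scale (x ^+ 2) (is_derive_heatK_x y x hn1 t0)) _.
  rewrite /poleK2 /poleK1; have -> : nu + 1 + 1 = nu + 2 by ring.
  by move: (heatK _ _ _ _) (heatK _ _ _ _) => A B; ring.
have dB : is_derive y 1 (fun y => poleK1 y t - poleK0 y t) _ := is_deriveB d1 d0.
have dx : is_derive y 1 (fun z : R => z / (2 * t)) (2 * t)^-1.
  by apply: is_derive_eq; rewrite /GRing.scale/=; ring.
apply: is_derive_eq1 (is_derive_mul dx dB) _.
rewrite /poleK_yy /poleK_y; move: (poleK0 _ _) (poleK1 _ _) (poleK2 _ _) => U0 U1 U2.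
by field; rewrite gt_eqF.
Qed.

Lemma poleK_eq y t : 0 < y -> 0 < t ->
  poleK_yy y t + (2 * nu + 1) / y * poleK_y y t = poleK_t y t.
Proof.
move=> y0 t0; rewrite /poleK_yy /poleK_y /poleK_t.
move: (poleK0 _ _) (poleK1 _ _) (poleK2 _ _) => U0 U1 U2.
by field; rewrite !gt_eqF.
Qed.

Lemma continuous_poleK y t : 0 < t ->
  [/\ {for (y, t), continuous (fun z : R * R => poleK0 z.1 z.2)},
      {for (y, t), continuous (fun z : R * R => poleK_y z.1 z.2)} &
      {for (y, t), continuous (fun z : R * R => poleK_t z.1 z.2)}].
Proof.
move=> t0; have hn1 : -1 < nu + 1 by have := hn; lra.
have hn2 : -1 < nu + 2 by have := hn; lra.
have c0 : {for (y, t), continuous (fun z : R * R => poleK0 z.1 z.2)}.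
  exact: continuous_heatK.
have c1 : {for (y, t), continuous (fun z : R * R => poleK1 z.1 z.2)}.
  by apply: cvgM; [exact: cvg_cst|exact: continuous_heatK].
have c2 : {for (y, t), continuous (fun z : R * R => poleK2 z.1 z.2)}.
  by apply: cvgM; [exact: cvg_cst|exact: continuous_heatK].
have cf : {for (y, t), continuous (fun z : R * R => z.1)} by exact: cvg_fst.
have cs : {for (y, t), continuous (fun z : R * R => z.2)} by exact: cvg_snd.
have ci (k : R) : 0 < k -> {for (y, t), continuous (fun z : R * R => (k * z.2)^-1)}.
  move=> k0; apply: cvgV; first by rewrite gt_eqF// mulr_gt0.
  by apply: cvgM; [exact: cvg_cst|exact: cs].
split => //.
- apply: cvgM; last by apply: cvgB; [exact: c1|exact: c0].
  by apply: cvgM; [exact: cf|exact: ci].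
- rewrite (_ : (fun z : R * R => poleK_t z.1 z.2) = (fun z : R * R =>
    (nu + 1) * (1 * z.2)^-1 * (poleK1 z.1 z.2 - poleK0 z.1 z.2)
    + (z.1 * z.1) / (4 * (z.2 * z.2)) * (poleK2 z.1 z.2 - 2 * poleK1 z.1 z.2 + poleK0 z.1 z.2))); last first.
    by apply/funext => z; rewrite mul1r.
  apply: cvgD; apply: cvgM.
  + by apply: cvgM; [exact: cvg_cst|exact: ci].
  + by apply: cvgB; [exact: c1|exact: c0].
  + apply: cvgM; first by apply: cvgM; exact: cf.
    apply: cvgV; first by rewrite gt_eqF// !mulr_gt0.
    by apply: cvgM; [exact: cvg_cst|apply: cvgM; exact: cs].
  + apply: cvgD; last exact: c0.
    apply: cvgB; first exact: c2.
    by apply: cvgM; [exact: cvg_cst|exact: c1].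
Qed.

Lemma poleK_gaussian (a b : R) : 0 < a -> a <= b -> exists2 C, 0 < C & forall y t, a <= t <= b ->
  0 <= poleK0 y t <= C * expR (- ((8 * b)^-1 * y ^+ 2)) /\
  0 <= poleK1 y t <= C * expR (- ((8 * b)^-1 * y ^+ 2)).
Proof.
move=> a0 ab; have hn1 : -1 < nu + 1 by have := hn; lra.
have B0 : 0 < `|x| + 1 by rewrite ltr_wpDl.
have [C0 C00 hC0] := heatK_le_gaussian hn B0 a0 ab.
have [C1 C10 hC1] := heatK_le_gaussian hn1 B0 a0 ab.
have xB : `|x| <= `|x| + 1 by rewrite lerDl.
exists (C0 + x ^+ 2 * C1); first by rewrite ltr_wpDr// mulr_ge0 ?sqr_ge0 ?ltW.
move=> y t hat; have := hC0 x y t xB hat; have := hC1 x y t xB hat.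
have g0 := expR_ge0 (- ((8 * b)^-1 * y ^+ 2)).
rewrite /poleK0 /poleK1 (heatKC nu y) (heatKC (nu + 1) y).
have := heatK_ge0 x y t hn; have := heatK_ge0 x y t hn1.
have := sqr_ge0 x.
move: (heatK nu _ _ _) (heatK (nu + 1) _ _ _) (x ^+ 2) (expR _) g0 => A B X G G0 X0 B0' A0 hB hA.
split; apply/andP; split => //.
- by rewrite (le_trans hA)// ler_wpM2r// lerDl mulr_ge0// ltW.
- by rewrite mulr_ge0.
- rewrite (le_trans (ler_wpM2l X0 hB))// mulrA ler_wpM2r//.
  by rewrite lerDr ltW.
Qed.

(** Both [cutoff'] and [poleK_y] carry a factor y, so the first product is b^-2 times y^2 times a
    Gaussian; in the second the factor y of [cutoff'] cancels 1 / y. Half of the Gaussian absorbs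
    y^2, and the other half is dominated by the weight. *)
Lemma commutator_le s (a0 b0 : R) : 0 < a0 -> a0 <= b0 ->
  exists2 C, 0 < C & forall b y t, 0 < y <= b -> a0 <= t <= b0 ->
   `|2 * poleK_y y t * cutoff' b y + poleK0 y t * (cutoff'' b y + (2 * nu + 1) / y * cutoff' b y)|
     <= C / b ^+ 2 * cweight s y.
Proof.
move=> a0p ab; have b0p : 0 < b0 by exact: lt_le_trans ab.
have [C C0 hC] := poleK_gaussian a0p ab.
pose c := (8 * b0)^-1; have cp : 0 < c by rewrite invr_gt0 mulr_gt0.
have c2 : 0 < c / 2 by rewrite divr_gt0.
have [C1 C10 hC1] := gaussian_le_cweight s c2.
pose A := 8 / a0 * C * (2 / c) + C * (16 + 4 * `|2 * nu + 1|).
have A1 : 0 <= 8 / a0 * C * (2 / c).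
  have ia : 0 <= a0^-1 by rewrite invr_ge0 ltW.
  have ic : 0 <= c^-1 by rewrite invr_ge0 ltW.
  by rewrite !mulr_ge0 ?(ltW C0).
have A2 : 0 < C * (16 + 4 * `|2 * nu + 1|).
  by rewrite mulr_gt0// ltr_wpDr// mulr_ge0.
exists (A * C1); first by rewrite mulr_gt0// ltr_wpDl.
move=> b y t /andP[y0 yb] hat.
have b0' : 0 < b by exact: lt_le_trans yb.
have [_ k1 k2] := cutoff_bounds y0 yb.
have [/andP[p0 q0] /andP[p1 q1]] := hC y t hat.
have /andP[at_ tb] := hat; have t0 : 0 < t by exact: lt_le_trans at_.
set G := expR (- ((8 * b0)^-1 * y ^+ 2)) in q0 q1.
pose G2 := expR (- (c / 2 * y ^+ 2)).
have hG : y ^+ 2 * G <= 2 / c * G2 by exact: sqr_gaussian_le.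
have hG1 : G <= G2.
  rewrite /G /G2 ler_expR lerN2 -/c ler_wpM2r ?sqr_ge0//; lra.
have q : 0 <= b ^- 2 by rewrite invr_ge0 sqr_ge0.
have k1' : `|cutoff' b y| <= 4 * y * b ^- 2 by [].
have i1 : `|2 * poleK_y y t * cutoff' b y| <= 8 / a0 * C * (2 / c) * b ^- 2 * G2.
  rewrite normrM.
  have h1 : `|2 * poleK_y y t| <= 2 * (y / a0 * (C * G)).
    rewrite normrM ger0_norm// ler_pM2l// /poleK_y normrM.
    rewrite ger0_norm ?divr_ge0 ?mulr_ge0 ?(ltW y0) ?(ltW t0)//.
    have -> : y / a0 * (C * G) = y / (2 * a0) * (2 * (C * G)) by field; rewrite gt_eqF.
    apply: ler_pM => //; first by rewrite divr_ge0 ?mulr_ge0 ?(ltW y0) ?(ltW t0).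
      by rewrite ler_pM2l// lef_pV2 ?posrE ?mulr_gt0// ler_pM2l.
    by rewrite ler_norml; apply/andP; split; lra.
  apply: le_trans (ler_pM _ _ h1 k1') _ => //.
  have -> : 2 * (y / a0 * (C * G)) * (4 * y * b ^- 2) = 8 / a0 * C * b ^- 2 * (y ^+ 2 * G) by ring.
  have -> : 8 / a0 * C * (2 / c) * b ^- 2 * G2 = 8 / a0 * C * b ^- 2 * (2 / c * G2) by ring.
  have ia : 0 <= a0^-1 by rewrite invr_ge0 ltW.
  rewrite ler_wpM2l//; apply: mulr_ge0 => //; apply: mulr_ge0; last exact: ltW.
  exact: mulr_ge0.
have i2 : `|poleK0 y t * (cutoff'' b y + (2 * nu + 1) / y * cutoff' b y)|
    <= C * (16 + 4 * `|2 * nu + 1|) * b ^- 2 * G2.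
  rewrite normrM (ger0_norm p0).
  have h1 : `|cutoff'' b y + (2 * nu + 1) / y * cutoff' b y| <= (16 + 4 * `|2 * nu + 1|) * b ^- 2.
    apply: le_trans (ler_normD _ _) _; rewrite [leRHS]mulrDl; apply: lerD => //.
    rewrite normrM normrM (gtr0_norm (_ : 0 < y^-1)) ?invr_gt0//.
    have -> : 4 * `|2 * nu + 1| * b ^- 2 = `|2 * nu + 1| / y * (4 * y * b ^- 2).
      by field; rewrite gt_eqF//= gt_eqF.
    by rewrite ler_wpM2l// divr_ge0// ltW.
  have h0 : poleK0 y t <= C * G2 by rewrite (le_trans q0)// ler_pM2l.
  apply: le_trans (ler_pM p0 _ h0 h1) _ => //.
  by rewrite le_eqVlt; apply/orP; left; apply/eqP; ring.
apply: le_trans (ler_normD _ _) _; apply: le_trans (lerD i1 i2) _.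
have -> : 8 / a0 * C * (2 / c) * b ^- 2 * G2 + C * (16 + 4 * `|2 * nu + 1|) * b ^- 2 * G2
  = A * b ^- 2 * G2 by rewrite /A; ring.
have -> : A * C1 / b ^+ 2 * cweight s y = A * b ^- 2 * (C1 * cweight s y) by ring.
by rewrite ler_wpM2l ?hC1// mulr_ge0// addr_ge0// ltW.
Qed.

(** In the flux at y the derivative of f meets a factor O(1) and f itself a factor O(y). These match
    the two quantities, with powers 2 nu + 1 and 2 nu + 2, that [flux_boundary] makes small. *)
Lemma pole_boundary_le (a0 b0 : R) : 0 < a0 -> a0 <= b0 ->
  exists2 C, 0 < C & forall b y t, 1 <= b -> 0 < y <= 1 -> a0 <= t <= b0 ->
   `|poleK0 y t * cutoff b y| <= C /\
   `|poleK_y y t * cutoff b y + poleK0 y t * cutoff' b y| <= C * y.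
Proof.
move=> a0p ab; have b0p : 0 < b0 by exact: lt_le_trans ab.
have [C C0 hC] := poleK_gaussian a0p ab.
exists (C + C * (a0^-1 + 4)).
  by rewrite addr_gt0// mulr_gt0// ltr_wpDl// invr_ge0 ltW.
move=> b y t b1 /andP[y0 y1] hat.
have yb : y <= b by exact: le_trans b1.
have [/andP[k00 k01] k1 _] := cutoff_bounds y0 yb.
have [/andP[p0 q0] /andP[p1 q1]] := hC y t hat.
have /andP[at_ tb] := hat; have t0 : 0 < t by exact: lt_le_trans at_.
have G1 : expR (- ((8 * b0)^-1 * y ^+ 2)) <= 1.
  by rewrite expR_le1 oppr_le0 mulr_ge0 ?sqr_ge0// invr_ge0 mulr_ge0 ?(ltW b0p).
have hh0 : poleK0 y t <= C by rewrite (le_trans q0)// ler_piMr// ltW.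
have hh1 : poleK1 y t <= C by rewrite (le_trans q1)// ler_piMr// ltW.
have ai : 0 <= a0^-1 by rewrite invr_ge0 ltW.
split.
  rewrite normrM (ger0_norm p0) (ger0_norm k00).
  apply: (@le_trans _ _ (C * 1)); first exact: ler_pM.
  by rewrite mulr1 lerDl mulr_ge0 ?(ltW C0)// addr_ge0.
have k1' : `|cutoff' b y| <= 4 * y.
  apply: le_trans k1 _; rewrite ler_piMr ?mulr_ge0 ?(ltW y0)//.
  by rewrite invf_le1 ?exprn_gt0 ?(lt_le_trans _ b1)// exprn_ege1.
have hy : `|poleK_y y t| <= y / a0 * C.
  rewrite /poleK_y normrM ger0_norm ?divr_ge0 ?mulr_ge0 ?(ltW y0) ?(ltW t0)//.
  apply: ler_pM => //; first by rewrite divr_ge0 ?mulr_ge0 ?(ltW y0) ?(ltW t0).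
    rewrite ler_pM2l// lef_pV2 ?posrE ?mulr_gt0//; lra.
  by rewrite ler_norml; apply/andP; split; lra.
have i1 : `|poleK_y y t * cutoff b y| <= y / a0 * C.
  rewrite normrM (ger0_norm k00) -[leRHS]mulr1; exact: ler_pM.
have i2 : `|poleK0 y t * cutoff' b y| <= C * (4 * y).
  by rewrite normrM (ger0_norm p0); exact: ler_pM.
apply: le_trans (ler_normD _ _) _; apply: le_trans (lerD i1 i2) _.
have -> : y / a0 * C + C * (4 * y) = C * (a0^-1 + 4) * y by ring.
by rewrite ler_wpM2r ?(ltW y0)// lerDr ltW.
Qed.

End flux.

(** * A priori bounds for arbitrary solutions *)

Section uniqueness_bounds.
Context {R : realType}.
Notation mu := (@lebesgue_measure R).
Notation D := (`]0%R, +oo[%classic : set R).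
Implicit Types (nu s x y t : R) (g h phi : R -> R).

Lemma bounded_rectangle (g : R * R -> R) (a b c d : R) :
  (forall y t, a <= y <= b -> c <= t <= d -> {for (y, t), continuous g}) ->
  exists2 M, 0 < M & forall y t, a <= y <= b -> c <= t <= d -> `|g (y, t)| <= M.
Proof.
move=> hg; pose K := `[a, b]%classic `*` `[c, d]%classic : set (R * R).
have cK : compact K by apply: compact_setX; exact: segment_compact.
have cg : {within K, continuous g}.
  apply: continuous_in_subspaceT => -[y t]; rewrite inE => -[/= hy ht].
  by apply: hg; [move: hy|move: ht]; rewrite in_itv.
have /compact_bounded[M [_ hM]] := continuous_compact cg cK.
exists (`|M| + 1); first by rewrite ltr_wpDl.
move=> y t hy ht; apply: (hM (`|M| + 1)).
  by rewrite (le_lt_trans (ler_norm M))// ltrDl.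
by exists (y, t) => //; split; rewrite /= in_itv.
Qed.

Lemma wnorm_ge0 nu g : 0 <= wnorm nu g.
Proof. by apply: Rintegral_ge0 => y _; rewrite mulr_ge0// cweight_ge0. Qed.

Lemma wnorm_le_sub nu g h : weighted_int nu ((nu + 2^-1) / 2) g ->
  weighted_int nu ((nu + 2^-1) / 2) h ->
  wnorm nu g <= wnorm nu h + wnorm nu (fun y => g y - h y).
Proof.
have mD := @measurable_halfline R.
move=> ig ih; have igh := weighted_int_sub ig ih.
rewrite -RintegralD//; [|exact: wnorm_integrable|exact: wnorm_integrable].
apply: le_Rintegral => //; first exact: wnorm_integrable.
  exact: integrable_add mD (wnorm_integrable ih) (wnorm_integrable igh).
move=> y _; rewrite -mulrDl ler_wpM2r ?cweight_ge0//.
have -> : radial nu g y = radial nu h y + radial nu (fun y => g y - h y) y.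
  by rewrite /radial; ring.
exact: ler_normD.
Qed.

Lemma wnorm_cvg0 nu (T : Type) (F : set_system T) {FF : ProperFilter F} (G : T -> R -> R) :
  (\forall t \near F, measurable_fun D (G t) /\ weighted_int nu ((nu + 2^-1) / 2) (G t)) ->
  Cnu_near nu 1 (G t) @[t --> F] --> 0%E ->
  Cnu_far nu 1 (G t) @[t --> F] --> 0%E ->
  wnorm nu (G t) @[t --> F] --> (0 : R).
Proof.
move=> hG h1 h2; have [C C0 hC] := weighted_le_Cnu nu.
have h3 : (C%:E * (Cnu_near nu 1 (G t) + Cnu_far nu 1 (G t)))%E @[t --> F] --> 0%E.
  rewrite -(mule0 C%:E); apply: cvgeZl => //.
  have d0 : (adde_def (0 : \bar R) 0)%E by [].
  rewrite -(adde0 0%E); exact: (cvgeD d0 h1 h2).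
suff h4 : (\int[mu]_(y in D) (`|radial nu (G t) y| * cweight ((nu + 2^-1) / 2) y)%:E)%E
    @[t --> F] --> 0%E by exact: fine_cvg h4.
apply: (squeeze_cvge _ (cvg_cst 0%E) h3).
near=> t; rewrite hC ?andbT; last by near: t; apply: filterS hG => t [].
by apply: integral_ge0 => y _; rewrite lee_fin mulr_ge0// cweight_ge0.
Unshelve. all: by end_near. Qed.

Lemma powR_small (p e : R) : 0 < p -> 0 < e ->
  exists2 d, 0 < d & forall a, 0 < a -> a <= d -> a `^ p <= e.
Proof.
move=> p0 e0; exists (e `^ p^-1); first exact: powR_gt0.
move=> a a0 ad.
have -> : e = (e `^ p^-1) `^ p by rewrite -powRrM mulVf ?gt_eqF// powRr1// ltW.
by rewrite ge0_ler_powR// ?nnegrE ?powR_ge0 ?ltW.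
Qed.

Context (nu : R) (hn : -1 < nu) (f : R -> R -> R).
Hypotheses (hf : C21 f) (hN : neumann_condition nu f).

Lemma C21_is_derive y t : 0 < y -> 0 < t ->
  [/\ is_derive y 1 (f ^~ t) (dy f y t), is_derive y 1 (dy f ^~ t) (dy (dy f) y t)
    & is_derive t 1 (f y) (dt f y t)].
Proof.
move=> y0 t0; have [+ _] := hf => /(_ y t y0 t0)[d1 d2 d3].
have e (g : R -> R) z : derivable g z 1 -> is_derive z 1 g (derive1 g z).
  by move=> h; rewrite derive1E; exact/derivableP.
by split; [exact: e d1|exact: e d2|exact: e d3].
Qed.

(* Membership in C_nu gives no pointwise control of f at the origin; it is the
   Neumann condition, integrated in y, that bounds f itself there. *)
Lemma flux_boundary s0 (e : R) : 0 < s0 -> 0 < e ->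
  exists r a1, [/\ 0 < r, 0 < a1 & forall s a, `|s - s0| < r -> 0 < a -> a <= a1 ->
    a `^ (2 * nu + 1) * `|dy f a s| <= e /\ a `^ (2 * nu + 2) * `|f a s| <= e].
Proof.
move=> s00 e0; have e20 : 0 < e / 2 by rewrite divr_gt0.
have := hN s00 => /cvgrPdist_le/(_ _ e20)[[A B] /= [/nbhs_ballP[d d0 hA] /nbhs_ballP[r1 r10 hB]] hAB].
have hflux y s : 0 < y -> y < d -> `|s - s0| < r1 -> y `^ (2 * nu + 1) * `|dy f y s| <= e / 2.
  move=> y0 yd sr; have := hAB (y, s); rewrite /= sub0r normrN normrM ger0_norm ?powR_ge0//.
  apply => //; split => /=.
    by apply: hA; rewrite /ball/= sub0r normrN gtr0_norm.
  by apply: hB; rewrite /ball/= distrC.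
pose d1 := Num.min d 1 / 2.
have dm : 0 < Num.min d 1 by rewrite lt_min d0 ltr01.
have d10 : 0 < d1 by rewrite divr_gt0.
have [d1d d11] : d1 < d /\ d1 < 1.
  have : d1 < Num.min d 1 by rewrite /d1 ltr_pdivrMr// ltr_pMr// ltr1n.
  by rewrite lt_min => /andP[].
have [_ [cf _ _ _]] := hf.
have := cf d1 s0 d10 s00 => /cvgrPdist_le/(_ 1 ltr01)[[A' B'] /= [hA' /nbhs_ballP[r2 r20 hB']] hAB'].
pose M := `|f d1 s0| + 1; have M0 : 0 < M by rewrite ltr_wpDl.
have hM s : `|s - s0| < r2 -> `|f d1 s| <= M.
  move=> sr; have h : `|f d1 s0 - f d1 s| <= 1.
    by apply: (hAB' (d1, s)); split => /=; [exact: nbhs_singleton|apply: hB'; rewrite /ball/= distrC].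
  have -> : f d1 s = f d1 s0 - (f d1 s0 - f d1 s) by ring.
  by rewrite (le_trans (ler_normB _ _))// lerD2l.
have p0 : 0 < 2 * nu + 2 by have := hn; lra.
have [a1 a10 ha1] := powR_small p0 (divr_gt0 e20 M0).
exists (Num.min (Num.min r1 r2) s0), (Num.min a1 (d1 / 2)); split.
- by rewrite !lt_min r10 r20.
- by rewrite lt_min a10 divr_gt0.
move=> s a; rewrite !lt_min le_min => /andP[/andP[sr1 sr2] ss0] a0 /andP[aa1 ad1].
have s0' : 0 < s by move: ss0; rewrite ltr_norml => /andP[h _]; lra.
have ad : a < d1 by rewrite (le_lt_trans ad1)// ltr_pdivrMr// ltr_pMr// ltr1n.
have hfl := hflux a s a0 (lt_trans ad d1d) sr1.
split; first by apply: le_trans hfl _; lra.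
have dfy (y : R) : y \in `]a, d1[ -> is_derive y 1 (f ^~ s) (dy f y s).
  rewrite in_itv/= => /andP[ay _].
  by have [] := C21_is_derive (lt_trans a0 ay) s0'.
have cfy : {within `[a, d1], continuous (f ^~ s)}.
  apply: continuous_in_subspaceT => y; rewrite inE/= in_itv/= => /andP[ay _].
  by have [/is_derive_continuous] := C21_is_derive (lt_le_trans a0 ay) s0'.
(* Mean value between a and the fixed point d1. The value f(d1, s) stays bounded and is killed by
   a^(2nu+2); in the other term a < c gives a^(2nu+2) <= c times c^(2nu+1), so the small flux at c
   appears. *)
have [c] := MVT ad dfy cfy; rewrite in_itv/= => /andP[ac cd] efd.
have c0 : 0 < c by exact: lt_trans ac.
have -> : f a s = f d1 s - dy f c s * (d1 - a) by rewrite -efd; ring.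
have pa : 0 <= a `^ (2 * nu + 2) by exact: powR_ge0.
apply: le_trans (ler_wpM2l pa (ler_normB _ _)) _; rewrite mulrDr.
have i1 : a `^ (2 * nu + 2) * `|f d1 s| <= e / 2.
  have -> : e / 2 = e / 2 / M * M by field; rewrite gt_eqF.
  by apply: ler_pM => //; [exact: ha1|exact: hM].
have i2 : a `^ (2 * nu + 2) * `|dy f c s * (d1 - a)| <= e / 2.
  have h1 : a `^ (2 * nu + 2) <= c * c `^ (2 * nu + 1).
    have -> : c * c `^ (2 * nu + 1) = c `^ (2 * nu + 2).
      by rewrite mulrC -powRS//; congr (_ `^ _); ring.
    by rewrite ge0_ler_powR ?nnegrE ?(ltW a0) ?(ltW c0) ?(ltW ac)// ltW.
  have h2 := hflux c s c0 (lt_trans cd d1d) sr1.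
  have h3 : `|d1 - a| <= 1.
    by rewrite ger0_norm ?subr_ge0 ?(ltW ad)// lerBlDr ler_wpDr ?(ltW d11) ?(ltW a0).
  rewrite normrM.
  apply: le_trans (ler_wpM2r _ h1) _; first by rewrite mulr_ge0.
  have c1 : c <= 1 by exact/ltW/(lt_trans cd).
  have -> : c * c `^ (2 * nu + 1) * (`|dy f c s| * `|d1 - a|) =
    c * `|d1 - a| * (c `^ (2 * nu + 1) * `|dy f c s|) by ring.
  rewrite -[leRHS]mul1r; apply: ler_pM => //.
  - by rewrite mulr_ge0 ?(ltW c0).
  - by rewrite mulr_ge0 ?powR_ge0.
  - by rewrite -[leRHS]mulr1; apply: ler_pM => //; rewrite ltW.
by rewrite (splitr e) lerD.
Qed.

End uniqueness_bounds.

(** * The truncated pairing and its rate of change *)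

Section uniqueness_truncation.
Context {R : realType}.
Notation mu := (@lebesgue_measure R).
Notation D := (`]0%R, +oo[%classic : set R).
Implicit Types (y s t a b : R).

Lemma continuous_slice (G : R * R -> R) y s :
  {for (y, s), continuous G} -> {for y, continuous (fun y => G (y, s))}.
Proof.
move=> h; apply: (@continuous_comp _ _ _ (fun y => (y, s)) G) => //.
suff : (z, s) @[z --> y] --> (y, s) by [].
exact: (cvg_pair cvg_id (cvg_cst _)).
Qed.

Lemma continuous_on_fst (g : R -> R) y s :
  {for y, continuous g} -> {for (y, s), continuous (fun z : R * R => g z.1)}.
Proof.
move=> h; apply: (@continuous_comp _ _ _ (fun z : R * R => z.1) g); last exact: h.
exact: cvg_fst.
Qed.

Lemma continuous_reverse (T : R) (G : R -> R -> R) y s :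
  {for (y, T - s), continuous (fun z : R * R => G z.1 z.2)} ->
  {for (y, s), continuous (fun z : R * R => G z.1 (T - z.2))}.
Proof.
move=> h; apply: (@continuous_comp _ _ _ (fun z : R * R => (z.1, T - z.2)) (fun z => G z.1 z.2)) => //.
suff : (z.1, T - z.2) @[z --> (y, s)] --> (y, T - s) by [].
have h2 : T - z.2 @[z --> (y, s)] --> T - s by apply: cvgB; [exact: cvg_cst|exact: cvg_snd].
exact: (cvg_pair cvg_fst h2).
Qed.

Context (nu x T : R) (f : R -> R -> R) (hn : -1 < nu).
Hypotheses (hf : C21 f) (he : bessel_heat_equation nu f).
Notation m y := (y `^ (2 * nu + 1)).
Notation K0 := (poleK0 nu x).
Notation K1 := (poleK_y nu x).
Notation Kt := (poleK_t nu x).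

(* Cutting off at b, where [cutoff b] vanishes to second order, leaves the
   flux through a as the only boundary term; the lower end a is handled by the
   Neumann condition. *)
Definition truncated a b s : R :=
  \int[mu]_(y in `[a, b]) (f y s * (K0 y (T - s) * cutoff b y) * m y).

Definition truncated_rate b y s : R :=
  (dt f y s * K0 y (T - s) - f y s * Kt y (T - s)) * cutoff b y * m y.

(** With B the Bessel operator and chi the cutoff, this is B(K chi) - chi B(K). *)
Definition commutator b y s : R :=
  2 * K1 y (T - s) * cutoff' b y
  + K0 y (T - s) * (cutoff'' b y + (2 * nu + 1) / y * cutoff' b y).

Definition pole_flux b y s : R :=
  m y * (dy f y s * (K0 y (T - s) * cutoff b y)
    - f y s * (K1 y (T - s) * cutoff b y + K0 y (T - s) * cutoff' b y)).

Section fixed.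
Context (a b : R) (a0 : 0 < a) (ab : a < b).
Let b0 : 0 < b := lt_trans a0 ab.
Let bn0 : b != 0. Proof. by rewrite gt_eqF. Qed.

Lemma continuous_truncated_weight y s : 0 < y ->
  {for (y, s), continuous (fun z : R * R => cutoff b z.1)} /\
  {for (y, s), continuous (fun z : R * R => m z.1)}.
Proof.
move=> y0; split; last exact: (continuous_on_fst (continuous_powR y0)).
exact: (continuous_on_fst (is_derive_continuous (is_derive_cutoff y bn0))).
Qed.

Lemma continuous_truncated y s : 0 < y -> 0 < s < T ->
  {for (y, s), continuous (fun z : R * R => f z.1 z.2 * (K0 z.1 (T - z.2) * cutoff b z.1) * m z.1)} /\
  {for (y, s), continuous (fun z : R * R => truncated_rate b z.1 z.2)}.
Proof.
move=> y0 /andP[s0 sT]; have t0 : 0 < T - s by rewrite subr_gt0.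
have [_ [cf _ _ ct]] := hf; have [k0 _ kt] := continuous_poleK x hn y t0.
have [cc cm] := continuous_truncated_weight s y0.
have {}k0 := continuous_reverse k0; have {}kt := continuous_reverse kt.
split; apply: cvgM; try exact: cm.
- by apply: cvgM; [exact: cf|apply: cvgM; [exact: k0|exact: cc]].
- apply: cvgM; last exact: cc.
  by apply: cvgB; apply: cvgM; [exact: ct|exact: k0|exact: cf|exact: kt].
Qed.

Lemma is_derive_truncated s : 0 < s < T ->
  is_derive s 1 (truncated a b) (\int[mu]_(y in `[a, b]) truncated_rate b y s).
Proof.
move=> /andP[s0 sT].
have hrect y t : a <= y <= b -> s / 2 <= t <= (s + T) / 2 -> 0 < y /\ 0 < t < T.
  have := a0; move=> a0' /andP[ay _] /andP[t1 t2]; split; [|apply/andP; split]; lra.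
have hc y t : a <= y <= b -> s / 2 <= t <= (s + T) / 2 ->
    {for (y, t), continuous (fun z : R * R => truncated_rate b z.1 z.2)}.
  by move=> hy ht; have [y0 h] := hrect _ _ hy ht; have [] := continuous_truncated y0 h.
have [M M0 hM] := bounded_rectangle hc.
have hw t : s / 2 < t < (s + T) / 2 -> s / 2 <= t <= (s + T) / 2.
  by move=> /andP[h1 h2]; rewrite !ltW.
apply: (@is_derive_integral _ `[a, b] (fun s y => f y s * (K0 y (T - s) * cutoff b y) * m y)
  (fun s y => truncated_rate b y s) s (s / 2) ((s + T) / 2) (fun=> M)) => //.
- by apply/andP; split; lra.
- move=> t /hw ht; apply: continuous_segment_integrable => y hy.
  have [y0 h] := hrect _ _ hy ht.
  have [h1 _] := continuous_truncated y0 h; exact: (continuous_slice h1).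
- move=> t y /hw ht; rewrite /= in_itv/= => hy.
  have [y0 /andP[t0 tT]] := hrect _ _ hy ht.
  have tT0 : 0 < T - t by rewrite subr_gt0.
  have [_ _ df] := C21_is_derive hf y0 t0.
  have dT : is_derive t 1 (fun t : R => T - t) (-1).
    by apply: is_derive_eq; rewrite /GRing.scale/=; ring.
  have dK : is_derive t 1 (fun t => K0 y (T - t)) (Kt y (T - t) * -1) :=
    @is_derive1_comp _ (K0 y) (fun t => T - t) _ _ _ (is_derive_poleK_t x hn y tT0) dT.
  have h := is_derive_scale (cutoff b y * m y) (is_derive_mul df dK).
  rewrite (_ : (fun s => f y s * (K0 y (T - s) * cutoff b y) * m y) =
    (fun s => cutoff b y * m y * (f y s * K0 y (T - s)))); last first.
    by apply/funext => r; ring.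
  by apply: is_derive_eq1 h _; rewrite /truncated_rate; ring.
- by apply: continuous_segment_integrable => y _; exact: cvg_cst.
- by move=> t y /hw ht; rewrite /= in_itv/= => hy; exact: (hM y t).
Qed.

(** Lagrange's identity for f and the cut-off kernel. Both heat equations turn the operators into
    time derivatives, the kernel running backwards through T - s; only the commutator is left
    over. *)
Lemma is_derive_pole_flux y s : 0 < y -> 0 < s < T ->
  is_derive y 1 (pole_flux b ^~ s) (truncated_rate b y s - f y s * commutator b y s * m y).
Proof.
move=> y0 /andP[s0 sT]; have t0 : 0 < T - s by rewrite subr_gt0.
have [d0 d1 _] := C21_is_derive hf y0 s0.
have k0 := is_derive_poleK_y x hn y t0; have k1 := is_derive_poleK_yy x hn y t0.
have c0 := is_derive_cutoff y bn0; have c1 := is_derive_cutoff' y bn0.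
have v0 := is_derive_mul k0 c0.
have v1 : is_derive y 1 (fun y => K1 y (T - s) * cutoff b y + K0 y (T - s) * cutoff' b y)
   (poleK_yy nu x y (T - s) * cutoff b y + 2 * K1 y (T - s) * cutoff' b y
    + K0 y (T - s) * cutoff'' b y).
  by apply: is_derive_eq1 (is_deriveD (is_derive_mul k1 c0) (is_derive_mul k0 c1)) _; ring.
have v0' : is_derive y 1 (fun y => K0 y (T - s) * cutoff b y)
   (K1 y (T - s) * cutoff b y + K0 y (T - s) * cutoff' b y).
  by apply: is_derive_eq1 v0 _; ring.
apply: is_derive_eq1 (is_derive_flux nu y0 d0 d1 v0' v1) _.
rewrite (he y0 s0) /truncated_rate /commutator -(poleK_eq nu x y0 t0).
move: (dt f y s) (f y s) (K0 _ _) (K1 _ _) (poleK_yy _ _ _ _) (cutoff _ _) (cutoff' _ _)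
  (cutoff'' _ _) (m y) => q1 q2 q3 q4 q5 q6 q7 q8 q9.
by field; rewrite gt_eqF.
Qed.

Lemma continuous_commutator s : 0 < s < T -> forall y, a <= y <= b ->
  {for y, continuous (fun y => f y s * commutator b y s * m y)}.
Proof.
move=> /andP[s0 sT] y; have t0 : 0 < T - s by rewrite subr_gt0.
have [_ [cf _ _ _]] := hf.
move=> /andP[ay _]; have y0 := lt_le_trans a0 ay.
have [k0 k1 _] := continuous_poleK x hn y t0.
have {}k0 := continuous_slice k0; have {}k1 := continuous_slice k1.
have {}cf := continuous_slice (cf y s y0 s0).
have dc' := is_derive_continuous (is_derive_cutoff' y bn0).
have dc'' : {for y, continuous (cutoff'' b)}.
  by apply: (@is_derive_continuous _ _ _ (24 * y / b ^+ 4)); apply: is_derive_eq;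
     rewrite /GRing.scale/=; ring.
apply: cvgM; last exact: continuous_powR.
apply: cvgM; first exact: cf.
apply: cvgD; apply: cvgM.
+ by apply: cvgM; [exact: cvg_cst|exact: k1].
+ exact: dc'.
+ exact: k0.
+ apply: cvgD; first exact: dc''.
  apply: cvgM; last exact: dc'.
  apply: cvgM; first exact: cvg_cst.
  by apply: cvgV; [rewrite gt_eqF|exact: cvg_id].
Qed.

Lemma truncated_rateE s : 0 < s < T ->
  \int[mu]_(y in `[a, b]) truncated_rate b y s =
  - pole_flux b a s + \int[mu]_(y in `[a, b]) (f y s * commutator b y s * m y).
Proof.
move=> hs; have /andP[s0 sT] := hs; have t0 : 0 < T - s by rewrite subr_gt0.
have cr y : a <= y <= b -> {for y, continuous (truncated_rate b ^~ s)}.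
  move=> /andP[ay _]; have y0 := lt_le_trans a0 ay.
  by have [_ h] := continuous_truncated y0 hs; exact: (continuous_slice h).
have cc := continuous_commutator hs.
have -> : \int[mu]_(y in `[a, b]) truncated_rate b y s =
    \int[mu]_(y in `[a, b]) ((truncated_rate b y s - f y s * commutator b y s * m y)
       + f y s * commutator b y s * m y).
  by apply: eq_Rintegral => y _; rewrite subrK.
rewrite RintegralD//; first last.
- exact: continuous_segment_integrable.
- by apply: continuous_segment_integrable => y hy; apply: cvgB; [exact: cr|exact: cc].
congr (_ + _).
have dF y : a <= y <= b -> is_derive y 1 (pole_flux b ^~ s)
    (truncated_rate b y s - f y s * commutator b y s * m y).
  by move=> /andP[ay _]; exact: is_derive_pole_flux (lt_le_trans a0 ay) hs.
have cF y : a <= y <= b -> {for y, continuous (fun y => truncated_rate b y s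
    - f y s * commutator b y s * m y)}.
  by move=> hy; apply: cvgB; [exact: cr|exact: cc].
have [e1 e2] := cutoff_end bn0.
have -> := Rintegral_FTC_segment ab dF cF.
by rewrite {1}/pole_flux e1 e2 !mulr0 addr0 mulr0 subr0 mulr0 sub0r.
Qed.

End fixed.

Hypothesis hw : forall s, 0 < s -> weighted_int nu ((nu + 2^-1) / 2) (f ^~ s).

(** The constant C depends on the range of T - s and not on a and b, so that a can tend to 0 and b
    to infinity. *)
Lemma truncated_rate_le (t1 t2 : R) : 0 < t1 -> t1 <= t2 ->
  exists2 C, 0 < C & forall a b s, 0 < a <= 1 -> 1 <= b -> a < b -> 0 < s -> t1 <= T - s <= t2 ->
    `|\int[mu]_(y in `[a, b]) truncated_rate b y s|
    <= C * (m a * `|dy f a s| + a `^ (2 * nu + 2) * `|f a s|) + C / b ^+ 2 * wnorm nu (f ^~ s).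
Proof.
move=> t10 t12; have mD := @measurable_halfline R.
have [C1 C10 hC1] := pole_boundary_le x hn t10 t12.
have [C2 C20 hC2] := commutator_le x hn ((nu + 2^-1) / 2) t10 t12.
exists (C1 + C2); first by rewrite addr_gt0.
move=> a b s /andP[a0 a1] b1 ab s0 hs; have hsT : 0 < s < T.
  by rewrite s0/= -subr_gt0; case/andP: hs => h _; exact: lt_le_trans h.
have -> := truncated_rateE a0 ab hsT.
apply: le_trans (ler_normD _ _) _; rewrite normrN; apply: lerD.
- have [h0 h1] := hC1 b a (T - s) b1 (introT andP (conj a0 a1)) hs.
  rewrite /pole_flux normrM (ger0_norm (powR_ge0 _ _)).
  have -> : a `^ (2 * nu + 2) = m a * a by rewrite -powRS//; congr (_ `^ _); ring.
  have -> : (C1 + C2) * (m a * `|dy f a s| + m a * a * `|f a s|) =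
    m a * (`|dy f a s| * (C1 + C2) + `|f a s| * ((C1 + C2) * a)) by ring.
  rewrite ler_wpM2l ?powR_ge0//; apply: le_trans (ler_normB _ _) _; rewrite !normrM.
  apply: lerD; rewrite ler_wpM2l// -?normrM; first by apply: le_trans h0 _; rewrite lerDl ltW.
  by apply: le_trans h1 _; rewrite ler_wpM2r ?(ltW a0)// lerDl ltW.
- have iw := wnorm_integrable (hw s0).
  have sub : `[a, b]%classic `<=` D.
    by move=> y; rewrite /= !in_itv/= => /andP[ay _]; rewrite andbT (lt_le_trans a0 ay).
  have iw' : mu.-integrable `[a, b] (EFin \o (fun y => (C1 + C2) / b ^+ 2 *
      (`|radial nu (f ^~ s) y| * cweight ((nu + 2^-1) / 2) y))).
    by apply: integrable_scale => //; apply: integrableS iw.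
  have cle y : y \in `[a, b] -> `|f y s * commutator b y s * m y| <= (C1 + C2) / b ^+ 2 *
      (`|radial nu (f ^~ s) y| * cweight ((nu + 2^-1) / 2) y).
    rewrite in_itv/= => /andP[ay yb]; have y0 := lt_le_trans a0 ay.
    have -> : f y s * commutator b y s * m y = radial nu (f ^~ s) y * commutator b y s.
      by rewrite /radial; ring.
    rewrite normrM mulrCA ler_wpM2l//.
    apply: le_trans (hC2 b y (T - s) (introT andP (conj y0 yb)) hs) _.
    rewrite ler_wpM2r ?cweight_ge0// ler_wpM2r ?invr_ge0 ?sqr_ge0//.
    by rewrite lerDr ltW.
  have ic : mu.-integrable `[a, b] (EFin \o (fun y => f y s * commutator b y s * m y)).
    by apply: continuous_segment_integrable => y hy; exact: (continuous_commutator a0 ab hsT).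
  apply: le_trans (le_normr_Rintegral _ ic) _ => //.
  apply: (@le_trans _ _ (\int[mu]_(y in `[a, b]) ((C1 + C2) / b ^+ 2 *
      (`|radial nu (f ^~ s) y| * cweight ((nu + 2^-1) / 2) y)))).
    by apply: le_Rintegral => //; exact: integrable_norm ic.
  rewrite RintegralZl//; last by apply: integrableS iw.
  rewrite ler_wpM2l ?divr_ge0 ?sqr_ge0 ?addr_ge0 ?(ltW C10) ?(ltW C20)//.
  rewrite /wnorm /Rintegral fine_le//.
  + by apply: integrable_fin_num => //; apply: integrableS iw.
  + exact: integrable_fin_num iw.
  + apply: ge0_subset_integral => //; first exact: measurable_int iw.
    by move=> y _; rewrite lee_fin mulr_ge0// cweight_ge0.
Qed.

End uniqueness_truncation.

(** * Constancy of the pairing and its two end values *)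

Section uniqueness.
Context {R : realType}.
Notation mu := (@lebesgue_measure R).
Notation D := (`]0%R, +oo[%classic : set R).
Implicit Types (y s t a b : R).

Lemma lipschitz_derive (h d : R -> R) (s0 r e : R) : 0 <= e ->
  (forall s, `|s - s0| < r -> is_derive s 1 h (d s) /\ `|d s| <= e) ->
  forall s, `|s - s0| < r -> `|h s - h s0| <= e * `|s - s0|.
Proof.
move=> e0 hd.
have key a b : a <= b -> (forall s, a <= s <= b -> `|s - s0| < r) -> `|h b - h a| <= e * (b - a).
  move=> ab hr.
  have h1 s : s \in `]a, b[ -> is_derive s 1 h (d s).
    rewrite in_itv/= => /andP[as_ sb].
    by have [] := hd s (hr s _); rewrite ?(ltW as_) ?(ltW sb).
  have h2 : {within `[a, b], continuous h}.
    apply: continuous_in_subspaceT => q; rewrite inE/= in_itv/= => hq.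
    by have [/is_derive_continuous] := hd _ (hr _ hq).
  have [c] := MVT_segment ab h1 h2; rewrite in_itv/= => hc ->.
  rewrite normrM (@ger0_norm _ (b - a)) ?subr_ge0// ler_wpM2r ?subr_ge0//.
  by have [] := hd _ (hr _ hc).
move=> s hs; have [le|/ltW le] := leP s s0.
  rewrite distrC (distrC s) (@ger0_norm _ (s0 - s)) ?subr_ge0//; apply: key => // q /andP[q1 q2].
  move: hs; rewrite distrC (distrC q) !ger0_norm ?subr_ge0//; lra.
rewrite (@ger0_norm _ (s - s0)) ?subr_ge0//; apply: key => // q /andP[q1 q2].
move: hs; rewrite !ger0_norm ?subr_ge0//; lra.
Qed.

Lemma flat_is_derive0 (g : R -> R) (s0 : R) :
  (forall e, 0 < e -> exists2 r, 0 < r & forall s, `|s - s0| < r ->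
     `|g s - g s0| <= e * `|s - s0|) -> is_derive s0 1 g 0.
Proof.
move=> hg.
have c : h^-1 *: ((g \o shift s0) (h *: (1 : R)) - g s0) @[h --> 0^'] --> (0 : R).
  apply/cvgrPdist_le => e e0; have [r r0 hr] := hg e e0.
  near=> h; have hn0 : h != 0 by near: h; exact: nbhs_dnbhs_neq.
  have hh : `|h| < r by near: h; apply: dnbhs0_lt.
  rewrite sub0r normrN /GRing.scale/= mulr1 normrM normfV mulrC ler_pdivrMr ?normr_gt0//.
  by have := hr (h + s0); rewrite addrK; exact.
by split; [apply/cvg_ex; exists 0|exact/cvg_lim].
Unshelve. all: by end_near. Qed.

Lemma cutoff_cvg y : 0 < y -> cutoff n.+1%:R y @[n --> \oo] --> (1 : R).
Proof.
move=> y0.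
have h : y / n.+1%:R @[n --> \oo] --> (0 : R).
  rewrite -(mulr0 y); apply: cvgM; first exact: cvg_cst.
  exact: cvg_harmonic.
rewrite [X in _ --> X](_ : (1 : R) = (1 - 0 * 0) * (1 - 0 * 0)); last by ring.
rewrite (_ : (fun n => _) = fun n => (1 - (y / n.+1%:R) * (y / n.+1%:R))
    * (1 - (y / n.+1%:R) * (y / n.+1%:R))); last first.
  by apply/funext => n; rewrite /cutoff !expr2.
have c : 1 - y / n.+1%:R * (y / n.+1%:R) @[n --> \oo] --> (1 - 0 * 0 : R).
  by apply: cvgB; [exact: cvg_cst|exact: cvgM].
exact: cvgM.
Qed.

Context (nu x T : R) (phi : R -> R) (f : R -> R -> R).
Hypotheses (hn : -1 < nu) (x0 : 0 < x) (T0 : 0 < T).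
Hypotheses (hphi : in_Cnu nu phi) (hS : cauchy_neumann_solution nu phi f).
Notation w0 := ((nu + 2^-1) / 2).

Let hf : C21 f. Proof. by case: hS => -[]. Qed.
Let he : bessel_heat_equation nu f. Proof. by case: hS => -[]. Qed.
Let hCnu s : 0 < s -> in_Cnu nu (f ^~ s).
Proof. by move=> s0; case: hS => _ _ _ /(_ s s0) []. Qed.
Let hw s : 0 < s -> weighted_int nu w0 (f ^~ s).
Proof. by move=> /hCnu; exact: in_Cnu_weighted_int. Qed.
Let mf s : 0 < s -> measurable_fun D (f ^~ s).
Proof. by move=> /hCnu[h _]; exact: measurable_continuous_halfline. Qed.

Let dual s := heatU nu (radial nu (f ^~ s)) x (T - s).

Lemma wnorm_locally_bounded s0 : 0 < s0 ->
  exists2 r, 0 < r & forall s, `|s - s0| < r -> wnorm nu (f ^~ s) <= wnorm nu (f ^~ s0) + 1.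
Proof.
move=> s00; case: hS => _ _ _ _ /(_ 1 ltr01)[_ _ /(_ s0 s00)[h1 h2]].
have h : \forall s \near s0, measurable_fun D (fun y => f y s - f y s0) /\
    weighted_int nu w0 (fun y => f y s - f y s0).
  near=> s; have s1 : 0 < s by near: s; exact: lt_nbhsr.
  split; first by apply: measurable_funB; exact: mf.
  by apply: weighted_int_sub; exact: hw.
have c : wnorm nu (fun y => f y s - f y s0) @[s --> s0] --> (0 : R) by exact: wnorm_cvg0 h h1 h2.
move/cvgrPdist_le/(_ 1 ltr01) in c.
have pos : \forall s \near s0, 0 < s by exact: lt_nbhsr.
have /nbhs_ballP[r r0 hr] : nbhs s0 [set s | `|0 - wnorm nu (fun y => f y s - f y s0)| <= 1 /\ 0 < s].
  exact: filterI c pos.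
exists r => // s sr; have /= [] := hr s; first by rewrite /ball/= distrC.
rewrite sub0r normrN (ger0_norm (wnorm_ge0 _ _)) => hle s1.
by apply: le_trans (wnorm_le_sub (hw s1) (hw s00)) _; rewrite lerD2l.
Unshelve. all: by end_near. Qed.

Lemma truncated_cvg s : 0 < s < T ->
  truncated nu x T f n.+1%:R^-1 n.+1%:R s @[n --> \oo] --> dual s.
Proof.
move=> hs; have /andP[s0 sT] := hs; have t0 : 0 < T - s by rewrite subr_gt0.
have mD := @measurable_halfline R.
pose F n y := f y s * (poleK0 nu x y (T - s) * cutoff n.+1%:R y) * y `^ (2 * nu + 1).
pose I n := `[n.+1%:R^-1, n.+1%:R]%classic : set R.
have subI n : I n `<=` D.
  move=> y; rewrite /I /= !in_itv/= => /andP[ay _].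
  by rewrite andbT (lt_le_trans _ ay)// invr_gt0.
have tE n : truncated nu x T f n.+1%:R^-1 n.+1%:R s = \int[mu]_(y in D) ((F n) \_ (I n)) y.
  by rewrite -Rintegral_mkcondr setIC (setIidl (subI n)).
rewrite (eq_cvg _ _ tE) /dual /heatU.
have mF n : measurable_fun D (F n \_ (I n)).
  apply/measurable_restrict => //; first exact: measurable_itv.
  apply: (measurable_funS mD); first exact: subIset (or_introl _ (@subset_refl _ _)).
  apply: measurable_continuous_halfline => y y0.
  (* Half of the upper end serves as the lower end in [continuous_truncated], which is stated for a
     pair [a < b]. *)
  have n1 : (n.+1%:R / 2 : R) < n.+1%:R by rewrite ltr_pdivrMr// ltr_pMr// ltr1n.
  have n0 : (0 : R) < n.+1%:R / 2 by rewrite divr_gt0.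
  have [h _] := continuous_truncated x hn hf n0 n1 y0 hs.
  exact: (continuous_slice h).
have tmp : tempered (radial nu (f ^~ s)) := weighted_int_tempered (hw s0).
have iG := integrable_norm (integrable_heatU x hn t0 tmp).
apply: (Rdominated_cvg mD mF _ iG).
- move=> y; rewrite /= in_itv/= andbT => y0.
  have [N /andP[N1 N2]] := harmonic_exhaustion y0.
  apply: (@cvg_trans _ (F n y @[n --> \oo])).
    apply: near_eq_cvg; exists N => // n /= Nn.
    have NnR : (N.+1%:R : R) <= n.+1%:R by rewrite ler_nat.
    rewrite patchE mem_set// /I /= in_itv/= (le_trans N2)// andbT.
    by apply: le_trans N1; rewrite lef_pV2 ?posrE.
  have -> : radial nu (f ^~ s) y * heatK nu x y (T - s) =
    f y s * (poleK0 nu x y (T - s) * 1) * y `^ (2 * nu + 1).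
    by rewrite /radial /poleK0 (heatKC nu y); ring.
  apply: cvgM; last exact: cvg_cst.
  apply: cvgM; first exact: cvg_cst.
  by apply: cvgM; [exact: cvg_cst|exact: cutoff_cvg].
- move=> n y; rewrite /= in_itv/= andbT => y0.
  rewrite patchE; case: ifPn => [|_]; last by rewrite normr0.
  rewrite inE /I /= in_itv/= => /andP[_ yn].
  have [/andP[c0 c1] _ _] := cutoff_bounds y0 yn.
  have -> : F n y = radial nu (f ^~ s) y * heatK nu x y (T - s) * cutoff n.+1%:R y.
    by rewrite /F /radial /poleK0 (heatKC nu y); ring.
  by rewrite [leLHS]normrM (ger0_norm c0) ler_piMr.
Qed.

(** One radius serves all large truncations, since the flux at 0 and the norm of f are controlled
    locally uniformly in time. Their common Lipschitz constant e is inherited by the pointwise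
    limit. *)
Lemma dual_flat s0 e : 0 < s0 < T -> 0 < e ->
  exists2 r, 0 < r & forall s, `|s - s0| < r -> `|dual s - dual s0| <= e * `|s - s0|.
Proof.
move=> /andP[s00 s0T] e0; have hN : neumann_condition nu f by case: hS.
have t10 : 0 < (T - s0) / 2 by rewrite divr_gt0// subr_gt0.
have t12 : (T - s0) / 2 <= T by lra.
have [C C0 hC] := truncated_rate_le x T hn hf he hw t10 t12.
have e40 : 0 < e / (4 * C) by rewrite divr_gt0// mulr_gt0.
have [r1 [a1 [r10 a10 hfl]]] := flux_boundary hn hf hN s00 e40.
have [r2 r20 hr2] := wnorm_locally_bounded s00.
set M := wnorm nu (f ^~ s0) + 1 in hr2.
have M0 : 0 <= M by rewrite addr_ge0// wnorm_ge0.
pose r := Num.min (Num.min r1 r2) (Num.min s0 ((T - s0) / 2)).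
have hr s : `|s - s0| < r -> [/\ `|s - s0| < r1, `|s - s0| < r2, 0 < s, s < T & (T - s0) / 2 <= T - s <= T].
  rewrite !lt_min => /andP[/andP[-> ->] /andP[]].
  rewrite !ltr_norml => /andP[q1 _] /andP[q3 q4]; split => //; lra.
exists r; first by rewrite !lt_min r10 r20 s00 t10.
have [N hN1 hN2] : exists2 N : nat, (N.+1%:R^-1 : R) <= a1 & 2 * C * M / e <= N.+1%:R.
  have [N1 /andP[h1 _]] := harmonic_exhaustion a10.
  have hp : 0 < 2 * C * M / e + 1 by rewrite ltr_wpDl// divr_ge0 ?mulr_ge0 ?(ltW C0) ?(ltW e0).
  have [N2 /andP[_ h2]] := harmonic_exhaustion hp.
  exists (maxn N1 N2).
    apply: le_trans h1; rewrite lef_pV2 ?posrE// ler_nat ltnS; exact: leq_maxl.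
  apply: (@le_trans _ _ N2.+1%:R); first by apply: le_trans h2; rewrite lerDl.
  by rewrite ler_nat ltnS; exact: leq_maxr.
(* The condition n >= 1 makes the interval nondegenerate. The choice of N gives e / 2 for the flux
   and, as b^-2 <= b^-1, e / 2 for the commutator. *)
have rate n s : (maxn N 1 <= n)%N -> `|s - s0| < r ->
    is_derive s 1 (truncated nu x T f n.+1%:R^-1 n.+1%:R)
      (\int[mu]_(y in `[n.+1%:R^-1, n.+1%:R]) truncated_rate nu x T f n.+1%:R y s) /\
    `|\int[mu]_(y in `[n.+1%:R^-1, n.+1%:R]) truncated_rate nu x T f n.+1%:R y s| <= e.
  rewrite geq_max => /andP[Nn n1] /hr[h1 h2 s1 s2 h3].
  have a0 : (0 : R) < n.+1%:R^-1 by rewrite invr_gt0.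
  have b1 : (1 : R) <= n.+1%:R by rewrite ler1n.
  have b2 : (1 : R) < n.+1%:R by rewrite ltr1n.
  have a1' : (n.+1%:R^-1 : R) <= 1 by rewrite invf_le1.
  have ab : (n.+1%:R^-1 : R) < n.+1%:R by exact: le_lt_trans a1' b2.
  have NnR : (N.+1%:R : R) <= n.+1%:R by rewrite ler_nat.
  split; first by apply: is_derive_truncated => //; rewrite s1.
  have a01 : 0 < (n.+1%:R^-1 : R) <= 1 by rewrite a0.
  apply: le_trans (hC _ _ _ a01 b1 ab s1 h3) _.
  have [i1 i2] : n.+1%:R^-1 `^ (2 * nu + 1) * `|dy f n.+1%:R^-1 s| <= e / (4 * C) /\
     n.+1%:R^-1 `^ (2 * nu + 2) * `|f n.+1%:R^-1 s| <= e / (4 * C).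
    by apply: hfl => //; apply: le_trans hN1; rewrite lef_pV2 ?posrE.
  have -> : e = C * (e / (4 * C) + e / (4 * C)) + e / 2 by field; rewrite gt_eqF.
  apply: lerD; first by rewrite ler_pM2l// lerD.
  apply: (@le_trans _ _ (C / n.+1%:R * M)).
    apply: ler_pM; rewrite ?wnorm_ge0 ?divr_ge0 ?(ltW C0) ?sqr_ge0 ?hr2//.
    by rewrite ler_pM2l// lef_pV2 ?posrE ?exprn_gt0// expr2 ler_peMl.
  rewrite mulrAC ler_pdivrMr//.
  have : 2 * C * M / e <= n.+1%:R by exact: le_trans NnR.
  by rewrite ler_pdivrMr// => h; lra.
move=> s hs.
have [_ _ s1 s2 _] := hr s hs.
have c1 := @truncated_cvg s (introT andP (conj s1 s2)).
have c2 := @truncated_cvg s0 (introT andP (conj s00 s0T)).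
apply: (ler_cvg_to (cvg_norm (cvgB c1 c2)) (cvg_cst (e * `|s - s0|))).
exists (maxn N 1) => // n /= Nn.
exact: (lipschitz_derive (ltW e0) (fun s hs => rate n s Nn hs)).
Qed.

Lemma dual_constant s1 s2 : 0 < s1 -> s1 <= s2 -> s2 < T -> dual s1 = dual s2.
Proof.
move=> s10 s12 s2T.
have h s : s1 <= s <= s2 -> is_derive s 1 dual 0.
  move=> /andP[h1 h2]; apply: flat_is_derive0 => e e0; apply: dual_flat => //.
  by rewrite (lt_le_trans s10 h1)/= (le_lt_trans h2 s2T).
have h1 s : s \in `]s1, s2[ -> is_derive s 1 dual 0.
  by rewrite in_itv/= => /andP[q1 q2]; apply: h; rewrite !ltW.
have h2 : {within `[s1, s2], continuous dual}.
  apply: continuous_in_subspaceT => q; rewrite inE/= in_itv/= => hq.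
  exact: is_derive_continuous (h q hq).
by have [c _] := MVT_segment s12 h1 h2; rewrite mul0r => /eqP; rewrite subr_eq0 => /eqP.
Qed.

Lemma heatU_le_wnorm (g : R -> R) (C1 C2 t : R) : 0 < C1 -> 0 < t -> weighted_int nu w0 g ->
  (forall y, heatK nu x y t <= C1 * (C2 * cweight w0 y)) ->
  `|heatU nu (radial nu g) x t| <= C1 * C2 * wnorm nu g.
Proof.
move=> C10 t0 ig hK; have mD := @measurable_halfline R.
have tmp := weighted_int_tempered ig.
apply: le_trans (le_heatU_abs x hn t0 tmp) _.
rewrite -RintegralZl//; last exact: wnorm_integrable.
apply: le_Rintegral => //.
- exact: (@integrable_heatU _ nu (fun y => `|radial nu g y|) x t hn t0 (tempered_abs tmp)).
- exact: integrable_scale mD (wnorm_integrable ig).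
- move=> y _; have -> : C1 * C2 * (`|radial nu g y| * cweight w0 y) =
    `|radial nu g y| * (C1 * (C2 * cweight w0 y)) by ring.
  by rewrite ler_wpM2l.
Qed.

(** Split f(., s) into f(., s) - phi and phi. For the difference, T - s stays in [[T / 2, T]], where
    a multiple of the weight dominates the kernel; for phi it is continuity of its potential in
    time. *)
Lemma dual_initial : dual s @[s --> 0^'+] --> heatU nu (radial nu phi) x T.
Proof.
have iphi : weighted_int nu w0 phi by exact: in_Cnu_weighted_int.
have mphi : measurable_fun D phi.
  by have [h _] := hphi; exact: measurable_continuous_halfline.
have T20 : 0 < T / 2 by rewrite divr_gt0.
have T2 : T / 2 <= T by rewrite ler_pdivrMr// ler_peMr ?ler1n ?(ltW T0).
have [C1 C10 hC1] := poleK_gaussian x hn T20 T2.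
have c80 : 0 < (8 * T)^-1 by rewrite invr_gt0 mulr_gt0.
have [C2 C20 hC2] := gaussian_le_cweight w0 c80.
have c0 : heatU nu (radial nu phi) x (T - s) @[s --> 0^'+] --> heatU nu (radial nu phi) x T.
  have h := continuous_heatU (x := x) hn T0 (weighted_int_tempered iphi).
  apply: (@cvg_comp _ _ _ (fun s => (x, T - s))
    (fun z : R * R => heatU nu (radial nu phi) z.1 z.2) _ (nbhs (x, T))); last exact: h.
  have h2 : T - s @[s --> 0^'+] --> T.
    rewrite -[X in _ --> X]subr0; apply: cvgB; first exact: cvg_cst.
    exact: cvg_at_right_filter cvg_id.
  exact: (cvg_pair (cvg_cst x) h2).
case: hS => _ _ _ _ /(_ 1 ltr01)[h1 h2 _].
have h : \forall s \near 0^'+, measurable_fun D (fun y => f y s - phi y) /\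
    weighted_int nu w0 (fun y => f y s - phi y).
  near=> s; have s1 : 0 < s by near: s; exact: nbhs_right_gt.
  split; first by apply: measurable_funB => //; exact: mf.
  by apply: weighted_int_sub => //; exact: hw.
have cw : C1 * C2 * wnorm nu (fun y => f y s - phi y) @[s --> 0^'+] --> (0 : R).
  rewrite -[X in _ --> X](mulr0 (C1 * C2)); apply: cvgM; first exact: cvg_cst.
  exact: wnorm_cvg0 h h1 h2.
have cd : heatU nu (radial nu (fun y => f y s - phi y)) x (T - s) @[s --> 0^'+] --> (0 : R).
  apply: norm_cvg0; apply: (squeeze_cvgr _ (cvg_cst (0 : R)) cw).
  near=> s; have s1 : 0 < s by near: s; exact: nbhs_right_gt.
  have s2 : s < T / 2 by near: s; exact: nbhs_right_lt.
  rewrite normr_ge0/=.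
  have hs : T / 2 <= T - s <= T by apply/andP; split; lra.
  have iw : weighted_int nu w0 (fun y => f y s - phi y).
    by apply: weighted_int_sub => //; exact: hw.
  have t0 : 0 < T - s by case/andP: hs => q _; exact: lt_le_trans q.
  apply: heatU_le_wnorm => // y.
  have [/andP[_ h0] _] := hC1 y _ hs.
  rewrite (heatKC nu x) (le_trans h0)// ler_pM2l//; exact: hC2.
rewrite -[X in _ --> X]add0r.
apply: (@cvg_trans _ ((heatU nu (radial nu (fun y => f y s - phi y)) x (T - s)
   + heatU nu (radial nu phi) x (T - s)) @[s --> 0^'+])); last exact: cvgD.
apply: near_eq_cvg; near=> s.
have s1 : 0 < s by near: s; exact: nbhs_right_gt.
have s2 : s < T by near: s; exact: nbhs_right_lt.
have t0 : 0 < T - s by rewrite subr_gt0.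
rewrite (@heatU_eq _ nu _ (fun y => radial nu (f ^~ s) y - radial nu phi y)); last first.
  by move=> y _; rewrite /radial mulrBl.
rewrite heatU_sub//; [|exact: weighted_int_tempered (hw s1)|exact: weighted_int_tempered iphi].
by rewrite subrK.
Unshelve. all: by end_near. Qed.

(** Near the pole, joint continuity of f at (x, T) compares f(., s) with f(x, T); away from it the
    error is T - s times a norm of f(., s), which is bounded for s near T. *)
Lemma dual_final : dual s @[s --> T^'-] --> f x T.
Proof.
apply/cvgrPdist_le => e e0.
have e20 : 0 < e / 2 by rewrite divr_gt0.
have [_ [cf _ _ _]] := hf.
have := cf x T x0 T0 => /cvgrPdist_le/(_ _ e20)[[A B] /= [/nbhs_ballP[d d0 hA] hB] hAB].
have [C C0 hC] := heatU_near hn x0 d0.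
have c0 : 0 < (32^-1 : R) by rewrite invr_gt0.
have [C2 C20 hC2] := gaussian_le_cweight w0 c0.
have [r r0 hr] := wnorm_locally_bounded T0.
(* Bounds, uniformly for s near T, the error of [heatU_near] divided by the elapsed time T - s: the
   weight dominates the Gaussian, and the norm of f(., s) is at most its value at T plus 1. *)
pose K := C * (C2 * (wnorm nu (f ^~ T) + 1) + `|f x T|).
have K0 : 0 <= K.
  by rewrite mulr_ge0 ?(ltW C0)// addr_ge0// mulr_ge0 ?(ltW C20)// addr_ge0 ?wnorm_ge0.
have mD := @measurable_halfline R.
near=> s.
have sT : s < T by near: s; exact: nbhs_left_lt.
have s1 : 0 < s by near: s; exact: nbhs_left_gt.
have t1 : T - s <= 1.
  by rewrite lerBlDr -lerBlDl ltW//; near: s; apply: nbhs_left_gt; rewrite ltrBlDr ltrDl.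
have sr : `|s - T| < r.
  rewrite distrC gtr0_norm ?subr_gt0// ltrBlDr -ltrBlDl.
  by near: s; apply: nbhs_left_gt; rewrite ltrBlDr ltrDl.
have tK : (T - s) * (K + 1) <= e / 2.
  rewrite -ler_pdivlMr ?ltr_wpDl// lerBlDr -lerBlDl ltW//.
  by near: s; apply: nbhs_left_gt; rewrite ltrBlDr ltrDl divr_gt0// ltr_wpDl.
have sB : B s.
  by near: s; apply: (cvg_at_left_filter cvg_id).
rewrite distrC.
have t0 : 0 < T - s <= 1 by rewrite subr_gt0 sT.
have xx : 0 < x <= x by rewrite x0 lexx.
have hne y : 0 < y -> `|y - x| < d -> `|f y s - f x T| <= e / 2.
  move=> y0 yd; rewrite distrC; apply: (hAB (y, s)); split => //=.
  by apply: hA; rewrite /ball/= distrC.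
have tmp := weighted_int_tempered (hw s1).
apply: le_trans (hC _ (f x T) (e / 2) x (T - s) xx t0 (ltW e20) tmp hne) _.
rewrite [leRHS](splitr e) lerD2l.
apply: le_trans tK; rewrite (mulrC C) -mulrA ler_wpM2l ?subr_ge0 ?(ltW sT)//.
apply: (@le_trans _ _ K); last by rewrite lerDl.
rewrite ler_wpM2l ?(ltW C0)// lerD2r.
apply: (@le_trans _ _ (C2 * wnorm nu (f ^~ s))); last by rewrite ler_wpM2l ?(ltW C20)// hr.
rewrite -RintegralZl//; last exact: wnorm_integrable (hw s1).
apply: le_Rintegral => //.
- apply: eq_integrable (integrable_norm (tmp _ c0)) => // y _.
  by rewrite /= normrM (ger0_norm (expR_ge0 _)).
- exact: integrable_scale mD (wnorm_integrable (hw s1)).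
- by move=> y _; rewrite [leRHS]mulrCA ler_wpM2l.
Unshelve. all: by end_near. Qed.

Lemma uniqueness_at : f x T = heatU nu (radial nu phi) x T.
Proof.
have T20 : 0 < T / 2 by rewrite divr_gt0.
have T2 : T / 2 < T by rewrite ltr_pdivrMr// ltr_pMr// ltr1n.
have e1 : f x T = dual (T / 2).
  apply: cvg_unique dual_final _ => //.
  apply: cvg_near_cst; near=> s.
  have s2 : T / 2 <= s by apply: ltW; near: s; exact: nbhs_left_gt.
  exact/esym/dual_constant.
rewrite e1; apply: (cvg_unique _ _ dual_initial) => //.
apply: cvg_near_cst; near=> s.
have s2 : s <= T / 2 by apply: ltW; near: s; exact: nbhs_right_lt.
exact/dual_constant.
Unshelve. all: by end_near. Qed.

End uniqueness.

(** * Solutions depend only on values at positive arguments *)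

Section solution_congruence.
Context {R : realType}.
Implicit Types (nu y t : R).

Lemma near_gt0 y : 0 < y -> \forall z \near y, 0 < z.
Proof. exact: lt_nbhsr. Qed.

Lemma Cnu_eq nu (h h' : R -> R) (r : R) : 0 < r -> (forall y, 0 < y -> h y = h' y) ->
  Cnu_near nu r h = Cnu_near nu r h' /\ Cnu_far nu r h = Cnu_far nu r h'.
Proof.
move=> r0 hh; split; apply: eq_integral => y.
  by rewrite inE/= in_itv/= => /andP[y0 _]; rewrite hh.
by rewrite inE/= in_itv/= andbT => ry; rewrite hh// (lt_trans r0).
Qed.

Lemma in_Cnu_eq nu (f g : R -> R) : (forall y, 0 < y -> f y = g y) ->
  in_Cnu nu g -> in_Cnu nu f.
Proof.
move=> fg [cg ig]; split=> [y y0|r r0].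
  apply: continuous_eq_near (cg y y0).
  by apply: filterS (near_gt0 y0) => z; exact: fg.
by have [-> ->] := Cnu_eq nu r0 fg; exact: ig.
Qed.

Lemma derive1_eq_halfline (f g : R -> R) y : (forall y, 0 < y -> f y = g y) -> 0 < y ->
  (derivable g y 1 -> derivable f y 1) /\ derive1 f y = derive1 g y.
Proof.
move=> fg y0; have e : \forall z \near y, g z = f z.
  by apply: filterS (near_gt0 y0) => z z0; rewrite fg.
split; first exact: near_eq_derivable.
by rewrite !derive1E; apply/esym; exact: near_eq_derive.
Qed.

Lemma in_C1nu_eq nu (f g : R -> R) : (forall y, 0 < y -> f y = g y) ->
  in_C1nu nu g -> in_C1nu nu f.
Proof.
move=> fg [d c i1 i2]; have fg' y : 0 < y -> derive1 f y = derive1 g y.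
  by move=> y0; have [] := derive1_eq_halfline fg y0.
split.
- by move=> y y0; have [h _] := derive1_eq_halfline fg y0; apply: h; exact: d.
- move=> y y0; apply: continuous_eq_near (c y y0).
  by apply: filterS (near_gt0 y0) => z; exact: fg'.
- exact: in_Cnu_eq i1.
- by apply: in_Cnu_eq i2 => y y0; rewrite fg'.
Qed.

Lemma jointly_continuous_eq (f g : R -> R -> R) :
  (forall y t, 0 < y -> 0 < t -> f y t = g y t) ->
  jointly_continuous g -> jointly_continuous f.
Proof.
move=> fg cg y t y0 t0; apply: continuous_eq_near (cg y t y0 t0).
have h1 : \forall z \near (y, t), 0 < z.1 by exact: near_fst_gt0.
have h2 : \forall z \near (y, t), 0 < z.2 by exact: near_snd_gt0.
by apply: filterS2 h1 h2 => z; exact: fg.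
Qed.

Context (nu : R) (phi : R -> R) (f g : R -> R -> R).
Hypothesis fg : forall y t, 0 < y -> 0 < t -> f y t = g y t.

Let fg_dy y t : 0 < y -> 0 < t -> dy f y t = dy g y t.
Proof. by move=> y0 t0; have [] := @derive1_eq_halfline (f ^~ t) (g ^~ t) y (fun z z0 => fg z0 t0) y0. Qed.

Let fg_dyy y t : 0 < y -> 0 < t -> dy (dy f) y t = dy (dy g) y t.
Proof. by move=> y0 t0; have [] := @derive1_eq_halfline (dy f ^~ t) (dy g ^~ t) y
    (fun z z0 => fg_dy z0 t0) y0. Qed.

Let fg_dt y t : 0 < y -> 0 < t -> dt f y t = dt g y t.
Proof. by move=> y0 t0; have [] := @derive1_eq_halfline (f y) (g y) t (fun z z0 => fg y0 z0) t0. Qed.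

Lemma C21_eq : C21 g -> C21 f.
Proof.
move=> [d [c1 c2 c3 c4]]; split.
  move=> y t y0 t0; have [d1 d2 d3] := d y t y0 t0; split.
  - by have [h _] := @derive1_eq_halfline (f ^~ t) (g ^~ t) y (fun z z0 => fg z0 t0) y0; exact: (h d1).
  - by have [h _] := @derive1_eq_halfline (dy f ^~ t) (dy g ^~ t) y
    (fun z z0 => fg_dy z0 t0) y0; exact: (h d2).
  - by have [h _] := @derive1_eq_halfline (f y) (g y) t (fun z z0 => fg y0 z0) t0; exact: (h d3).
split; [exact: jointly_continuous_eq c1|exact: jointly_continuous_eq c2
  |exact: jointly_continuous_eq c3|exact: jointly_continuous_eq c4].
Qed.

Lemma initial_datum_eq : initial_datum phi g -> initial_datum phi f.
Proof.
move=> h y y0; apply: cvg_trans (h y y0); apply: near_eq_cvg.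
have h1 : \forall z \near (y, 0 : R), 0 < z.1 by exact: near_fst_gt0.
by apply: filterS h1 => z z1 z2; rewrite fg.
Qed.

Lemma neumann_condition_eq : neumann_condition nu g -> neumann_condition nu f.
Proof.
move=> h t t0; apply: cvg_trans (h t t0); apply: near_eq_cvg.
have h2 : \forall z \near (0 : R, t), 0 < z.2 by exact: near_snd_gt0.
by apply: filterS h2 => z z2 z1; rewrite fg_dy.
Qed.

Lemma continuous_in_Cnu_eq : continuous_in_Cnu nu phi g -> continuous_in_Cnu nu phi f.
Proof.
move=> h r r0; have [h1 h2 h3] := h r r0.
have pos : \forall t \near 0^'+, 0 < (t : R) by exact: nbhs_right_gt.
have e t (k : R -> R) : 0 < t ->
    Cnu_near nu r (fun y => g y t - k y) = Cnu_near nu r (fun y => f y t - k y) /\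
    Cnu_far nu r (fun y => g y t - k y) = Cnu_far nu r (fun y => f y t - k y).
  by move=> t0; apply: Cnu_eq => // y y0; rewrite fg.
split.
- by apply: cvg_trans h1; apply: near_eq_cvg; apply: filterS pos => t /(e t phi)[].
- by apply: cvg_trans h2; apply: near_eq_cvg; apply: filterS pos => t /(e t phi)[].
move=> s s0; have [h4 h5] := h3 s s0.
have e' t : 0 < t ->
    Cnu_near nu r (fun y => g y t - g y s) = Cnu_near nu r (fun y => f y t - f y s) /\
    Cnu_far nu r (fun y => g y t - g y s) = Cnu_far nu r (fun y => f y t - f y s).
  by move=> t0; apply: Cnu_eq => // y y0; rewrite !fg.
split.
- by apply: cvg_trans h4; apply: near_eq_cvg; apply: filterS (near_gt0 s0) => t /e'[].
- by apply: cvg_trans h5; apply: near_eq_cvg; apply: filterS (near_gt0 s0) => t /e'[].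
Qed.

(** Transfers the solution property from [heatU] to [kernel_operator]: the two are identified only
    for positive x and t, where powers of xy / (2t) have a positive base, and every clause is local
    in that region. *)
Lemma cauchy_neumann_solution_eq :
  cauchy_neumann_solution nu phi g -> cauchy_neumann_solution nu phi f.
Proof.
move=> [[c e] i n c1 cc]; split.
- split; first exact: C21_eq.
  by move=> y t y0 t0; rewrite fg_dyy// fg_dy// fg_dt//; exact: e.
- exact: initial_datum_eq.
- exact: neumann_condition_eq.
- by move=> t t0; apply: in_C1nu_eq (c1 t t0) => y y0; exact: fg.
- exact: continuous_in_Cnu_eq.
Qed.

End solution_congruence.

(** * The kernel operator as a heat potential *)

Section kernel.
Context {R : realType}.
Notation mu := (@lebesgue_measure R).
Notation D := (`]0%R, +oo[%classic : set R).
Implicit Types (nu x y t : R) (phi : R -> R).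

Lemma kernel_integrandE nu phi x y t : -1 < nu -> 0 < x -> 0 < y -> 0 < t ->
  phi y * pN nu x y t * y `^ (2 * nu + 1) = radial nu phi y * heatK nu x y t.
Proof. by move=> hn x0 y0 t0; rewrite pN_heatK// mulrAC. Qed.

Lemma kernel_operatorE nu phi x t : -1 < nu -> 0 < x -> 0 < t ->
  kernel_operator nu (pN nu) phi x t = heatU nu (radial nu phi) x t.
Proof.
move=> hn x0 t0; apply: eq_Rintegral => y.
by rewrite inE/= in_itv/= andbT => y0; exact: kernel_integrandE.
Qed.

Lemma kernel_integrable nu phi x t : -1 < nu -> in_Cnu nu phi -> 0 < x -> 0 < t ->
  mu.-integrable D (fun y => (phi y * pN nu x y t * y `^ (2 * nu + 1))%:E).
Proof.
move=> hn hphi x0 t0.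
have h := integrable_heatU x hn t0 (weighted_int_tempered (in_Cnu_weighted_int hphi)).
apply: eq_integrable h; first exact: measurable_halfline.
by move=> y; rewrite inE/= in_itv/= andbT => y0; rewrite kernel_integrandE.
Qed.

End kernel.

Unset Implicit Arguments.

Theorem proposition22p3 (R : realType) (nu : R) (hnu : -1 < nu) :
  (forall x y t : R, 0 < x -> 0 < y -> 0 < t -> pN nu x y t = pN nu y x t) /\
  is_neumann_heat_kernel nu (pN nu).
Proof.
split=> [x y t _ _ _|phi [_ _ hphi _]].
  by rewrite /pN (mulrC x y) (addrC (x ^+ 2)).
split=> [x t x0 t0||f hf x t x0 t0].
- exact: kernel_integrable.
- apply: cauchy_neumann_solution_eq (heatU_cauchy_neumann hnu hphi) => y t y0 t0.
  exact: kernel_operatorE.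
- by rewrite kernel_operatorE//; exact: uniqueness_at.
Qed.
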